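(* Let $N\ge 2$, let $\Omega\subset\mathbb{R}^N$ be a bounded and smooth domain, and let $p>N$. For each $q\ge 1$ let $w_q$ denote a positive extremal function of $\lambda_q(\Omega)$. Then there exist a sequence $q_n\to\infty$ and a nonnegative function $w\in W_0^{1,p}(\Omega)\cap C(\overline{\Omega})$ such that $w_{q_n}\to w$ strongly in $C(\overline{\Omega})$ and also strongly in $W_0^{1,p}(\Omega)$. Moreover, $w$ is an extremal function of $\Lambda_p(\Omega)$, that is, $\|\nabla w\|_p^p=\Lambda_p(\Omega)$ and $\|w\|_\infty=1$.
   Context: A domain is a nonempty connected open set. $\|\cdot\|_s$ denotes the standard norm of $L^s(\Omega)$, $1\le s\le\infty$. For fixed $p>N$ and $q\ge 1$, $$\lambda_q(\Omega):=\inf\left\{\|\nabla u\|_p^p: u\in W_0^{1,p}(\Omega)\text{ and }\|u\|_q=1\right\}.$$ A positive extremal function of $\lambda_q(\Omega)$ is a function $w_q\in W_0^{1,p}(\Omega)$ with $w_q>0$ in $\Omega$, $\|w_q\|_q=1$ and $\|\nabla w_q\|_p^p=\lambda_q(\Omega)$ (such functions exist). The constant $\Lambda_p(\Omega)$ is defined by $\Lambda_p(\Omega):=\lim_{q\to\infty}\lambda_q(\Omega)$ (the limit exists). A function $v\in W_0^{1,p}(\Omega)$ is called an extremal function of $\Lambda_p(\Omega)$ if $\|\nabla v\|_p^p=\Lambda_p(\Omega)$ and $\|v\|_\infty=1$. Elements of $W_0^{1,p}(\Omega)$, $p>N$, are identified with their continuous representatives on $\overline{\Omega}$. *)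

(* Defs.v *)
From HB Require Import structures.
From mathcomp Require Import all_boot all_order all_algebra.
From mathcomp Require Import all_classical all_reals all_analysis.
Set Implicit Arguments.
Unset Strict Implicit.
Unset Printing Implicit Defensive.
Import Order.TTheory GRing.Theory Num.Theory.
Import numFieldNormedType.Exports.
Local Open Scope classical_set_scope.
Local Open Scope ring_scope.

(* Row vectors carry the product sigma-algebra, exactly as tuples do in the
   library; on 'rV[R]_n this is the Borel sigma-algebra. *)
Section measurable_rV.
Context {R : realType}.
Variable n : nat.

Let coors : 'I_n -> 'rV[R]_n -> R := fun i x => x 0 i.

Let rV_set0 : g_sigma_preimage coors set0.
Proof. exact: sigma_algebra0. Qed.

Let rV_setC A : g_sigma_preimage coors A -> g_sigma_preimage coors (~` A).
Proof. exact: sigma_algebraC. Qed.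

Let rV_bigcup (F : _^nat) : (forall i, g_sigma_preimage coors (F i)) ->
  g_sigma_preimage coors (\bigcup_i (F i)).
Proof. exact: sigma_algebra_bigcup. Qed.

HB.instance Definition _ :=
  @isMeasurable.Build (measure_tuple_display default_measure_display)
    'rV[R]_n (g_sigma_preimage coors) rV_set0 rV_setC rV_bigcup.

Lemma measurable_rV_coord (i : 'I_n) :
  measurable_fun [set: 'rV[R]_n] (fun x : 'rV[R]_n => x 0 i).
Proof.
move=> _ Y mY; rewrite setTI; apply: sub_sigma_algebra => /=.
rewrite -bigcup_seq/=; exists i => /=; first by rewrite mem_index_enum.
by exists Y => //; rewrite setTI.
Qed.

Lemma measurable_fun_rV d (T : measurableType d) (f : T -> 'rV[R]_n) :
  (forall i, measurable_fun [set: T] (fun x => f x 0 i)) ->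
  measurable_fun [set: T] f.
Proof.
move=> mf.
suff H : measurable `<=` [set B : set 'rV[R]_n | measurable (f @^-1` B)].
  by move=> _ B mB; rewrite setTI; exact: H.
apply: smallest_sub.
  split=> /=.
  - by rewrite preimage_set0.
  - by move=> B mB; rewrite setTD preimage_setC; exact: measurableC.
  - by move=> F mF; rewrite preimage_bigcup; exact: bigcupT_measurable.
rewrite -bigcup_seq/=; apply: bigcup_sub => i _.
move=> _ [B mB <-] /=; rewrite setTI.
by have := mf i measurableT B mB; rewrite setTI.
Qed.

End measurable_rV.

Section lebesgue_rV.
Context {R : realType}.

Definition rV_cons n (x : measurableTypeR R * 'rV[R]_n) : 'rV[R]_n.+1 :=
  row_mx (x.1)%:M x.2 : 'rV[R]_(1 + n).

Definition rV_behead n (x : 'rV[R]_n.+1) : 'rV[R]_n :=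
  rsubmx (x : 'rV[R]_(1 + n)).

Lemma rV_cons0 n (x : measurableTypeR R * 'rV[R]_n) : rV_cons x 0 0 = x.1.
Proof.
rewrite /rV_cons (_ : 0 = lshift n (0 : 'I_1)); last exact/val_inj.
by rewrite (row_mxEl (x.1)%:M x.2) mxE eqxx mulr1n.
Qed.
Lemma rV_consS n (x : measurableTypeR R * 'rV[R]_n) (i : 'I_n) :
  rV_cons x 0 (lift 0 i) = x.2 0 i.
Proof.
rewrite /rV_cons (_ : lift 0 i = rshift 1 i); last exact/val_inj.
by rewrite (row_mxEr (x.1)%:M x.2).
Qed.

Lemma rV_consK n (x : measurableTypeR R * 'rV[R]_n) :
  (rV_cons x 0 0, rV_behead (rV_cons x)) = x.
Proof. by rewrite rV_cons0 /rV_behead /rV_cons row_mxKr; case: x. Qed.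

Lemma rV_beheadK n (x : 'rV[R]_n.+1) : rV_cons (x 0 0, rV_behead x) = x.
Proof.
apply/rowP => i; case: (unliftP 0 i) => [j ->|->]; last by rewrite rV_cons0.
by rewrite rV_consS /= mxE; congr (x _ _); exact/val_inj.
Qed.

Lemma measurable_rV_cons n : measurable_fun [set: measurableTypeR R * 'rV[R]_n]
  (@rV_cons n).
Proof.
apply: measurable_fun_rV => i; case: (unliftP 0 i) => [j ->|->].
  under eq_fun do rewrite rV_consS.
  apply: (measurableT_comp (measurable_rV_coord j)).
  exact: measurable_snd.
under eq_fun do rewrite rV_cons0.
exact: measurable_fst.
Qed.

Lemma measurable_rV_behead n : measurable_fun [set: 'rV[R]_n.+1]
  (fun x => ((x 0 0 : measurableTypeR R), rV_behead x)).
Proof.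
apply: measurable_fun_pair; first exact: measurable_rV_coord.
apply: measurable_fun_rV => i.
rewrite (_ : (fun x => _) = (fun x : 'rV[R]_n.+1 => x 0 (rshift 1 i : 'I_(1 + n)))).
  exact: measurable_rV_coord.
by apply/funext => x; rewrite mxE.
Qed.

Section succ.
Variables (n : nat) (mu : {sigma_finite_measure set 'rV[R]_n -> \bar R}).

Definition lebesgue_succ : set 'rV[R]_n.+1 -> \bar R :=
  pushforward (lebesgue_measure \x mu)%E (@rV_cons n).

Let succ0 : lebesgue_succ set0 = 0%E.
Proof. by rewrite /lebesgue_succ /pushforward preimage_set0 measure0. Qed.

Let succ_ge0 A : (0 <= lebesgue_succ A)%E.
Proof. by rewrite /lebesgue_succ /pushforward. Qed.

Let succ_preimage_measurable (A : set 'rV[R]_n.+1) :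
  measurable A -> measurable (@rV_cons n @^-1` A).
Proof.
by move=> mA; have := measurable_rV_cons measurableT mA; rewrite setTI.
Qed.

Let succ_sigma_additive : semi_sigma_additive lebesgue_succ.
Proof.
move=> F mF tF mUF; rewrite /lebesgue_succ /pushforward preimage_bigcup.
apply: measure_semi_sigma_additive.
- by move=> k; exact: succ_preimage_measurable.
- apply/trivIsetP => /= i j _ _ ij; rewrite -preimage_setI.
  by move/trivIsetP : tF => /(_ _ _ _ _ ij) ->//; rewrite preimage_set0.
- by rewrite -preimage_bigcup; exact: succ_preimage_measurable.
Qed.

HB.instance Definition _ := isMeasure.Build _ _ _ lebesgue_succ
  succ0 succ_ge0 succ_sigma_additive.

Let succ_sigma_finite : sigma_finite setT lebesgue_succ.
Proof.
have [F TF Foo] : sigma_finite setT (lebesgue_measure \x mu)%E.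
  have /sigma_finiteP[F [TF ndF Foo]] := sigma_finiteT (@lebesgue_measure R).
  have /sigma_finiteP[G [TG ndG Goo]] := sigma_finiteT mu.
  exists (fun k => F k `*` G k).
    rewrite -setXTT TF TG predeqE => -[x y]; split.
      move=> [/= [k _ Fkx] [j _ Gjy]]; exists (maxn k j) => //; split.
      - by move: x Fkx; exact/subsetPset/ndF/leq_maxl.
      - by move: y Gjy; exact/subsetPset/ndG/leq_maxr.
    by move=> [k _ []/= ? ?]; split; exists k.
  move=> k; have [? ?] := Foo k; have [? ?] := Goo k.
  split; first exact: measurableX.
  by rewrite product_measure1E// lte_mul_pinfty// ge0_fin_numE.
pose f (x : 'rV[R]_n.+1) : measurableTypeR R * 'rV[R]_n := (x 0 0, rV_behead x).
exists (fun k => f @^-1` F k).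
  by rewrite -preimage_bigcup -TF preimage_setT.
move=> k; have [mF Fk] := Foo k; split.
  by have := measurable_rV_behead measurableT mF; rewrite setTI.
rewrite /lebesgue_succ /pushforward -comp_preimage.
rewrite (_ : _ \o _ = id)//; apply/funext => x; exact: rV_consK.
Qed.

HB.instance Definition _ :=
  Measure_isSigmaFinite.Build _ _ _ lebesgue_succ succ_sigma_finite.

End succ.

(* Lebesgue measure on R^n: R^(n+1) is identified with R * R^n through
   rV_cons, and R^0 is a point of mass 1. *)
Fixpoint lebesgue_rV n : {sigma_finite_measure set 'rV[R]_n -> \bar R} :=
  match n with
  | 0 => dirac (0 : 'rV[R]_0)
  | m.+1 => lebesgue_succ (lebesgue_rV m)
  end.

End lebesgue_rV.

Section calculus.
Context {R : realType} {n : nat}.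
Implicit Types (f : 'rV[R]_n -> R) (x : 'rV[R]_n).

Definition enorm x : R := Num.sqrt (\sum_(i < n) x 0 i ^+ 2).

Definition partial (i : 'I_n) f : 'rV[R]_n -> R := 'D_('e_i) f.

Definition iter_partial (s : seq 'I_n) f := foldr partial f s.

(* C^oo on the whole space: partial derivatives of all orders exist and are
   continuous. *)
Definition smooth f := forall s : seq 'I_n,
  continuous (iter_partial s f) /\
  forall i x, derivable (iter_partial s f) x 'e_i.

Definition test_function (Omega : set 'rV[R]_n) f :=
  [/\ smooth f, compact (closure [set x | f x != 0]) &
      closure [set x | f x != 0] `<=` Omega].

End calculus.

(* The boundary is locally the graph of a C^oo function of n - 1 of the
   coordinates, with Omega lying on one side of it; i selects the remaining
   coordinate and b its orientation. *)
Definition smooth_boundary (R : realType) n (Omega : set 'rV[R]_n) :=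
  forall x0, (closure Omega `\` Omega) x0 ->
  exists (r : R) (i : 'I_n) (b : bool) (gamma : 'rV[R]_n.-1 -> R),
    [/\ 0 < r, smooth gamma &
      forall x, ball x0 r x ->
        (Omega x <-> gamma (col' i x) < (-1) ^+ b * x 0 i)].

Definition domain (R : realType) n (Omega : set 'rV[R]_n) :=
  [/\ Omega !=set0, connected Omega & open Omega].

(* Functions are total on R^n; only their values on Omega (or on its closure,
   when continuity there is required) are meaningful. *)
Section sobolev.
Context {R : realType} {n : nat} (Omega : set 'rV[R]_n).
Local Notation leb := (@lebesgue_rV R n).
Implicit Types (u v w : 'rV[R]_n -> R) (G : 'rV[R]_n -> 'rV[R]_n) (p q : R).

Definition normL (s : \bar R) u : \bar R := 'N[leb]_s[EFin \o (u \_ Omega)]%E.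

Definition inL (s : \bar R) u := u \_ Omega \in Lfun leb s.

Definition loc_integrable u := measurable_fun Omega u /\
  forall K, compact K -> K `<=` Omega -> leb.-integrable K (EFin \o u).

Definition weak_gradient u G :=
  [/\ loc_integrable u,
      forall i, loc_integrable (fun x => G x 0 i) &
      forall (i : 'I_n) phi, test_function Omega phi ->
        \int[leb]_(x in Omega) (u x * partial i phi x) =
        - \int[leb]_(x in Omega) (G x 0 i * phi x)].

(* A weak gradient of u, or 0 if there is none; weak gradients are unique
   up to null sets. *)
Definition grad u : 'rV[R]_n -> 'rV[R]_n := xget (fun=> 0) (weak_gradient u).

Definition W1p p u :=
  [/\ inL p%:E u, exists G, weak_gradient u G &
      forall i, inL p%:E (fun x => grad u x 0 i)].

Definition norm_grad p u : \bar R := normL p%:E (fun x => enorm (grad u x)).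

Definition energy p u : \bar R := (norm_grad p u `^ p)%E.

Definition normW1p p u : \bar R := (normL p%:E u + norm_grad p u)%E.

(* The closure of the test functions in W^{1,p}(Omega). *)
Definition W01p p u := W1p p u /\
  forall e : R, 0 < e -> exists2 phi, test_function Omega phi &
    (normW1p p (fun x => (u x - phi x)%R) < e%:E)%E.

Definition lambda p q : \bar R :=
  ereal_inf [set energy p u | u in [set u | W01p p u /\ normL q%:E u = 1%E]].

Definition Lambda p : \bar R := lim (lambda p q @[q --> +oo]).

(* Elements of W_0^{1,p}(Omega), p > n, are represented by the function
   that is continuous on the closure of Omega. *)
Definition CW01p p u := W01p p u /\ {within closure Omega, continuous u}.

Definition positive_extremal p q w :=
  [/\ CW01p p w, forall x, Omega x -> 0 < w x, normL q%:E w = 1%E &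
      energy p w = lambda p q].

Definition extremal_Lambda p v :=
  [/\ CW01p p v, energy p v = Lambda p & normL +oo%E v = 1%E].

End sobolev.

(* Main.v *)
(* The quantity lambda_q |Omega|^(p/q) is nonincreasing in q by Hoelder's
   inequality, so lambda_q converges to a finite Lambda; and any v in
   W_0^{1,p} with v > s > 0 somewhere satisfies Lambda s^p <= |grad v|_p^p,
   since |v|_q >= s |{v > s}|^(1/q).  Morrey's inequality, proved for test
   functions by comparing means over cubes and extended by density, makes the
   w_q equibounded and equicontinuous, so some sequence w_(q_n) converges
   uniformly to a w with sup w = 1.  The midpoints of w_(q_k) and w_(q_l) thus
   have supremum close to 1, hence energy at least almost Lambda; as p > N >= 2,
   Clarkson's inequality then forces the gradients to be Cauchy in L^p.  The
   limit field is the weak gradient of w and has energy Lambda. *)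
Require Import Defs.
From HB Require Import structures.
From mathcomp Require Import finmap.
From mathcomp Require Import all_boot all_order all_algebra.
From mathcomp Require Import all_classical all_reals all_analysis.
From mathcomp Require Import measurable_realfun ess_sup_inf ring lra.
Import Order.TTheory GRing.Theory Num.Theory.
Import numFieldNormedType.Exports.
Local Open Scope classical_set_scope.
Local Open Scope ring_scope.
Set Implicit Arguments.
Unset Strict Implicit.
Unset Printing Implicit Defensive.

(** * Lebesgue measure on row vectors *)

Section lebesgue_rV_theory.
Context {R : realType}.
Local Notation leb := (@lebesgue_rV R).
Implicit Types n : nat.

(** Two mismatches shape the proof. First, [grad] is an arbitrary choice among weak gradients, so
    nothing can be computed with it until weak gradients are known to be unique almost everywhere.
    This needs the fundamental lemma of the calculus of variations, hence explicit smooth bumps,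
    built from polynomials in 1/t times exp(-1/t). Afterwards every Sobolev function travels with a
    named gradient field. Second, [W01p] provides approximation by test functions in norm only,
    while Morrey's inequality is about point values. The mean over a small cube links the two: it is
    continuous in the L^p norm and close to the value at the corner of the cube, both for the
    function and for its approximants. Strong convergence is reached without weak compactness. The
    lower bound on the energy of midpoints takes the place of weak lower semicontinuity, and for
    exponents at least 2 Clarkson's inequality reduces to superadditivity and convexity of t^(p/2)
    together with the parallelogram law. *)

Definition obox n (a b : 'rV[R]_n) : set 'rV[R]_n :=
  [set x | forall i, a 0 i < x 0 i < b 0 i].

Definition cbox n (a b : 'rV[R]_n) : set 'rV[R]_n :=
  [set x | forall i, a 0 i <= x 0 i <= b 0 i].

Lemma measurable_obox n (a b : 'rV[R]_n) : measurable (obox a b).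
Proof.
rewrite (_ : obox a b = \bigcap_(i in [set: 'I_n])
    ((fun x : 'rV[R]_n => x 0 i) @^-1` `]a 0 i, b 0 i[)).
  apply: fin_bigcap_measurable => // i _.
  have := @measurable_rV_coord R n i measurableT _ (measurable_itv `]a 0 i, b 0 i[).
  by rewrite setTI.
apply/seteqP; split => [x bx i _|x bx i]; first by rewrite /= in_itv; exact: bx.
by have := bx i I; rewrite /= in_itv.
Qed.

(** Rational corners leave countably many boxes, so facts known on each box add up to facts on [U].
    The closed box is kept inside [U] because a bump living on it must be a test function. *)
Lemma open_rat_obox n (U : set 'rV[R]_n) x : open U -> U x ->
  exists c : 'rV[rat]_n * 'rV[rat]_n,
    obox (map_mx ratr c.1) (map_mx ratr c.2) x /\
    cbox (map_mx ratr c.1) (map_mx ratr c.2) `<=` U.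
Proof.
move=> oU Ux; have /nbhs_ballP[e /= e0 xe] : nbhs x U by exact: open_nbhs_nbhs.
have /choice[a aP] : forall i : 'I_n, exists c : rat, x 0 i - e / 2 < ratr c < x 0 i.
  move=> i; have [c] := @rat_in_itvoo R (x 0 i - e / 2) (x 0 i) ltac:(lra).
  by rewrite in_itv; exists c.
have /choice[b bP] : forall i : 'I_n, exists c : rat, x 0 i < ratr c < x 0 i + e / 2.
  move=> i; have [c] := @rat_in_itvoo R (x 0 i) (x 0 i + e / 2) ltac:(lra).
  by rewrite in_itv; exists c.
exists (\row_i a i, \row_i b i) => /=; split.
  by move=> i; rewrite !mxE; have /andP[_ ->] := aP i; have /andP[-> _] := bP i.
move=> y yb; apply: xe; split => // i j; rewrite ord1 /ball/=.
have := yb j; rewrite !mxE => /andP[h1 h2].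
have /andP[h3 h4] := aP j; have /andP[h5 h6] := bP j.
by rewrite ltr_norml; apply/andP; split; lra.
Qed.

Lemma open_measurable_rV n (U : set 'rV[R]_n) : open U -> measurable U.
Proof.
move=> oU; pose b (c : 'rV[rat]_n * 'rV[rat]_n) : set 'rV[R]_n :=
  obox (map_mx ratr c.1) (map_mx ratr c.2).
rewrite (_ : U = \bigcup_(c in [set c | b c `<=` U]) b c).
  rewrite bigcup_mkcond; apply: countable_bigcupT_measurable.
    exact: countableP.
  by move=> c; case: ifPn => // _; exact: measurable_obox.
apply/seteqP; split; last by move=> x [c /= cU bx]; exact: cU.
move=> x Ux; have [c [xc cU]] := open_rat_obox oU Ux.
exists c => //= y yc; apply: cU => i; have /andP[h1 h2] := yc i.
by rewrite !ltW.
Qed.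

Lemma continuous_measurable_rV n (f : 'rV[R]_n -> R) :
  continuous f -> measurable_fun [set: 'rV[R]_n] f.
Proof.
move=> /continuousP cf; apply: (measurability _ (RGenOpens.measurableE R)).
move=> _ [_ [a [b ->] <-]]; rewrite setTI; apply: open_measurable_rV.
by apply: cf; exact: interval_open.
Qed.

Lemma measurable_fun_shift_rV n (v : 'rV[R]_n) :
  measurable_fun [set: 'rV[R]_n] (fun x => x + v).
Proof.
apply: measurable_fun_rV => i.
under eq_fun do rewrite mxE.
by apply: measurable_funD => //; exact: measurable_rV_coord.
Qed.

Let lebesgue_measureD (a : R) (B : set R) : measurable B ->
  lebesgue_measure ((fun x => x + a) @^-1` B) = lebesgue_measure B :> \bar R.
Proof.
move=> mB; have ma : measurable_fun [set: measurableTypeR R]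
  ((fun x => x + a) : _ -> measurableTypeR R) by exact: measurable_funD.
apply/esym; pose m := pushforward (@lebesgue_measure R) ((fun x => x + a) : measurableTypeR R -> measurableTypeR R).
apply: (@lebesgue_measure_unique _ m) => //= _ [[x y]] _ <-.
rewrite /m /pushforward/=.
rewrite (_ : _ @^-1` _ = `]x - a, y - a]%classic); last first.
  by apply/seteqP; split => z /=; rewrite !in_itv /= ltrBlDr lerBrDr.
rewrite !lebesgue_measure_itv/= !lte_fin ltrD2r; case: ifPn => // _.
by rewrite -!EFinB; congr EFin; ring.
Qed.

(** Induction on the dimension. Under [rV_cons] a translation splits into one of the first
    coordinate and one of the rest; the pushforward of the product measure under it agrees with the
    product measure on rectangles, which determine that measure. *)
Lemma lebesgue_rVD n (v : 'rV[R]_n) (B : set 'rV[R]_n) : measurable B ->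
  leb n ((fun x => x + v) @^-1` B) = leb n B.
Proof.
elim: n v B => [|n IH] v B mB.
  by rewrite (_ : (fun x => x + v) = id)//; apply/funext => x; apply/rowP; case.
have mC : measurable (@rV_cons R n @^-1` B).
  by have := @measurable_rV_cons R n measurableT _ mB; rewrite setTI.
rewrite /= /lebesgue_succ /pushforward.
pose h (x : measurableTypeR R * 'rV[R]_n) : measurableTypeR R * 'rV[R]_n :=
  (x.1 + v 0 0, x.2 + rV_behead v).
have mh : measurable_fun setT h.
  apply: measurable_fun_pair.
    by apply: measurable_funD => //; exact: measurable_fst.
  apply: (measurableT_comp (measurable_fun_shift_rV _)).
  exact: measurable_snd.
transitivity ((lebesgue_measure \x leb n)%E (h @^-1` (@rV_cons R n @^-1` B))).
  have hE x : rV_cons (h x) = rV_cons x + v.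
    apply/rowP => i; rewrite [RHS]mxE; case: (unliftP 0 i) => [j ->|->].
      by rewrite !rV_consS /= !mxE; congr (_ + v _ _); exact/val_inj.
    by rewrite !rV_cons0.
  by congr (_ _); apply/seteqP; split => x /=; rewrite hE.
pose m := pushforward (lebesgue_measure \x leb n)%E h.
apply/esym; apply: (@product_measure_unique _ _ _ _ _ _ _ m) => //.
move=> X Y mX mY; rewrite [LHS](_ : _ = (lebesgue_measure \x leb n)%E
  (((fun x => x + v 0 0) @^-1` X) `*` ((fun x => x + rV_behead v) @^-1` Y)))//.
rewrite product_measure1E//.
- by rewrite IH//; congr (_ * _)%E; exact: lebesgue_measureD.
- have ma : measurable_fun [set: measurableTypeR R]
    ((fun x => x + v 0 0) : _ -> measurableTypeR R) by exact: measurable_funD.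
  by have := ma measurableT _ mX; rewrite setTI.
- by have := measurable_fun_shift_rV (rV_behead v) measurableT mY; rewrite setTI.
Qed.

(** Half-open sides let a box be cut into two disjoint boxes of the same kind. The second argument
    holds side lengths rather than the far corner, so that a translation changes [a] only. *)
Definition box n (a l : 'rV[R]_n) : set 'rV[R]_n :=
  [set x | forall i, a 0 i <= x 0 i < a 0 i + l 0 i].

Lemma measurable_box n (a l : 'rV[R]_n) : measurable (box a l).
Proof.
rewrite (_ : box a l = \bigcap_(i in [set: 'I_n])
  ((fun x : 'rV[R]_n => x 0 i) @^-1` `[a 0 i, a 0 i + l 0 i[)).
  apply: fin_bigcap_measurable => // i _.
  by have := @measurable_rV_coord R n i measurableT _ (measurable_itv `[a 0 i, a 0 i + l 0 i[); rewrite setTI.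
by apply/seteqP; split => [x bx i _|x bx i] /=; [rewrite in_itv/=; exact: bx|have := bx i I; rewrite /= in_itv].
Qed.

Lemma lebesgue_rV_box n (a l : 'rV[R]_n) : (forall i, 0 <= l 0 i) ->
  leb n (box a l) = (\prod_(i < n) l 0 i)%:E.
Proof.
elim: n a l => [|n IH] a l l0.
  rewrite big_ord0 /= diracE (_ : _ \in _ = true)//.
  by apply/mem_set => -[].
rewrite big_ord_recl /= /lebesgue_succ /pushforward.
rewrite (_ : _ @^-1` _ = (`[a 0 0, a 0 0 + l 0 0[%classic `*` box (rV_behead a) (rV_behead l))); last first.
  apply/seteqP; split => [x bx|x [/= bx bx2] i] /=.
    split.
      by have /= := bx 0; rewrite rV_cons0 in_itv.
    move=> i; have /= := bx (lift 0 i); rewrite rV_consS !mxE.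
    by rewrite (_ : lift 0 i = rshift 1 i)//; exact/val_inj.
  case: (unliftP 0 i) => [j ->|->]; last by rewrite rV_cons0; move: bx; rewrite in_itv.
  have /= := bx2 j; rewrite rV_consS !mxE.
  by rewrite (_ : lift 0 j = rshift 1 j)//; exact/val_inj.
rewrite product_measure1E//=; last exact: measurable_box.
rewrite IH; last by move=> i; rewrite mxE.
rewrite lebesgue_measure_itv/= lte_fin EFinM ltrDl.
have := l0 0; rewrite le_eqVlt => /predU1P[<-|->]; first by rewrite ltxx !mul0e.
rewrite -EFinB addrAC subrr add0r; congr (_ * _%:E)%E; apply: eq_bigr => i _.
by rewrite mxE; congr (l _ _); exact/val_inj.
Qed.

End lebesgue_rV_theory.

(** * Integration on row vectors: translations and derivatives along a coordinate *)

Section lebesgue_rV_integral.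
Context {R : realType} {n : nat}.
Local Notation leb := (@lebesgue_rV R n).
Implicit Types (f : 'rV[R]_n -> R) (x v : 'rV[R]_n) (B : set 'rV[R]_n).

(** Here |x| is the sup norm, so balls of row vectors are cubes; the Euclidean length is [enorm]. *)
Lemma rV_norm_leP x (M : R) : 0 <= M -> `|x| <= M <-> forall i, `|x 0 i| <= M.
Proof.
move=> M0; rewrite {1}/Num.norm /= mx_normrE; split => [xM i|xM].
  by apply: le_trans xM; apply/bigmax_geP; right; exists (0, i).
by apply/bigmax_leP; split => // -[i j] _; rewrite /= ord1.
Qed.

Lemma rV_coord_le x i : `|x 0 i| <= `|x|.
Proof. by move: i; apply/rV_norm_leP. Qed.

Lemma ge0_integral_rVD v (f : 'rV[R]_n -> \bar R) :
  measurable_fun [set: 'rV[R]_n] f -> (forall x, 0 <= f x)%E ->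
  (\int[leb]_x f (x + v)%R = \int[leb]_x f x)%E.
Proof.
move=> mf f0; transitivity (\int[pushforward leb (fun x => x + v)%R]_y f y)%E.
  by rewrite ge0_integral_pushforward//; exact: measurable_fun_shift_rV.
apply: eq_measure_integral => //; first exact: measurable_fun_shift_rV.
by move=> ? B mB _; exact: lebesgue_rVD.
Qed.

Lemma integrable_rVD v f : leb.-integrable setT (EFin \o f) ->
  leb.-integrable setT (EFin \o (fun x => f (x + v))).
Proof.
move=> /integrableP[mf foo]; have ms := measurable_fun_shift_rV v.
apply/integrableP; split.
  exact: (measurableT_comp mf ms).
rewrite (ge0_integral_rVD v (f := fun x => `|(EFin \o f) x|%E))//.
exact: measurableT_comp.
Qed.

Lemma Rintegral_rVD v f : leb.-integrable setT (EFin \o f) ->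
  \int[leb]_x f (x + v) = \int[leb]_x f x.
Proof.
move=> intf; rewrite /Rintegral; congr fine.
have ms := measurable_fun_shift_rV v.
transitivity (\int[pushforward leb (fun x => x + v)%R]_y (f y)%:E)%E.
  rewrite integral_pushforward//; first by case/integrableP : intf.
  exact: integrable_rVD.
by apply: eq_measure_integral => // B mB _; exact: lebesgue_rVD.
Qed.

Lemma lebesgue_rV_open_gt0 (U : set 'rV[R]_n) x : open U -> U x ->
  (0 < leb U)%E.
Proof.
move=> oU Ux; have /nbhs_ballP[e /= e0 xe] : nbhs x U by exact: open_nbhs_nbhs.
apply: (@lt_le_trans _ _ (leb (box x (const_mx (e / 2))))).
  rewrite lebesgue_rV_box => [|i]; last by rewrite mxE divr_ge0 ?ltW.
  by rewrite lte_fin prodr_gt0// => i _; rewrite mxE divr_gt0.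
apply: le_measure; rewrite ?inE; [exact: measurable_box|exact: open_measurable_rV|].
move=> y yb; apply: xe; split => // i j; rewrite ord1.
have := yb j; rewrite mxE /ball/= => /andP[h1 h2].
by rewrite ltr_norml; apply/andP; split; lra.
Qed.

Lemma lebesgue_rV_bounded B (M : R) : measurable B ->
  (forall x, B x -> `|x| <= M) -> (leb B < +oo)%E.
Proof.
move=> mB BM; have [->|/set0P[x0 Bx0]] := eqVneq B set0; first by rewrite measure0.
have M0 : 0 <= M by apply: le_trans (BM _ Bx0).
apply: (@le_lt_trans _ _ (leb (box (const_mx (- M)) (const_mx (2 * M + 1))))).
  apply: le_measure; rewrite ?inE//; first exact: measurable_box.
  move=> x /BM /(rV_norm_leP _ M0) xM i; have := xM i; rewrite !mxE ler_norml.
  by move=> /andP[h1 h2]; apply/andP; split; lra.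
by rewrite lebesgue_rV_box ?ltry// => i; rewrite mxE; lra.
Qed.

Lemma integrable_bounded_rV B f (K : R) : measurable B -> (leb B < +oo)%E ->
  measurable_fun B f -> (forall x, B x -> `|f x| <= K) ->
  leb.-integrable B (EFin \o f).
Proof.
move=> mB Boo mf fK; apply: measurable_bounded_integrable => //.
exists K; split; first exact: num_real.
by move=> y Ky x Bx; rewrite /= (le_trans (fK _ Bx))// ltW.
Qed.

Lemma is_derive_line f (i : 'I_n) x (h : R) : derivable f (x + h *: 'e_i) 'e_i ->
  is_derive h 1 (fun t : R => f (x + t *: 'e_i)) (partial i f (x + h *: 'e_i)).
Proof.
move=> df.
have E : (fun t : R => t^-1 *: (((fun t : R => f (x + t *: 'e_i)) \o shift h) (t *: (1:R)) - f (x + h *: 'e_i)))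
  = (fun t : R => t^-1 *: ((f \o shift (x + h *: 'e_i)) (t *: 'e_i) - f (x + h *: 'e_i))).
  apply/funext => t /=; congr (_ *: (f _ - _)).
  by rewrite scaler1 scalerDl addrCA.
by apply: DeriveDef; rewrite /derivable/partial/derive E.
Qed.

Lemma is_derive_Rintegral_line f (i : 'I_n) B (G : 'rV[R]_n -> R) (a u v : R) :
  measurable B -> a \in `]u, v[ -> (forall x, derivable f x 'e_i) ->
  (forall h, h \in `]u, v[ ->
    leb.-integrable B (EFin \o (fun x => f (x + h *: 'e_i)))) ->
  leb.-integrable B (EFin \o G) -> (forall x, 0 <= G x) ->
  (forall h x, h \in `]u, v[ -> B x -> `|partial i f (x + h *: 'e_i)| <= G x) ->
  is_derive a 1 (fun h : R => \int[leb]_(x in B) f (x + h *: 'e_i))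
    (\int[leb]_(x in B) partial i f (x + a *: 'e_i)).
Proof.
move=> mB auv df intf intG G0 fG.
pose F h x := f (x + h *: 'e_i).
have d1F h x : partial1of2 F h x = partial i f (x + h *: 'e_i).
  by rewrite partial1of2E; have [_ <-] := is_derive_line (df (x + h *: 'e_i)).
have := @cvg_differentiation_under_integral _ _ _ leb F B mB a u v auv intf
   _ G G0 intG _.
have dF h x : `]u, v[%classic h -> B x -> derivable (F ^~ x) h 1.
  by move=> _ _; have [] := is_derive_line (df (x + h *: 'e_i)).
move=> /(_ dF) H2.
have /H2{H2} : forall h x, `]u, v[%classic h -> B x -> `|partial1of2 F h x| <= G x.
  by move=> h x uvh Bx; rewrite d1F fG.
under [in X in _ --> X -> _]eq_Rintegral do rewrite d1F.
set l := Rintegral _ _ _ => cvl.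
pose g (h : R) := \int[leb]_(x in B) f (x + h *: 'e_i).
have E : (fun h : R => h^-1 *: ((g \o shift a) (h *: (1 : R)) - g a)) =
    (fun h => h^-1 *: (g (h + a) - g a)).
  by apply/funext => h /=; rewrite scaler1.
apply: DeriveDef; rewrite /derivable /derive E; first exact: (cvgP _ cvl).
exact/cvg_lim.
Qed.

(** Mean value theorem for the function sending t to the integral over [B] of f (x + t e_i).
    Averaging over [B] first means that only integrals of the partial derivative enter, and these
    are controlled by its L^p norm. *)
Lemma le_Rintegral_line f (i : 'I_n) B (M M' K h : R) :
  measurable B -> (leb B < +oo)%E -> continuous f -> (forall x, `|f x| <= M) ->
  (forall x, derivable f x 'e_i) -> (forall x, `|partial i f x| <= M') ->
  (forall t, `|\int[leb]_(x in B) partial i f (x + t *: 'e_i)| <= K) ->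
  `|\int[leb]_(x in B) f (x + h *: 'e_i) - \int[leb]_(x in B) f x| <= `|h| * K.
Proof.
move=> mB Boo cf fM df dfM HK.
have intf t : leb.-integrable B (EFin \o (fun x => f (x + t *: 'e_i))).
  apply: (@integrable_bounded_rV _ _ M) => //.
  apply: measurable_funTS; apply: (measurableT_comp (continuous_measurable_rV cf)).
  exact: measurable_fun_shift_rV.
have dI (t : R) : is_derive t 1 (fun h : R => \int[leb]_(x in B) f (x + h *: 'e_i))
    (\int[leb]_(x in B) partial i f (x + t *: 'e_i)).
  apply: (@is_derive_Rintegral_line _ _ _ (cst M') _ (t - 1) (t + 1)) => //.
  - by rewrite in_itv /=; apply/andP; split; lra.
  - apply: (@integrable_bounded_rV _ _ M') => // x _ /=.
    by rewrite ger0_norm//; exact: le_trans (dfM x).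
  - by move=> x; exact: le_trans (dfM x).
have cI (a b : R) : {within `[a, b], continuous (fun h : R => \int[leb]_(x in B) f (x + h *: 'e_i))}.
  apply: continuous_subspaceT => t.
  by apply/differentiable_continuous/derivable1_diffP; case: (dI t).
have I0 : \int[leb]_(x in B) f x = \int[leb]_(x in B) f (x + 0 *: 'e_i).
  by apply: eq_Rintegral => x _; rewrite scale0r addr0.
rewrite I0; have [h0|h0] := leP 0 h.
  have [c _ ->] := MVT_segment h0 (fun t _ => dI t) (cI _ _).
  by rewrite subr0 normrM mulrC ler_wpM2l.
have [c _] := MVT_segment (ltW h0) (fun t _ => dI t) (cI _ _).
by rewrite distrC => ->; rewrite sub0r normrM normrN mulrC ler_wpM2l.
Qed.

Lemma measurable_normball (r : R) : measurable [set x : 'rV[R]_n | `|x| <= r].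
Proof.
rewrite -(setCK [set x | _]); apply: measurableC; apply: open_measurable_rV.
rewrite (_ : ~` _ = (fun x : 'rV[R]_n => `|x|) @^-1` `]r, +oo[).
  have /continuousP/(_ `]r, +oo[%classic) := @norm_continuous R 'rV[R]_n.
  by apply; exact: interval_open.
by apply/seteqP; split => x /=; rewrite in_itv /= andbT ltNge => /negP.
Qed.

Lemma integrable_supp_rV f (M r : R) : measurable_fun setT f ->
  (forall x, `|f x| <= M) -> (forall x, r < `|x| -> f x = 0) ->
  leb.-integrable setT (EFin \o f).
Proof.
move=> mf fM f0; have mB := measurable_normball r.
rewrite (_ : EFin \o f = (EFin \o f) \_ [set x | `|x| <= r]).
  rewrite -integrable_mkcond//; apply: (@integrable_bounded_rV _ _ M) => //.
    exact: (@lebesgue_rV_bounded _ r).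
  exact: measurable_funTS.
apply/funext => x; rewrite patchE; case: ifPn => // /negP.
by rewrite inE /= => /negP; rewrite -ltNge => /f0 /= ->.
Qed.

(* By translation invariance the integral of f (x + h e_i) does not depend on h. *)
Lemma Rintegral_partial0 f (i : 'I_n) (M M' r : R) :
  continuous f -> (forall x, derivable f x 'e_i) ->
  (forall x, `|f x| <= M) -> (forall x, `|partial i f x| <= M') ->
  (forall x, r < `|x| -> f x = 0) -> (forall x, r < `|x| -> partial i f x = 0) ->
  \int[leb]_x partial i f x = 0.
Proof.
move=> cf df fM dfM f0 df0.
have intf := integrable_supp_rV (continuous_measurable_rV cf) fM f0.
(* The shift [h] ranges over []-1, 1[], so all translated derivatives vanish outside radius [r + 1],
   and [M'] times the indicator of [B] dominates them. *)
pose B := [set x : 'rV[R]_n | `|x| <= r + 1].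
have mB : measurable B by exact: measurable_normball.
have e1 : `|'e_i : 'rV[R]_n| <= 1.
  by apply/rV_norm_leP => // j; rewrite mxE eqxx /= normr_nat; case: (_ == _).
have M'0 : 0 <= M' by exact: le_trans (dfM 0).
have dI : is_derive (0 : R) 1 (fun h : R => \int[leb]_x f (x + h *: 'e_i))
    (\int[leb]_x partial i f (x + 0 *: 'e_i)).
  apply: (@is_derive_Rintegral_line _ _ _ (fun x => M' * \1_B x) _ (- 1) 1) => //.
  - by rewrite in_itv /=; apply/andP; split; lra.
  - by move=> h _; exact: integrable_rVD.
  - apply: (@integrable_supp_rV _ M' (r + 1)).
    + by apply: measurable_funM => //; exact: measurable_indic.
    + move=> x; rewrite normrM (ger0_norm M'0) ler_piMr// indicE.
      by rewrite normr_nat; case: (_ \in _).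
    + move=> x xr; rewrite indicE memNset ?mulr0//= => xr'.
      by move: xr; rewrite ltNge xr'.
  - by move=> x; rewrite mulr_ge0// indicE.
  - move=> h x; rewrite in_itv /= => /andP[h1 h2] _.
    have [xr|xr] := leP `|x| (r + 1).
      by rewrite indicE mem_set// mulr1.
    rewrite df0 ?normr0 ?mulr_ge0 ?indicE//.
    have : `|h *: 'e_i : 'rV[R]_n| <= 1.
      by rewrite normrZ mulr_ile1// ltW// ltr_norml h1.
    have := ler_normB (x + h *: 'e_i) (h *: 'e_i); rewrite addrK; lra.
have <- : \int[leb]_x partial i f (x + 0 *: 'e_i) = \int[leb]_x partial i f x.
  by apply: eq_Rintegral => x _; rewrite scale0r addr0.
have [_ <-] := dI.
rewrite (_ : (fun h => _) = cst (\int[leb]_x f x)) ?derive_cst//.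
by apply/funext => h; rewrite Rintegral_rVD.
Qed.

End lebesgue_rV_integral.

(** * Test functions *)

Section flat.
Context {R : realType}.
Implicit Types (p : {poly R}) (t : R).

(* This family is stable under differentiation, so it consists of smooth functions. *)
Definition flat p t : R := if 0 < t then p.[t^-1] * expR (- t^-1) else 0.

(** Since exp s >= s^(k+1)/(k+1)! for s >= 0, each monomial satisfies t^(-k) exp(-1/t) <= (k+1)! t
    when t > 0; the coefficients of [p] are then summed. In particular every member of the family
    tends to 0 at 0. *)
Lemma flat_le p : exists C, forall t, `|flat p t| <= C * `|t|.
Proof.
pose C := \sum_(k < size p) `|p`_k| * (k.+1`!)%:R.
exists C => t; rewrite /flat; case: ifPn => [t0|_]; last first.
  by rewrite normr0 mulr_ge0// sumr_ge0// => k _; rewrite mulr_ge0.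
rewrite normrM (ger0_norm (expR_ge0 _)) (gtr0_norm t0) horner_coef.
apply: (@le_trans _ _ ((\sum_(k < size p) `|p`_k| * t^-1 ^+ k) * expR (- t^-1))).
  rewrite ler_wpM2r ?expR_ge0// (le_trans (ler_norm_sum _ _ _))//.
  apply: ler_sum => k _; rewrite normrM normrX [ `|t^-1|]gtr0_norm//.
  by rewrite invr_gt0.
rewrite !mulr_suml; apply: ler_sum => k _; rewrite -!mulrA ler_wpM2l//.
rewrite expRN ler_pdivrMr ?expR_gt0//.
apply: (@le_trans _ _ (k.+1`!%:R * t * (t^-1 ^+ k.+1 / k.+1`!%:R))).
  rewrite exprS le_eqVlt; apply/orP; left; apply/eqP.
  have f0 : k.+1`!%:R != 0 :> R by rewrite pnatr_eq0 -lt0n fact_gt0.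
  have t0' : t != 0 by rewrite gt_eqF.
  by field; rewrite ?f0 ?t0'.
rewrite ler_wpM2l ?mulr_ge0 ?(ltW t0)//.
have := @expR_ge1Dxn _ t^-1 k; rewrite invr_ge0 => /(_ (ltW t0)).
by apply: le_trans; rewrite lerDr.
Qed.

Lemma is_derive_flat p t : is_derive t 1 (flat p) (flat ('X^2 * (p - p^`())) t).
Proof.
have [t0|t0|->] := ltgtP t 0.
- rewrite [X in is_derive _ _ _ X](_ : _ = 0); last first.
    by rewrite /flat ltNge (ltW t0).
  apply: (@near_eq_is_derive _ _ _ (cst 0)).
  near=> s; rewrite /flat/= ltNge ifF//; apply/negbTE; rewrite negbK.
  by apply: ltW; near: s; exact: lt_nbhsl.
- pose f := (horner p \o GRing.inv) * (expR \o -%R \o GRing.inv) : R -> R.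
  apply: (@near_eq_is_derive _ _ _ f).
    near=> s; rewrite /flat/= ifT//; near: s; exact: lt_nbhsr.
  have dV : is_derive t 1 (GRing.inv : R -> R) (- t ^- 2 *: 1).
    by apply: (@is_deriveV _ id) => //; rewrite gt_eqF.
  rewrite /f; apply: is_derive_eq.
  rewrite /flat t0 !hornerE /=  /GRing.scale/=.
  by field; rewrite gt_eqF.
(* At 0 the slope [flat p z / z] is again a member of the family, [flat ('X * p) z], and [flat_le]
   makes it tend to 0. *)
- rewrite [X in is_derive _ _ _ X](_ : _ = 0); last by rewrite /flat ltxx.
  apply/is_derive1_caratheodory; exists (flat ('X * p)); split.
  + move=> z; rewrite /flat ltxx !subr0; case: ifPn; rewrite ?mul0r// => z0.
    by rewrite !hornerE; field; rewrite gt_eqF.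
  + have F0 : flat ('X * p) 0 = 0 by rewrite /flat ltxx.
    suff : flat ('X * p) s @[s --> (0 : R)] --> flat ('X * p) 0 by [].
    rewrite F0; apply/cvgr0Pnorm_lt => e e0; have [C HC] := flat_le ('X * p).
    near=> s; apply: le_lt_trans (HC s) _.
    have C1 : 0 < `|C| + 1 by rewrite ltr_wpDl.
    apply: (@le_lt_trans _ _ ((`|C| + 1) * `|s|)).
      by rewrite ler_wpM2r// (le_trans (ler_norm _))// lerDl.
    rewrite -ltr_pdivlMl//; near: s.
    have := @nbhs0_lt _ R ((`|C| + 1)^-1 * e).
    by rewrite mulr_gt0 ?invr_gt0// => /(_ isT).
  + by rewrite /flat ltxx.
Unshelve. all: by end_near. Qed.

Lemma continuous_flat p : continuous (flat p).
Proof.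
move=> t; apply/differentiable_continuous/derivable1_diffP.
by case: (is_derive_flat p t).
Qed.

End flat.

(** * Smooth functions built from flat functions of one coordinate *)

Section smooth_functions.
Context {R : realType} {n : nat}.
Implicit Types (f g : 'rV[R]_n -> R) (x : 'rV[R]_n).

(** Smoothness quantifies over all lists of indices; the induction on the list is done here once. To
    prove a function smooth it then suffices to exhibit a class that contains it and is closed under
    [partial]. *)
Lemma smooth_class (P : ('rV[R]_n -> R) -> Prop) :
  (forall f, P f -> continuous f /\
     forall i, P (partial i f) /\ forall x, derivable f x 'e_i) ->
  forall f, P f -> smooth f.
Proof.
move=> HP f Pf s; have : P (iter_partial s f).
  elim: s => //= i s IH; by have [_ /(_ i)[]] := HP _ IH.
by move=> /HP[cs ds]; split => // i x; have [_] := ds i.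
Qed.

Lemma smooth_continuous f : smooth f -> continuous f.
Proof. by move=> /(_ [::])[]. Qed.

Lemma smooth_derivable f i x : smooth f -> derivable f x 'e_i.
Proof. by move=> /(_ [::])[_]; apply. Qed.

Lemma smooth_partial f i : smooth f -> smooth (partial i f).
Proof.
by move=> sf s; have := sf (rcons s i); rewrite /iter_partial foldr_rcons.
Qed.

Lemma partialD f g i : smooth f -> smooth g ->
  partial i (f \+ g) = partial i f \+ partial i g.
Proof.
by move=> sf sg; apply/funext => x; rewrite /partial deriveD//; exact: smooth_derivable.
Qed.

Lemma partialZ f c i : smooth f -> partial i (c \*o f) = c \*o partial i f.
Proof.
by move=> sf; apply/funext => x; rewrite /partial deriveMl//; exact: smooth_derivable.
Qed.

Lemma partialM f g i : smooth f -> smooth g ->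
  partial i (f \* g) = (f \* partial i g) \+ (g \* partial i f).
Proof.
by move=> sf sg; apply/funext => x; rewrite /partial deriveM//; exact: smooth_derivable.
Qed.

Lemma smoothD f g : smooth f -> smooth g -> smooth (f \+ g).
Proof.
move=> sf sg.
apply: (@smooth_class (fun h => exists f g, [/\ smooth f, smooth g & h = f \+ g])).
  move=> _ [{sf}f [{sg}g [sf sg ->]]]; split.
    by move=> x; exact: (cvgD (@smooth_continuous _ sf x) (@smooth_continuous _ sg x)).
  move=> i; split; first by exists (partial i f), (partial i g); split;
    [exact: smooth_partial..|exact: partialD].
  by move=> x; apply: derivableD; exact: smooth_derivable.
by exists f, g.
Qed.

Lemma smoothZ f c : smooth f -> smooth (c \*o f).
Proof.
move=> sf.
apply: (@smooth_class (fun h => exists f, smooth f /\ h = c \*o f)).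
  move=> _ [{sf}f [sf ->]]; split.
    by move=> x; exact: (cvgM (cvg_cst c) (@smooth_continuous _ sf x)).
  move=> i; split; first by exists (partial i f); split;
    [exact: smooth_partial..|exact: partialZ].
  by move=> x; apply: derivableM => //; exact: smooth_derivable.
by exists f.
Qed.

(** Along ['e_i] the function is [h] composed with an affine function of one variable, of slope [a]
    if i = j and 0 otherwise, so the one-variable chain rule at 0 applies. *)
Lemma is_derive_coord (h : R -> R) (a b d : R) (i j : 'I_n) x :
  is_derive (a * x 0 j + b) 1 h d ->
  is_derive x 'e_i (fun x => h (a * x 0 j + b)) (a * (i == j)%:R * d).
Proof.
move=> dh.
pose l (t : R) := a * (x + t *: 'e_i) 0 j + b.
have lE : l = (fun t : R => (a * (i == j)%:R) * t + (a * x 0 j + b)).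
  by apply/funext => t; rewrite /l !mxE eqxx /= eq_sym; ring.
have dl : is_derive (0 : R) 1 l (a * (i == j)%:R).
  rewrite lE; apply: is_derive_eq.
  by rewrite /GRing.scale/= mulr1 addr0.
have l0 : l 0 = a * x 0 j + b by rewrite lE mulr0 add0r.
have dh' : is_derive (l 0) 1 h d by rewrite l0.
have [] : is_derive (0 : R) 1 (h \o l) (a * (i == j)%:R * d).
  by rewrite mulrC; exact: is_derive1_comp.
rewrite /derivable /derive.
rewrite (_ : (fun t => t^-1 *: (((h \o l) \o shift 0) (t *: 1) - (h \o l) 0)) =
  (fun t : R => t^-1 *: (((fun x => h (a * x 0 j + b)) \o shift x) (t *: 'e_i) - h (a * x 0 j + b)))).
  by move=> dc dv; exact: DeriveDef.
apply/funext => t; rewrite /= l0 /l addr0 (_ : t%:A = t) ?[in LHS](addrC x)//.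
by rewrite /GRing.scale/= mulr1.
Qed.

(** Chosen to be closed under partial derivatives: the product rule calls for sums and products, and
    the chain rule for constant factors. *)
Inductive flat_class : ('rV[R]_n -> R) -> Prop :=
| flat_coord p (a b : R) (j : 'I_n) : flat_class (fun x => flat p (a * x 0 j + b))
| flat_cst c : flat_class (cst c)
| flat_add f g : flat_class f -> flat_class g -> flat_class (f \+ g)
| flat_mul f g : flat_class f -> flat_class g -> flat_class (f \* g).

Lemma smooth_flat_class f : flat_class f -> smooth f.
Proof.
apply: smooth_class => {}f; elim => {f}.
- move=> p a b j; split.
    move=> x; have cl : {for x, continuous (fun x : 'rV[R]_n => a * x 0 j + b)}.
      exact: (cvgD (cvgM (cvg_cst a) (@coord_continuous _ _ _ 0 j x)) (cvg_cst b)).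
    exact: (continuous_comp cl (@continuous_flat _ p _)).
  move=> i; have dx x := @is_derive_coord (flat p) a b _ i j x (is_derive_flat p _).
  split; last by move=> x; case: (dx x).
  rewrite (_ : partial i _ = cst (a * (i == j)%:R) \*
    (fun x => flat ('X^2 * (p - p^`())) (a * x 0 j + b))).
    by apply: flat_mul; [exact: flat_cst|exact: flat_coord].
  by apply/funext => x; rewrite /partial; have [_ ->] := dx x.
- move=> c; split; first exact: cst_continuous.
  move=> i; split => //.
  rewrite (_ : partial i _ = cst 0); first exact: flat_cst.
  by apply/funext => x; rewrite /partial derive_cst.
- move=> f g cf [ctf df] cg [ctg dg]; split.
    by move=> x; exact: (cvgD (ctf x) (ctg x)).
  move=> i; have [pf df'] := df i; have [pg dg'] := dg i; split.
    rewrite (_ : partial i _ = partial i f \+ partial i g); first exact: flat_add.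
    by apply/funext => x; rewrite /partial deriveD.
  by move=> x; exact: derivableD.
- move=> f g cf [ctf df] cg [ctg dg]; split.
    by move=> x; exact: (cvgM (ctf x) (ctg x)).
  move=> i; have [pf df'] := df i; have [pg dg'] := dg i; split.
    rewrite (_ : partial i _ = (f \* partial i g) \+ (g \* partial i f)).
      by apply: flat_add; apply: flat_mul.
    by apply/funext => x; rewrite /partial deriveM.
  by move=> x; exact: derivableM.
Qed.

End smooth_functions.

(** * Integrable functions whose integrals over all boxes vanish *)

Section ae_zero.
Context {R : realType} {n : nat}.
Local Notation leb := (@lebesgue_rV R n).
Implicit Types (h : 'rV[R]_n -> R) (a b : 'rV[R]_n).

Let oboxes : set (set 'rV[R]_n) := [set A | exists a b, A = obox a b].

Let measurable_oboxes : (@measurable _ 'rV[R]_n) = <<s oboxes >>.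
Proof.
apply/seteqP; split; last first.
  apply: smallest_sub; first exact: sigma_algebra_measurable.
  by move=> _ [a [b ->]]; exact: measurable_obox.
apply: smallest_sub; first exact: smallest_sigma_algebra.
rewrite -bigcup_seq/=; apply: bigcup_sub => i _ _ [B mB <-].
rewrite setTI.
suff H : @measurable _ (measurableTypeR R) `<=`
    [set B | <<s oboxes >> ((fun x : 'rV[R]_n => x 0 i) @^-1` B)] by exact: H.
rewrite RGenOpens.measurableE; apply: smallest_sub.
  split=> /=.
  - by rewrite preimage_set0; exact: sigma_algebra0.
  - by move=> C mC; rewrite setTD preimage_setC; exact: sigma_algebraC.
  - by move=> F mF; rewrite preimage_bigcup; exact: sigma_algebra_bigcup.
move=> _ [c [d ->]] /=.
(* A slab between two values of coordinate [i] is the union over [k] of boxes whose remaining sides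
   are []-k, k[]. *)
rewrite (_ : _ @^-1` _ = \bigcup_k obox
   (\row_j if j == i then c else - k%:R) (\row_j if j == i then d else k%:R)).
  by apply: sigma_algebra_bigcup => k; apply: sub_sigma_algebra; do 2 eexists.
apply/seteqP; split => [x|x [k _ /(_ i)]] /=; last by rewrite !mxE eqxx in_itv.
rewrite in_itv /= => xcd.
have [k xk] : exists k, `|x| < k%:R.
  exists (Num.bound `|x|); exact: archi_boundP.
exists k => // j; rewrite !mxE; case: ifPn => [/eqP ->//|_].
by rewrite -ltr_norml (le_lt_trans _ xk)// rV_coord_le.
Qed.

(** The positive and negative parts of [h] induce two measures that agree on open boxes. These are
    stable under intersection, generate the measurable sets and exhaust the space with finite mass,
    so the measures coincide and [h] integrates to 0 over every measurable set. *)
Lemma ae_eq0_obox h : leb.-integrable setT (EFin \o h) ->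
  (forall a b, (\int[leb]_(x in obox a b) (h x)%:E)%E = 0%E) ->
  {ae leb, forall x, h x = 0}.
Proof.
move=> ih h0; have mh := measurable_int _ ih.
pose f := EFin \o h.
have ip : leb.-integrable setT f^\+%E by exact: integrable_funepos.
have im : leb.-integrable setT f^\-%E by exact: integrable_funeneg.
pose m1 (A : set 'rV[R]_n) := (\int[leb]_(x in A) f^\+%E x)%E.
pose m2 (A : set 'rV[R]_n) := (\int[leb]_(x in A) f^\-%E x)%E.
have m10 : m1 set0 = 0%E by rewrite /m1 integral_set0.
have m20 : m2 set0 = 0%E by rewrite /m2 integral_set0.
have m1ge0 A : (0 <= m1 A)%E by exact: integral_ge0.
have m2ge0 A : (0 <= m2 A)%E by exact: integral_ge0.
have s1 : semi_sigma_additive m1.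
  by apply: semi_sigma_additive_nng_induced => //; exact: measurable_funepos.
have s2 : semi_sigma_additive m2.
  by apply: semi_sigma_additive_nng_induced => //; exact: measurable_funeneg.
pose M1 : {measure set 'rV[R]_n -> \bar R} :=
  HB.pack m1 (isMeasure.Build _ _ _ m1 m10 m1ge0 s1).
pose M2 : {measure set 'rV[R]_n -> \bar R} :=
  HB.pack m2 (isMeasure.Build _ _ _ m2 m20 m2ge0 s2).
have m12 A : measurable A -> m1 A = m2 A.
  apply: (@measure_unique _ _ _ oboxes
    (fun k => obox (const_mx (- k%:R)) (const_mx k%:R)) _ _ _ _ M1 M2) => //.
  - move=> _ _ [a [b ->]] [c [d ->]].
    exists (\row_i Num.max (a 0 i) (c 0 i)), (\row_i Num.min (b 0 i) (d 0 i)).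
    apply/seteqP; split => [x [xab xcd] i|x xabcd].
      by rewrite !mxE gt_max lt_min andbACA; apply/andP; split; [exact: xab|exact: xcd].
    by split => i; have := xabcd i; rewrite !mxE gt_max lt_min andbACA => /andP[].
  - by move=> k; do 2 eexists.
  - apply/seteqP; split => // x _.
    exists (Num.bound `|x|) => // i; rewrite !mxE -ltr_norml.
    by apply: le_lt_trans (archi_boundP _) => //; exact: rV_coord_le.
  - move=> _ [a [b ->]] /=; have := h0 a b; rewrite integralE => /eqP.
    have mab := measurable_obox a b.
    rewrite sube_eq ?add0e => [/eqP //| |].
      have : leb.-integrable (obox a b) f^\+%E by exact: integrableS ip.
      by move=> /(integrable_fin_num mab).
    have : leb.-integrable (obox a b) f^\-%E by exact: integrableS im.
    by move=> /(integrable_fin_num mab) H; rewrite fin_num_adde_defl.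
  - move=> k /=; rewrite /m1.
    have : leb.-integrable (obox (const_mx (- k%:R)) (const_mx k%:R)) f^\+%E.
      by apply: integrableS ip => //; exact: measurable_obox.
    by move=> /(integrable_lty (measurable_obox _ _)).
have /(_ measurableT) : measurable [set: 'rV[R]_n] -> ae_eq leb setT f (cst 0%E).
  move=> mT; apply: integral_ae_eq => // E _ mE.
  rewrite integral0 integralE -/(m1 E) -/(m2 E) m12// subee//.
  by rewrite /m2 integrable_fin_num//; exact: integrableS im.
by apply: filterS => x /(_ I) [].
Qed.

End ae_zero.

(** * Smooth bumps in a box *)

Section box_bump.
Context {R : realType} {n : nat}.
Local Notation leb := (@lebesgue_rV R n).
Implicit Types (x a b : 'rV[R]_n).

(* As [k] tends to infinity these test functions tend boundedly to the
   indicator function of [obox a b]. *)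
Definition box_bump (k : nat) a b x : R :=
  \prod_(i < n) (flat 1 (k%:R * x 0 i + - (k%:R * a 0 i)) *
                 flat 1 (- k%:R * x 0 i + k%:R * b 0 i)).

Let flat1E (t : R) : flat 1 t = if 0 < t then expR (- t^-1) else 0.
Proof. by rewrite /flat hornerC mul1r. Qed.

Let flat1_ge0 (t : R) : 0 <= flat 1 t.
Proof. by rewrite flat1E; case: ifPn => // _; exact: expR_ge0. Qed.

Let flat1_le1 (t : R) : flat 1 t <= 1.
Proof.
by rewrite flat1E; case: ifPn => // t0; rewrite expR_le1 lerNl oppr0 invr_ge0 ltW.
Qed.

Lemma box_bump_smooth k a b : smooth (box_bump k a b).
Proof.
apply: smooth_flat_class; rewrite /box_bump.
elim: (index_enum _) => [|i s IH].
  rewrite (_ : (fun x => _) = cst 1); first exact: flat_cst.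
  by apply/funext => x; rewrite big_nil.
rewrite (_ : (fun x => _) =
  ((fun x : 'rV[R]_n => flat 1 (k%:R * x 0 i + - (k%:R * a 0 i))) \*
   (fun x : 'rV[R]_n => flat 1 (- k%:R * x 0 i + k%:R * b 0 i))) \*
   (fun x => \prod_(i <- s) (flat 1 (k%:R * x 0 i + - (k%:R * a 0 i)) *
                 flat 1 (- k%:R * x 0 i + k%:R * b 0 i)))).
  by apply: flat_mul => //; apply: flat_mul; exact: flat_coord.
by apply/funext => x; rewrite big_cons.
Qed.

Lemma box_bump_norm k a b x : `|box_bump k a b x| <= 1.
Proof.
rewrite /box_bump normr_prod; apply: prodr_ile1 => i _.
by rewrite normr_ge0 ger0_norm ?mulr_ge0//= mulr_ile1.
Qed.

Lemma box_bump_out k a b x : ~ obox a b x -> box_bump k a b x = 0.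
Proof.
move=> /existsNP[i xi]; apply/eqP; rewrite /box_bump prodf_seq_eq0.
apply/hasP; exists i; first by rewrite mem_index_enum.
have -> : k%:R * x 0 i + - (k%:R * a 0 i) = k%:R * (x 0 i - a 0 i) by ring.
have -> : - k%:R * x 0 i + k%:R * b 0 i = k%:R * (b 0 i - x 0 i) by ring.
rewrite /= mulf_eq0 !flat1E.
have [ax|xa] := ltP (a 0 i) (x 0 i).
  have xb : b 0 i <= x 0 i by rewrite leNgt; apply/negP => xb; apply: xi; rewrite ax.
  apply/orP; right; rewrite ifF ?eqxx//; apply/negbTE.
  by rewrite -leNgt mulr_ge0_le0// subr_le0.
by apply/orP; left; rewrite ifF ?eqxx//; apply/negbTE; rewrite -leNgt mulr_ge0_le0// subr_le0.
Qed.

Lemma box_bump_cvg a b x :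
  box_bump k a b x @[k --> \oo] --> (\1_(obox a b) x : R).
Proof.
rewrite indicE; case: (boolP (_ \in _)); rewrite (inE, notin_setE) /= => xab; last first.
  by under eq_fun do rewrite box_bump_out//; exact: cvg_cst.
have cflat (t : R) : 0 < t -> flat 1 (k%:R * t) @[k --> \oo] --> (1 : R).
  move=> t0; apply/cvgrPdist_lt => e e0; near=> k.
  (* The value exp(-1/(k t)) lies between 1 - 1/(k t) and 1, whence the threshold 1/(e t) for
     [k]. *)
  have ek : (e * t)^-1 < k%:R by near: k; exact: nbhs_infty_gtr.
  have kt0 : 0 < k%:R * t.
    by rewrite mulr_gt0// (le_lt_trans _ ek)// invr_ge0 mulr_ge0 ?ltW.
  rewrite flat1E kt0; set s := _^-1.
  have s0 : 0 <= s by rewrite invr_ge0 ltW.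
  have se : s < e.
    rewrite /s -[e]invrK ltf_pV2 ?posrE ?invr_gt0// -ltr_pdivrMr//.
    by rewrite -invfM.
  have := expR_ge1Dx (- s); have : expR (- s) <= 1 by rewrite expR_le1 lerNl oppr0.
  by move=> h1 h2; rewrite ger0_norm; lra.
have cprod (F : nat -> 'I_n -> R) : (forall i, F k i @[k --> \oo] --> (1 : R)) ->
    \prod_(i < n) F k i @[k --> \oo] --> (1 : R).
  move=> F1; elim: (index_enum _) => [|i s IH].
    by under eq_fun do rewrite big_nil; exact: cvg_cst.
  under eq_fun do rewrite big_cons.
  by have := cvgM (F1 i) IH; rewrite mulr1; apply.
apply: cprod => i; have /andP[h1 h2] := xab i.
rewrite (_ : (fun k => _) = (fun k : nat => flat 1 (k%:R * (x 0 i - a 0 i)) *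
    flat 1 (k%:R * (b 0 i - x 0 i)))); last first.
  by apply/funext => k; congr (flat _ _ * flat _ _); ring.
have xa0 : 0 < x 0 i - a 0 i by rewrite subr_gt0.
have bx0 : 0 < b 0 i - x 0 i by rewrite subr_gt0.
by have := cvgM (cflat _ xa0) (cflat _ bx0); rewrite mulr1; apply.
Unshelve. all: by end_near. Qed.

Lemma closed_cbox a b : closed (cbox a b).
Proof.
rewrite (_ : cbox a b = \bigcap_(i in [set: 'I_n])
    ((fun x : 'rV[R]_n => x 0 i) @^-1` `[a 0 i, b 0 i])).
  apply: closed_bigI => i _; apply: closed_comp; last exact: interval_closed.
  by move=> x _; exact: coord_continuous.
apply/seteqP; split => [x bx i _|x bx i]; first by rewrite /= in_itv; exact: bx.
by have := bx i I; rewrite /= in_itv.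
Qed.

Lemma bounded_cbox a b : bounded_set (cbox a b).
Proof.
exists (`|a| + `|b|); split; first exact: num_real.
move=> M M1 x xab /=; apply/rV_norm_leP => [|i].
  by apply: ltW; apply: le_lt_trans M1; rewrite addr_ge0.
have /andP[h1 h2] := xab i; have := rV_coord_le a i; have := rV_coord_le b i.
have := normr_ge0 a; have := normr_ge0 b.
by rewrite !ler_norml => ? ? /andP[? ?] /andP[? ?]; apply/andP; split; lra.
Qed.

Lemma box_bump_test k a b (Omega : set 'rV[R]_n) : cbox a b `<=` Omega ->
  test_function Omega (box_bump k a b).
Proof.
move=> abO.
have supp : closure [set x | box_bump k a b x != 0] `<=` cbox a b.
  rewrite (closure_id (cbox a b)).1; last exact: closed_cbox.
  apply: closure_subset => x /= x0 i.
  have : obox a b x.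
    by apply: contrapT => H; move/eqP: x0; apply; exact: box_bump_out.
  by move=> /(_ i) /andP[h1 h2]; rewrite !ltW.
split; [exact: box_bump_smooth| |exact: subset_trans abO].
apply: (subclosed_compact _ _ supp); first exact: closed_closure.
by apply: bounded_closed_compact; [exact: bounded_cbox|exact: closed_cbox].
Qed.


End box_bump.

(** * The fundamental lemma of the calculus of variations *)

Section weak_zero.
Context {R : realType} {n : nat} (Omega : set 'rV[R]_n).
Local Notation leb := (@lebesgue_rV R n).
Implicit Types (g : 'rV[R]_n -> R) (a b : 'rV[R]_n).

Lemma compact_cbox a b : compact (cbox a b).
Proof.
by apply: bounded_closed_compact; [exact: bounded_cbox|exact: closed_cbox].
Qed.

Lemma measurable_cbox a b : measurable (cbox a b).
Proof.
rewrite -(setCK (cbox a b)); apply: measurableC; apply: open_measurable_rV.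
by apply: closed_openC; exact: closed_cbox.
Qed.

Lemma sub_obox_cbox a b : obox a b `<=` cbox a b.
Proof. by move=> x xab i; have /andP[h1 h2] := xab i; rewrite !ltW. Qed.

(** Test with [box_bump k] and let [k] grow. On the compact closed box |g| is integrable and
    dominates, and the integrands tend to [g] times the indicator of the open box. *)
Let weak_zero_obox g a b : loc_integrable Omega g ->
  (forall phi, test_function Omega phi ->
     \int[leb]_(x in Omega) (g x * phi x) = 0) ->
  cbox a b `<=` Omega -> open Omega ->
  (\int[leb]_(x in obox a b) (g x)%:E = 0)%E.
Proof.
move=> [mg ig] g0 abO oO.
have mO : measurable Omega by exact: open_measurable_rV.
have mab := measurable_obox a b; have mcab := measurable_cbox a b.
have igc := ig _ (@compact_cbox a b) abO.
have mgc : measurable_fun (cbox a b) g by exact: measurable_funS mg.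
pose f k x := (g x * box_bump k a b x)%:E.
have mf k : measurable_fun (cbox a b) (f k).
  apply/measurable_EFinP/measurable_funM => //; apply: measurable_funTS.
  by apply: continuous_measurable_rV; apply: smooth_continuous; exact: box_bump_smooth.
have fle k x : (`|f k x| <= `|(g x)%:E|)%E.
  rewrite lee_fin normrM ler_piMr//; exact: box_bump_norm.
have fint k : leb.-integrable (cbox a b) (f k).
  by apply: (le_integrable _ _ _ igc) => // x _; exact: fle.
have f0 k : (\int[leb]_(x in cbox a b) f k x = 0)%E.
  have -> : (\int[leb]_(x in cbox a b) f k x = \int[leb]_(x in Omega) f k x)%E.
    rewrite [LHS]integral_mkcond [RHS]integral_mkcond; apply: eq_integral => x _.
    rewrite !patchE; case: (boolP (x \in cbox a b)) => [xab|xab].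
      by rewrite mem_set//; apply: abO; rewrite inE in xab.
    case: ifPn => // _; rewrite /f box_bump_out ?mulr0//.
    by move: xab; rewrite notin_setE; apply: contra_not; exact: sub_obox_cbox.
  have := g0 _ (box_bump_test k abO); rewrite /Rintegral => H.
  have fO : leb.-integrable Omega (f k).
    apply/integrable_mkcond => //; have /integrable_mkcond := fint k.
    move=> /(_ mcab); congr (leb.-integrable _ _).
    apply/funext => x; rewrite !patchE; case: (boolP (x \in cbox a b)) => [xab|xab].
      by rewrite mem_set//; apply: abO; rewrite inE in xab.
    case: ifPn => // _; rewrite /f box_bump_out ?mulr0//.
    by move: xab; rewrite notin_setE; apply: contra_not; exact: sub_obox_cbox.
  by rewrite -(fineK (integrable_fin_num mO fO)) H.
have mlim : measurable_fun (cbox a b) (fun x => (g x * \1_(obox a b) x)%:E).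
  by apply/measurable_EFinP/measurable_funM => //; exact: measurable_indic.
have flim : {ae leb, forall x, cbox a b x ->
    f k x @[k --> \oo] --> (g x * \1_(obox a b) x)%:E}.
  apply: aeW => x _; apply: cvg_EFin; first exact: nearW.
  by apply: cvgM; [exact: cvg_cst|exact: box_bump_cvg].
have fdom : {ae leb, forall x k, cbox a b x -> (`|f k x| <= `|(g x)%:E|)%E}.
  by apply: aeW => x k _; exact: fle.
have [_ _] := dominated_convergence mcab mf mlim flim (integrable_abse igc) fdom.
under eq_fun do rewrite f0.
move=> /(cvg_unique (@ereal_hausdorff R) (@cvg_cst _ _ _ _ _)) cv.
rewrite cv [LHS]integral_mkcond [RHS]integral_mkcond; apply: eq_integral => x _.
rewrite !patchE indicE; case: (boolP (x \in obox a b)) => xab.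
  by rewrite mulr1 mem_set//; apply: sub_obox_cbox; rewrite inE in xab.
by rewrite mulr0; case: ifP.
Qed.

(** Every point of [Omega] lies in an open box with rational corners whose closed box stays in
    [Omega]. There are countably many of these, and on each one [g] vanishes almost everywhere. *)
Lemma weak_zero g : open Omega -> loc_integrable Omega g ->
  (forall phi, test_function Omega phi ->
     \int[leb]_(x in Omega) (g x * phi x) = 0) ->
  {ae leb, forall x, Omega x -> g x = 0}.
Proof.
move=> oO lg g0.
(* Boxes are numbered by their codes so that countably many almost everywhere statements can be
   joined over [nat]. A number coding no box, like a box leaving [Omega], imposes nothing. *)
pose P m x := if @unpickle ('rV[rat]_n * 'rV[rat]_n)%type m is Some c then
  obox (map_mx ratr c.1) (map_mx ratr c.2) x ->
  cbox (map_mx ratr c.1) (map_mx ratr c.2) `<=` Omega -> g x = 0 else True.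
have : forall m, {ae leb, forall x, P m x}.
  move=> m; rewrite /P; case: unpickle => [c|]; last exact: aeW.
  move: (map_mx ratr c.1) (map_mx ratr c.2) => a b.
  have [abO|abO] := pselect (cbox a b `<=` Omega); last by apply: aeW => x _ /abO.
  have mab := measurable_obox a b.
  suff : {ae leb, forall x, (g \_ (obox a b)) x = 0}.
    by apply: filterS => x /[swap] xab; rewrite patchE mem_set// => ->.
  apply: ae_eq0_obox.
    have /(integrableS (measurable_cbox a b) mab (@sub_obox_cbox a b)) :=
      lg.2 _ (@compact_cbox a b) abO.
    move=> /(integrable_mkcond _ mab); congr (leb.-integrable _ _).
    by apply/funext => x; rewrite /= !patchE; case: ifP.
  move=> c1 c2.
  (* [ae_eq0_obox] asks for integrals over all boxes, also those that leave [obox a b]. Cutting by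
     [obox a b] gives the box with corners [a'] and [b'], possibly empty. *)
  pose a' : 'rV[R]_n := \row_i Num.max (a 0 i) (c1 0 i).
  pose b' : 'rV[R]_n := \row_i Num.min (b 0 i) (c2 0 i).
  rewrite -[RHS](@weak_zero_obox g a' b')//.
    rewrite [LHS]integral_mkcond [RHS]integral_mkcond; apply: eq_integral => x _.
    have xI : obox a' b' x <-> obox c1 c2 x /\ obox a b x.
      split => [xab|[x1 x2] i].
        by split => i; have := xab i; rewrite !mxE gt_max lt_min andbACA => /andP[].
      by rewrite !mxE gt_max lt_min andbACA; apply/andP; split; [exact: x2|exact: x1].
    rewrite /= !patchE; case: (boolP (x \in obox c1 c2)) => x1.
      case: (boolP (x \in obox a b)) => x2; rewrite ?(inE, notin_setE) in x1 x2.
        by rewrite mem_set//; apply/xI.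
      by rewrite memNset// => /xI[].
    by rewrite notin_setE in x1; rewrite memNset// => /xI[].
  apply: subset_trans abO => x xab i; have := xab i; rewrite !mxE ge_max le_min.
  by move=> /andP[/andP[-> _] /andP[->]].
move=> /ae_foralln; apply: filterS => x Px Ox.
have [c [xc cO]] := open_rat_obox oO Ox.
by have := Px (pickle c); rewrite /P pickleK; apply.
Qed.

End weak_zero.

(** * Morrey's inequality for test functions *)

Section hoelder_set.
Context d {T : measurableType d} {R : realType} (mu : {measure set T -> \bar R}).

(** Hoelder's inequality for [f] and the indicator of [B], whose norm with the conjugate exponent is
    m^(1 - 1/p). *)
Lemma integral_le_Lnorm (f : T -> R) (B : set T) (p D m : R) : 1 < p ->
  measurable_fun [set: T] f -> measurable B -> mu B = m%:E -> 0 <= m ->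
  ('N[mu]_p%:E[EFin \o f] <= D%:E)%E ->
  (\int[mu]_(x in B) `|f x|%:E <= (m `^ (1 - p^-1) * D)%:E)%E.
Proof.
move=> p1 mf mB muB m0 fD.
have p0 : 0 < p by rewrite (lt_trans _ p1).
pose q := (1 - p^-1)^-1.
have q0 : 0 < q by rewrite invr_gt0 subr_gt0 invf_lt1.
have D0 : 0 <= D by rewrite -lee_fin (le_trans _ fD)// Lnorm_ge0.
have := @hoelder _ _ _ mu f (\1_B) p q mf (measurable_indic mB) p0 q0.
rewrite invrK addrC subrK => /(_ erefl) H.
have -> : (\int[mu]_(x in B) `|f x|%:E = 'N[mu]_1[EFin \o (f \* \1_B)%R])%E.
  rewrite Lnorm1 [LHS]integral_mkcond; apply: eq_integral => x _.
  rewrite patchE /= indicE; case: (x \in B); rewrite ?mulr1 ?mulr0 ?normr0//.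
apply: (le_trans H); rewrite mulrC EFinM lee_pmul//; [exact: Lnorm_ge0|exact: Lnorm_ge0|].
rewrite unlock /= (_ : (\int[mu]_x _)%E = m%:E).
  by rewrite poweR_EFin invrK.
rewrite -muB -[B in RHS]setIT -integral_indic//; apply: eq_integral => x _ /=.
by rewrite indicE; case: (x \in B); rewrite ?normr1 ?powR1 ?normr0 ?powR0// gt_eqF.
Qed.

End hoelder_set.

Section morrey.
Context {R : realType} {n : nat}.
Local Notation leb := (@lebesgue_rV R n).
Implicit Types (x y z l : 'rV[R]_n) (i j : 'I_n).

Lemma LnormD_rV (f : 'rV[R]_n -> R) (v : 'rV[R]_n) (p : R) :
  measurable_fun setT f ->
  'N[leb]_p%:E[EFin \o (fun x => f (x + v)%R)]%E = 'N[leb]_p%:E[EFin \o f]%E.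
Proof.
move=> mf; rewrite unlock; congr (_ `^ _)%E.
rewrite (ge0_integral_rVD v (f := fun x => (`|f x| `^ p)%:E))//.
apply/measurable_EFinP; apply: (@measurableT_comp _ _ _ _ _ _ (@powR R ^~ p)).
  exact: measurable_powR.
exact: measurableT_comp.
Qed.

Lemma measurable_rVD (f : 'rV[R]_n -> R) (v : 'rV[R]_n) :
  measurable_fun setT f -> measurable_fun setT (fun x => f (x + v)).
Proof. by move=> mf; apply: (measurableT_comp mf (measurable_fun_shift_rV v)). Qed.

Variables (u : 'rV[R]_n -> R) (p M D : R).
Hypotheses (p1 : 1 < p) (np : n%:R < p) (n0 : (0 < n)%N).
Hypothesis cu : continuous u.
Hypothesis du : forall i x, derivable u x 'e_i.
Hypothesis cdu : forall i, continuous (partial i u).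
Hypothesis uM : forall x, `|u x| <= M.
Hypothesis duM : forall i x, `|partial i u x| <= M.
Hypothesis uD : forall i, ('N[leb]_p%:E[EFin \o partial i u] <= D%:E)%E.

Let p0 : 0 < p. Proof. exact: lt_trans p1. Qed.

Let D0 : 0 <= D.
Proof. by rewrite -lee_fin (le_trans _ (uD (Ordinal n0)))// Lnorm_ge0. Qed.

(** Hoelder's inequality bounds the integral of the derivative over [B], at any translate, by m^(1 -
    1/p) D; dividing by the measure [m] leaves m^(-1/p). *)
Lemma mean_line_le (B : set 'rV[R]_n) (m h : R) i : measurable B ->
  leb B = m%:E -> 0 < m ->
  m^-1 * `|\int[leb]_(x in B) u (x + h *: 'e_i) - \int[leb]_(x in B) u x|
  <= `|h| * (m `^ (- p^-1) * D).
Proof.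
move=> mB Bm m0; have Boo : (leb B < +oo)%E by rewrite Bm ltry.
have H t : `|\int[leb]_(x in B) partial i u (x + t *: 'e_i)| <= m `^ (1 - p^-1) * D.
  have mi : measurable_fun setT (fun x => partial i u (x + t *: 'e_i)).
    by apply: measurable_rVD; exact: continuous_measurable_rV.
  have ii : leb.-integrable B (EFin \o (fun x => partial i u (x + t *: 'e_i))).
    by apply: (@integrable_bounded_rV _ _ _ _ M) => //; exact: measurable_funTS.
  apply: le_trans (le_normr_Rintegral mB ii) _.
  have N1 : ('N[leb]_p%:E[EFin \o (fun x => partial i u (x + t *: 'e_i))] <= D%:E)%E.
    by rewrite (@LnormD_rV (partial i u))//; exact: continuous_measurable_rV.
  have := integral_le_Lnorm p1 mi mB Bm (ltW m0) N1.
  rewrite -lee_fin /Rintegral fineK//.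
  by apply: integrable_fin_num => //; exact: integrable_norm.
have := @le_Rintegral_line _ _ u i B M M _ h mB Boo cu uM (fun x => @du i x) (duM i) H.
rewrite -(ler_pM2l (_ : 0 < m^-1)) ?invr_gt0// => /le_trans; apply.
rewrite mulrCA ler_wpM2l// mulrA ler_wpM2r//.
have mn : m != 0 by rewrite gt_eqF.
by rewrite powRD ?mn ?implybT// powRr1 ?(ltW m0)// mulKf.
Qed.

Definition mean x l : R := (\prod_(i < n) l 0 i)^-1 * \int[leb]_(z in box x l) u z.

Let alpha : R := 1 - n%:R / p.

Let alpha_gt0 : 0 < alpha.
Proof. by rewrite subr_gt0 ltr_pdivrMr// mul1r. Qed.

Let intu (B : set 'rV[R]_n) : measurable B -> (leb B < +oo)%E ->
  leb.-integrable B (EFin \o u).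
Proof.
move=> mB Boo; apply: (@integrable_bounded_rV _ _ _ _ M) => //.
by apply: measurable_funTS; exact: continuous_measurable_rV.
Qed.

Lemma Rintegral_boxD (f : 'rV[R]_n -> R) x l (v : 'rV[R]_n) :
  leb.-integrable (box (x + v) l) (EFin \o f) ->
  \int[leb]_(z in box (x + v) l) f z = \int[leb]_(z in box x l) f (z + v).
Proof.
move=> intf; have mb := measurable_box (x + v) l.
have bE z : box (x + v) l (z + v) <-> box x l z.
  by split => H i; have := H i; rewrite !mxE addrAC lerD2r ltrD2r.
rewrite Rintegral_mkcond -(Rintegral_rVD v).
  rewrite [RHS]Rintegral_mkcond; apply: eq_Rintegral => z _.
  rewrite !patchE; case: (boolP (z \in box x l)) => zb.
    by rewrite inE in zb; rewrite mem_set//; apply/bE.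
  by rewrite notin_setE in zb; rewrite memNset// => /bE.
move/(integrable_mkcond _ mb) : intf; congr (leb.-integrable _ _).
by apply/funext => z; rewrite /= !patchE; case: ifP.
Qed.

Lemma meanD x l i (h : R) : (forall j, 0 < l 0 j) ->
  `|mean (x + h *: 'e_i) l - mean x l| <=
  `|h| * ((\prod_(j < n) l 0 j) `^ (- p^-1) * D).
Proof.
move=> l0; have m0 : 0 < \prod_(j < n) l 0 j by exact: prodr_gt0.
have bm y := @lebesgue_rV_box _ _ y l (fun i => ltW (l0 i)).
rewrite /mean -mulrBr normrM gtr0_norm ?invr_gt0//.
rewrite Rintegral_boxD; last first.
  by apply: intu; [exact: measurable_box|rewrite bm ltry].
exact: mean_line_le (measurable_box x l) (bm x) m0.
Qed.

(** Cutting side [j] in two gives [box x l'] and its translate along ['e_j]. The mean over the whole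
    box is the average of the means over the halves, hence differs from the first by half the
    difference that [mean_line_le] bounds. *)
Lemma mean_halve x l l' j : (forall i, 0 < l 0 i) ->
  (forall i, l' 0 i = if i == j then l 0 i / 2 else l 0 i) ->
  `|mean x l - mean x l'| <= l' 0 j * ((\prod_(i < n) l' 0 i) `^ (- p^-1) * D).
Proof.
move=> l0 l'E; have l'0 i : 0 < l' 0 i.
  by rewrite l'E; case: ifP => // _; rewrite divr_gt0.
have m0 : 0 < \prod_(j < n) l' 0 j by exact: prodr_gt0.
have bm y := @lebesgue_rV_box _ _ y l' (fun i => ltW (l'0 i)).
have ml : \prod_(i < n) l 0 i = 2 * \prod_(i < n) l' 0 i.
  rewrite (bigD1 j)//= [in RHS](bigD1 j)//= l'E eqxx mulrA.
  congr (_ * _); first by field.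
  by apply: eq_bigr => i ij; rewrite l'E (negbTE ij).
have bU : box x l = box x l' `|` box (x + l' 0 j *: 'e_j) l'.
  apply/seteqP; split => [z zl|z [zl|zl] i].
  - have [zj|zj] := ltP (z 0 j) (x 0 j + l' 0 j); [left|right] => i.
      have := zl i; rewrite l'E; case: eqP => [->|//] /andP[-> _] /=.
      by rewrite l'E eqxx in zj.
    have := zl i; rewrite !mxE eqxx /=.
    have [->|ij] := eqVneq i j; last by rewrite mulr0 addr0 l'E (negbTE ij).
    by rewrite mulr1 zj /= => /andP[_]; rewrite l'E eqxx -addrA -splitr.
  - have := zl i; rewrite l'E; case: eqP => // _ /andP[-> h] /=.
    by apply: lt_le_trans h _; rewrite lerD2l ler_pdivrMr// ler_pMr// ler1n.
  - have := zl i; rewrite !mxE eqxx /=.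
    have [->|ij] := eqVneq i j; last by rewrite mulr0 addr0 l'E (negbTE ij).
    rewrite mulr1 l'E eqxx -addrA -splitr => /andP[h ->]; rewrite andbT.
    by apply: le_trans h; rewrite lerDl divr_ge0 ?ltW.
have bD : [disjoint box x l' & box (x + l' 0 j *: 'e_j) l'].
  apply/disj_setPS => z [/(_ j) /andP[_ h1] /(_ j) /andP[h2 _]].
  by move: h2; rewrite !mxE !eqxx mulr1 leNgt h1.
have intb y : leb.-integrable (box y l') (EFin \o u).
  by apply: intu; [exact: measurable_box|rewrite bm ltry].
rewrite /mean bU Rintegral_setU//; [|exact: measurable_box|exact: measurable_box|]; last first.
  rewrite -bU; apply: intu; first exact: measurable_box.
  by rewrite lebesgue_rV_box ?ltry// => i; exact: ltW.
rewrite Rintegral_boxD// ml.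
have := mean_line_le (l' 0 j) j (measurable_box x l') (bm x) m0; move: m0.
move: (\int[leb]_(_ in _) _) (\int[leb]_(_ in _) _) (\prod_(i < n) l' 0 i).
move=> b c P P0; rewrite (gtr0_norm (l'0 j)) => H; apply: le_trans H.
have -> : (2 * P)^-1 * (b + c) - P^-1 * b = 2^-1 * (P^-1 * (c - b)).
  by field; rewrite gt_eqF.
rewrite !normrM gtr0_norm ?invr_gt0// (gtr0_norm (_ : 0 < P^-1)) ?invr_gt0//.
rewrite ler_piMl//; last by lra.
by rewrite mulr_ge0// invr_ge0 ltW.
Qed.

Let theta : R := 2 `^ (- alpha).

Let theta_lt1 : theta < 1.
Proof.
rewrite /theta powRN invf_lt1 ?powR_gt0//.
rewrite [ltLHS](_ : _ = 1 `^ alpha); last by rewrite powR1.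
by rewrite gt0_ltr_powR ?nnegrE// ltr1n.
Qed.

Let theta_gt0 : 0 < theta. Proof. exact: powR_gt0. Qed.

(* Halving the n sides of a cube one at a time moves the mean; the denominator
   sums the resulting geometric series of ratio [2 `^ (- alpha)]. *)
Definition morrey_cst : R := n%:R / (1 - 2 `^ (- (1 - n%:R / p))).

Let K : R := morrey_cst * D.

Let K0 : 0 <= K.
Proof. by rewrite mulr_ge0// divr_ge0// subr_ge0 ltW. Qed.

Let KE : n%:R * D = (1 - theta) * K.
Proof. by rewrite /K/morrey_cst -/alpha -/theta; field; rewrite gt_eqF// subr_gt0. Qed.

Let cube (r : R) : 'rV[R]_n := const_mx r.

(** Origin of the Hoelder exponent: a displacement by [s] costs the factor [s], and a cube of side
    [s] contributes its volume s^n to the power -1/p. *)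
Let scaleE (s : R) : 0 < s -> s * ((s ^+ n) `^ (- p^-1) * D) = s `^ alpha * D.
Proof.
move=> s0; rewrite -powR_mulrn ?ltW// -powRrM mulrA; congr (_ * _).
rewrite -[X in X * _]powRr1 ?ltW// -powRD ?(gt_eqF s0) ?implybT//.
by rewrite mulrN.
Qed.

Lemma mean_cube_halve x (r : R) : 0 < r ->
  `|mean x (cube r) - mean x (cube (r / 2))| <= n%:R * D * (r / 2) `^ alpha.
Proof.
move=> r0; have r20 : 0 < r / 2 by rewrite divr_gt0.
pose l k : 'rV[R]_n := \row_i if (i < k)%N then r / 2 else r.
have step k (kn : (k < n)%N) : `|mean x (l k) - mean x (l k.+1)| <= (r / 2) `^ alpha * D.
  have l0 i : 0 < l k 0 i by rewrite mxE; case: ifP.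
  have lE i : l k.+1 0 i = if i == Ordinal kn then l k 0 i / 2 else l k 0 i.
    rewrite !mxE -val_eqE /= ltnS leq_eqVlt; case: eqVneq => [->|] //=.
    by rewrite ltnn.
  apply: le_trans (mean_halve x l0 lE) _.
  rewrite -scaleE// mxE /= ltnS leqnn ler_wpM2l ?(ltW r20)// ler_wpM2r//.
  (* A partially halved box has volume at least that of the small cube, and the negative exponent
     reverses the inequality. *)
  rewrite !powRN lef_pV2 ?posrE ?powR_gt0 ?exprn_gt0 ?prodr_gt0//; last first.
    by move=> i _; rewrite mxE; case: ifP.
  rewrite ge0_ler_powR ?nnegrE ?invr_ge0 ?exprn_ge0 ?prodr_ge0 ?(ltW p0) ?(ltW r20)//.
    by move=> i _; rewrite mxE; case: ifP => _; exact: ltW.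
  rewrite -[X in _ ^+ X]card_ord -prodr_const; apply: ler_prod => i _.
  by rewrite (ltW r20) mxE; case: ifP => // _; lra.
have tele k : (k <= n)%N ->
    `|mean x (l 0%N) - mean x (l k)| <= k%:R * ((r / 2) `^ alpha * D).
  elim: k => [_|k IH kn]; first by rewrite subrr normr0 mul0r.
  rewrite -natr1 mulrDl mul1r.
  have -> : mean x (l 0%N) - mean x (l k.+1) = (mean x (l 0%N) - mean x (l k)) +
    (mean x (l k) - mean x (l k.+1)) by ring.
  by apply: le_trans (ler_normD _ _) (lerD (IH (ltnW kn)) (step _ kn)).
have := tele n (leqnn n); rewrite (_ : l 0%N = cube r); last by apply/rowP => i; rewrite !mxE.
rewrite (_ : l n = cube (r / 2)); last by apply/rowP => i; rewrite !mxE ltn_ord.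
by move=> /le_trans; apply; rewrite mulrAC mulrA [leRHS]mulrAC mulrAC.
Qed.

(** The increments form a geometric series of ratio [theta], and [K] is n D / (1 - theta). The
    factor [1 - theta ^+ k] plays the role of the partial sum and lets the induction close, with
    nonnegative slack proportional to (1 - theta)^2. *)
Lemma mean_cube_dyadic x (r : R) k : 0 < r ->
  `|mean x (cube r) - mean x (cube (r / 2 ^+ k))| <= K * r `^ alpha * (1 - theta ^+ k).
Proof.
move=> r0; elim: k => [|k IH].
  by rewrite expr0 divr1 subrr normr0 mulr_ge0// ?subrr// mulr_ge0// powR_ge0.
have -> : mean x (cube r) - mean x (cube (r / 2 ^+ k.+1)) =
  (mean x (cube r) - mean x (cube (r / 2 ^+ k))) +
  (mean x (cube (r / 2 ^+ k)) - mean x (cube (r / 2 ^+ k.+1))) by ring.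
apply: le_trans (ler_normD _ _) _.
have rk0 : 0 < r / 2 ^+ k by rewrite divr_gt0// exprn_gt0.
have := mean_cube_halve x rk0.
have -> : r / 2 ^+ k / 2 = r / 2 ^+ k.+1 by rewrite exprSr invfM mulrA.
have -> : (r / 2 ^+ k.+1) `^ alpha = r `^ alpha * theta ^+ k.+1.
  rewrite powRM ?invr_ge0 ?exprn_ge0 ?(ltW r0)//; congr (_ * _).
  rewrite /theta -!powR_mulrn ?powR_ge0// -powRN -!powRrM.
  by rewrite mulNr mulrC mulNr.
rewrite KE => H; apply: le_trans (lerD IH H) _.
rewrite -subr_ge0.
have -> : K * r `^ alpha * (1 - theta ^+ k.+1) - (K * r `^ alpha * (1 - theta ^+ k) +
  (1 - theta) * K * (r `^ alpha * theta ^+ k.+1)) =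
  K * r `^ alpha * (theta ^+ k * (1 - theta) ^+ 2) by rewrite exprS; ring.
apply: mulr_ge0; first by rewrite mulr_ge0 ?powR_ge0.
by apply: mulr_ge0; [apply: exprn_ge0; exact: ltW|exact: sqr_ge0].
Qed.

Lemma mean_cube_near x (e : R) : 0 < e ->
  exists2 d, 0 < d & forall r, 0 < r < d -> `|mean x (cube r) - u x| <= e.
Proof.
move=> e0; have /cvgrPdist_le/(_ e e0)/nbhs_ballP[d /= d0 xd] := @cu x.
exists d => // r /andP[r0 rd].
have c0 i : 0 < cube r 0 i by rewrite mxE.
have m0 : 0 < \prod_(j < n) cube r 0 j by exact: prodr_gt0.
have bm := @lebesgue_rV_box _ _ x (cube r) (fun i => ltW (c0 i)).
have mb := measurable_box x (cube r).
have iu : leb.-integrable (box x (cube r)) (EFin \o u) by apply: intu => //; rewrite bm ltry.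
have ic (c : R) : leb.-integrable (box x (cube r)) (EFin \o cst c).
  by apply: (@integrable_bounded_rV _ _ _ _ `|c|) => //; rewrite bm ltry.
have uxE : u x = (\prod_(j < n) cube r 0 j)^-1 * \int[leb]_(z in box x (cube r)) cst (u x) z.
  by rewrite Rintegral_cst// (congr1 fine bm) /= mulrCA mulVf ?mulr1// gt_eqF.
rewrite [in X in _ - X]uxE /mean -mulrBr -RintegralB// normrM gtr0_norm ?invr_gt0//.
rewrite ler_pdivrMl//.
have iub : leb.-integrable (box x (cube r)) (EFin \o (fun z => u z - u x)).
  exact: (integrableB mb iu (ic (u x))).
apply: le_trans (le_normr_Rintegral mb iub) _.
apply: (@le_trans _ _ (\int[leb]_(z in box x (cube r)) cst e z)).
  apply: le_Rintegral => //.
    by move/integrable_norm : iub; exact.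
  move=> z zb; rewrite distrC; apply: xd; split => // i j; rewrite ord1 /ball/=.
  have := zb j; rewrite mxE => /andP[h1 h2].
  by rewrite distrC ger0_norm ?subr_ge0//; lra.
by rewrite Rintegral_cst// (congr1 fine bm) /= mulrC.
Qed.

(** As the dyadic cubes shrink, their means tend to [u x] by continuity, while the dyadic bound
    stays below K r^alpha. *)
Lemma mean_cube_le x (r : R) : 0 < r ->
  `|u x - mean x (cube r)| <= K * r `^ alpha.
Proof.
move=> r0; apply/ler_addgt0Pr => e e0.
have [d d0 xd] := mean_cube_near x e0.
have [k rk] : exists k, r / 2 ^+ k < d.
  exists (Num.bound (r / d)); rewrite ltr_pdivrMr ?exprn_gt0// -ltr_pdivrMl// mulrC.
  apply: (lt_le_trans (archi_boundP _)); first by rewrite divr_ge0 ?ltW.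
  by rewrite -natrX ler_nat; exact/ltnW/ltn_expl.
have rk0 : 0 < r / 2 ^+ k by rewrite divr_gt0// exprn_gt0.
have -> : u x - mean x (cube r) = - (mean x (cube (r / 2 ^+ k)) - u x) -
  (mean x (cube r) - mean x (cube (r / 2 ^+ k))) by ring.
apply: le_trans (ler_normB _ _) _; rewrite normrN addrC.
apply: lerD; last by apply: xd; rewrite rk0.
apply: le_trans (mean_cube_dyadic x k r0) _.
apply: ler_piMr; first by rewrite mulr_ge0 ?powR_ge0.
by rewrite gerBl exprn_ge0// ltW.
Qed.

(** The factor 3 counts three terms of size K r^alpha with r = |x - y|: each value against the mean
    over a cube of side r, and the two means against each other, moving the corner from x to y one
    coordinate at a time. The sup bound [M] serves integrability only and does not enter the
    constant, which is why the estimate survives density arguments. *)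
Lemma morrey x y : `|u x - u y| <= 3 * K * `|x - y| `^ alpha.
Proof.
have [->|xy] := eqVneq x y.
  by rewrite subrr normr0 mulr_ge0 ?powR_ge0// mulr_ge0.
pose r := `|x - y|; have r0 : 0 < r by rewrite normr_gt0 subr_eq0.
pose z k : 'rV[R]_n := \row_i if (i < k)%N then y 0 i else x 0 i.
have c0 i : 0 < cube r 0 i by rewrite mxE.
have step k (kn : (k < n)%N) :
    `|mean (z k) (cube r) - mean (z k.+1) (cube r)| <= r `^ alpha * D.
  pose i := Ordinal kn; pose h := y 0 i - x 0 i.
  have -> : z k.+1 = z k + h *: 'e_i.
    apply/rowP => j; rewrite !mxE eqxx /= ltnS leq_eqVlt -val_eqE /=.
    case: eqVneq => [jk|] /=; last by rewrite mulr0 addr0.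
    have -> : j = i by exact/val_inj.
    by rewrite /h ltnn mulr1 addrC subrK.
  rewrite distrC; apply: le_trans (meanD _ _ _ c0) _.
  rewrite -scaleE// (eq_bigr (fun=> r)) => [|j _]; last by rewrite mxE.
  rewrite prodr_const card_ord ler_wpM2r ?mulr_ge0 ?powR_ge0//.
  by have := rV_coord_le (x - y) i; rewrite !mxE distrC.
have tele k : (k <= n)%N ->
    `|mean (z 0%N) (cube r) - mean (z k) (cube r)| <= k%:R * (r `^ alpha * D).
  elim: k => [_|k IH kn]; first by rewrite subrr normr0 mul0r.
  rewrite -natr1 mulrDl mul1r.
  have -> : mean (z 0%N) (cube r) - mean (z k.+1) (cube r) =
    (mean (z 0%N) (cube r) - mean (z k) (cube r)) +
    (mean (z k) (cube r) - mean (z k.+1) (cube r)) by ring.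
  by apply: le_trans (ler_normD _ _) (lerD (IH (ltnW kn)) (step _ kn)).
have := tele n (leqnn n); rewrite (_ : z 0%N = x); last by apply/rowP => i; rewrite !mxE.
rewrite (_ : z n = y); last by apply/rowP => i; rewrite !mxE ltn_ord.
rewrite mulrCA KE => H.
have {}H : `|mean x (cube r) - mean y (cube r)| <= K * r `^ alpha.
  apply: le_trans H _; rewrite [leRHS]mulrC ler_wpM2l ?powR_ge0//.
  by apply: ler_piMl => //; rewrite gerBl ltW.
have := mean_cube_le x r0; have := mean_cube_le y r0; move: H.
rewrite -/r -mulrA; move: (mean x _) (mean y _) (K * _) => a b c.
rewrite !ler_norml => /andP[h1 h2] /andP[h3 h4] /andP[h5 h6].
by apply/andP; split; lra.
Qed.

End morrey.

(** * Supports, bounds and weak gradients of test functions *)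

Section test_functions.
Context {R : realType} {n : nat} (Omega : set 'rV[R]_n).
Local Notation leb := (@lebesgue_rV R n).
Implicit Types (phi psi : 'rV[R]_n -> R) (x : 'rV[R]_n).

Definition cgrad phi x : 'rV[R]_n := \row_i partial i phi x.

Lemma partial_out phi i x : ~ closure [set x | phi x != 0] x -> partial i phi x = 0.
Proof.
move=> nx; rewrite /partial.
suff [] : is_derive x ('e_i : 'rV[R]_n) phi 0 by [].
apply: (@near_eq_is_derive _ _ _ (cst 0)).
have : open (~` closure [set x | phi x != 0]) by exact/closed_openC/closed_closure.
move=> oS; near=> y.
have : (~` closure [set x | phi x != 0]) y by near: y; exact: open_nbhs_nbhs.
move=> ny; apply/esym/eqP; apply: contrapT => /negP y0; apply: ny.
exact: subset_closure.
Unshelve. all: by end_near. Qed.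

Lemma test_smooth phi : test_function Omega phi -> smooth phi.
Proof. by case. Qed.

Lemma test_out phi x : test_function Omega phi -> ~ Omega x ->
  phi x = 0 /\ forall i, partial i phi x = 0.
Proof.
move=> [_ _ sO] Ox; split; last by move=> i; apply: partial_out => /sO.
by apply/eqP; apply: contrapT => /negP x0; apply/Ox/sO; exact: subset_closure.
Qed.

Lemma test_supp phi : test_function Omega phi ->
  exists r, forall x, r < `|x| -> phi x = 0 /\ forall i, partial i phi x = 0.
Proof.
move=> [_ /compact_bounded[r [_ rP]] _]; exists (r + 1) => x rx.
have nx : ~ closure [set x | phi x != 0] x.
  have r1 : r < r + 1 by rewrite ltrDl.
  by move=> /(rP _ r1) /=; rewrite leNgt rx.
split; last by move=> i; exact: partial_out.
by apply/eqP; apply: contrapT => /negP x0; apply: nx; exact: subset_closure.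
Qed.

Lemma continuous_supp_bounded (f : 'rV[R]_n -> R) (r : R) : continuous f ->
  (forall x, r < `|x| -> f x = 0) -> exists M, forall x, `|f x| <= M.
Proof.
move=> cf f0; pose B := [set x : 'rV[R]_n | `|x| <= r].
have cB : compact B.
  rewrite (_ : B = cbox (const_mx (- r)) (const_mx r) `&` B).
    apply: compact_closedI; first exact: compact_cbox.
    have /continuous_closedP/(_ `]-oo, r]%classic) := @norm_continuous R 'rV[R]_n.
    rewrite (_ : _ @^-1` _ = B); first by apply; exact: interval_closed.
    by apply/seteqP; split => x /=; rewrite in_itv.
  apply/seteqP; split => [x xr|x []//]; split => // i; rewrite !mxE -ler_norml.
  by apply: le_trans xr; exact: rV_coord_le.
have cfB : {within B, continuous f} by exact: continuous_subspaceT.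
have /compact_bounded[M [_ MP]] := continuous_compact cfB cB.
exists (`|M| + 1) => x; have [xr|xr] := leP `|x| r.
  apply: (MP (`|M| + 1)); first by rewrite (le_lt_trans (ler_norm _))// ltrDl.
  by exists x.
by rewrite f0// normr0 addr_ge0.
Qed.

Lemma test_bounded phi : test_function Omega phi ->
  exists M, (forall x, `|phi x| <= M) /\ forall i x, `|partial i phi x| <= M.
Proof.
move=> tphi; have [r rP] := test_supp tphi; have sphi := test_smooth tphi.
have [M0 M0P] := continuous_supp_bounded (smooth_continuous sphi) (fun x xr => (rP x xr).1).
have /choice[M MP] : forall i, exists M, forall x, `|partial i phi x| <= M.
  move=> i; apply: (@continuous_supp_bounded _ r).
    exact: smooth_continuous (smooth_partial i sphi).
  by move=> x /rP[].
exists (`|M0| + \sum_i `|M i|); split => [x|i x].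
  apply: le_trans (M0P x) _; rewrite (le_trans (ler_norm _))// lerDl.
  exact: sumr_ge0.
apply: le_trans (MP i x) _; rewrite (le_trans (ler_norm _))//.
by rewrite (bigD1 i)//= addrCA lerDl addr_ge0// sumr_ge0.
Qed.

Lemma test_functionD phi psi (c : R) : test_function Omega phi ->
  test_function Omega psi -> test_function Omega (phi \+ (c \*o psi)).
Proof.
move=> tphi tpsi; have [sphi kphi subphi] := tphi; have [spsi kpsi subpsi] := tpsi.
have sub : closure [set x | phi x + c * psi x != 0] `<=`
    closure [set x | phi x != 0] `|` closure [set x | psi x != 0].
  rewrite -closureU; apply: closure_subset => x /=.
  have [->|] := eqVneq (phi x) 0; last by left.
  have [->|] := eqVneq (psi x) 0; last by right.
  by rewrite mulr0 addr0 eqxx.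
split.
- by apply: smoothD => //; exact: smoothZ.
- apply: (subclosed_compact _ _ sub); first exact: closed_closure.
  exact: compactU.
- by apply: subset_trans sub _ => x [/subphi|/subpsi].
Qed.

Lemma Rintegral_test (f : 'rV[R]_n -> R) : (forall x, ~ Omega x -> f x = 0) ->
  \int[leb]_(x in Omega) f x = \int[leb]_x f x.
Proof.
move=> f0; rewrite Rintegral_mkcond; apply: eq_Rintegral => x _.
by rewrite patchE; case: ifPn => //; rewrite notin_setE => /f0.
Qed.

Hypothesis oO : open Omega.

Lemma continuous_loc_integrable (f : 'rV[R]_n -> R) (M : R) : continuous f ->
  (forall x, `|f x| <= M) -> loc_integrable Omega f.
Proof.
move=> cf fM; have mf := continuous_measurable_rV cf; split.
  exact: measurable_funTS.
move=> K /[dup] /compact_bounded[r [_ rP]] cK KO.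
have mK : measurable K.
  have clK : closed K by apply: compact_closed => //; exact: norm_hausdorff.
  by rewrite -(setCK K); apply: measurableC; apply: open_measurable_rV; exact: closed_openC.
apply: (@integrable_bounded_rV _ _ _ _ M) => //; last exact: measurable_funTS.
apply: (@lebesgue_rV_bounded _ _ _ (r + 1)) => // x Kx.
by apply: (rP (r + 1)) => //; rewrite ltrDl.
Qed.

(** Integration by parts: the product of the two test functions has compact support, so its partial
    derivative integrates to 0 by [Rintegral_partial0], and the product rule splits that
    integral. *)
Lemma test_weak_gradient phi : test_function Omega phi ->
  weak_gradient Omega phi (cgrad phi).
Proof.
move=> tphi; have sphi := test_smooth tphi; have [M [M0 M1]] := test_bounded tphi.
have cphi := smooth_continuous sphi.
have cdphi i : continuous (partial i phi) by exact: smooth_continuous (smooth_partial i sphi).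
split; first exact: continuous_loc_integrable M0.
  move=> i; rewrite (_ : (fun x => _) = partial i phi).
    exact: continuous_loc_integrable (M1 i).
  by apply/funext => x; rewrite mxE.
move=> i psi tpsi; have spsi := test_smooth tpsi; have [M' [M'0 M'1]] := test_bounded tpsi.
have cpsi := smooth_continuous spsi.
have cdpsi : continuous (partial i psi) by exact: smooth_continuous (smooth_partial i spsi).
have [r rP] := test_supp tphi.
have M_ge0 : 0 <= M by exact: le_trans (M0 0).
have int1 : leb.-integrable setT (EFin \o (fun x => phi x * partial i psi x)).
  apply: (@integrable_supp_rV _ _ _ (M * M') r).
  - by apply: measurable_funM; exact: continuous_measurable_rV.
  - by move=> x; rewrite normrM ler_pM.
  - by move=> x /rP[-> _]; rewrite mul0r.
have int2 : leb.-integrable setT (EFin \o (fun x => cgrad phi x 0 i * psi x)).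
  rewrite (_ : (fun x => _) = partial i phi \* psi); last first.
    by apply/funext => x; rewrite mxE.
  apply: (@integrable_supp_rV _ _ _ (M * M') r).
  - by apply: measurable_funM; exact: continuous_measurable_rV.
  - by move=> x; rewrite normrM ler_pM.
  - by move=> x /rP[_ h]; rewrite /= h mul0r.
rewrite Rintegral_test; last by move=> x /(test_out tphi)[-> _]; rewrite mul0r.
rewrite Rintegral_test; last first.
  by move=> x /(test_out tphi)[_ h]; rewrite mxE h mul0r.
apply/eqP; rewrite -addr_eq0 -RintegralD//; apply/eqP.
rewrite -[RHS](@Rintegral_partial0 _ _ (phi \* psi) i (M * M') (M * M' + M' * M) r).
- apply: eq_Rintegral => x _; rewrite (partialM i sphi spsi) mxE /=.
  by congr (_ + _); rewrite mulrC.
- by move=> x; exact: (cvgM (@cphi x) (@cpsi x)).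
- by move=> x; apply: derivableM; exact: smooth_derivable.
- by move=> x; rewrite normrM ler_pM.
- move=> x; rewrite (partialM i sphi spsi) /=.
  by apply: le_trans (ler_normD _ _) _; rewrite !normrM lerD// ler_pM.
- by move=> x /rP[h _]; rewrite /= h mul0r.
- by move=> x /rP[h1 h2]; rewrite (partialM i sphi spsi) /= h1 h2 mul0r mulr0 addr0.
Qed.

End test_functions.

(** * Sobolev functions *)

Section enorm.
Context {R : realType} {n : nat}.
Implicit Types (a b : 'rV[R]_n).

Lemma enorm_ge0 a : 0 <= enorm a. Proof. exact: sqrtr_ge0. Qed.

Let sumsq_ge0 a : 0 <= \sum_(i < n) a 0 i ^+ 2.
Proof. by apply: sumr_ge0 => i _; exact: sqr_ge0. Qed.

Lemma enorm_sqr a : enorm a ^+ 2 = \sum_(i < n) a 0 i ^+ 2.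
Proof. by rewrite sqr_sqrtr. Qed.

Lemma enormZ c a : enorm (c *: a) = `|c| * enorm a.
Proof.
rewrite /enorm; under eq_bigr do rewrite mxE exprMn.
by rewrite -mulr_sumr sqrtrM ?sqr_ge0// sqrtr_sqr.
Qed.

Lemma coord_le_enorm a i : `|a 0 i| <= enorm a.
Proof.
rewrite -(ler_pXn2r (n := 2)) ?nnegrE ?enorm_ge0// enorm_sqr real_normK ?num_real//.
by rewrite (bigD1 i)//= lerDl sumr_ge0// => j _; exact: sqr_ge0.
Qed.

Lemma enorm_le_sum a : enorm a <= \sum_(i < n) `|a 0 i|.
Proof.
rewrite -(ler_pXn2r (n := 2)) ?nnegrE ?enorm_ge0 ?sumr_ge0//.
rewrite enorm_sqr expr2 mulr_suml; apply: ler_sum => i _.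
rewrite -real_normK ?num_real// expr2 ler_wpM2l// (bigD1 i)//= lerDl.
by rewrite sumr_ge0.
Qed.

Lemma cauchy_schwarz a b :
  (\sum_(i < n) a 0 i * b 0 i) ^+ 2 <=
  (\sum_(i < n) a 0 i ^+ 2) * (\sum_(i < n) b 0 i ^+ 2).
Proof.
set c := \sum_i _ * _; set A := \sum_i a _ _ ^+ 2; set B := \sum_i b _ _ ^+ 2.
have H : 0 <= B * (A * B - c ^+ 2).
  have -> : B * (A * B - c ^+ 2) = \sum_(i < n) (B * a 0 i - c * b 0 i) ^+ 2.
    rewrite [RHS](eq_bigr (fun i => B ^+ 2 * a 0 i ^+ 2 +
      (- (2 * B * c)) * (a 0 i * b 0 i) + c ^+ 2 * b 0 i ^+ 2)); last first.
      by move=> i _; ring.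
    by rewrite !big_split -!mulr_sumr -/A -/B -/c /=; ring.
  by apply: sumr_ge0 => i _; exact: sqr_ge0.
have [B0|B0] := eqVneq B 0.
  have b0 i : b 0 i = 0.
    apply/eqP; rewrite -sqrf_eq0; apply/eqP.
    apply: (@psumr_eq0P _ _ xpredT (fun i => b 0 i ^+ 2)) => // j _.
    exact: sqr_ge0.
  rewrite /c big1 ?expr0n ?mulr_ge0 ?sumsq_ge0// => i _.
  by rewrite b0 mulr0.
have Bp : 0 < B by rewrite lt_neqAle eq_sym B0 sumsq_ge0.
by rewrite -subr_ge0 -(pmulr_rge0 _ Bp).
Qed.

Lemma enormD a b : enorm (a + b) <= enorm a + enorm b.
Proof.
rewrite -(ler_pXn2r (n := 2)) ?nnegrE ?addr_ge0 ?enorm_ge0//.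
rewrite sqrrD !enorm_sqr; under eq_bigr do rewrite mxE sqrrD.
rewrite !big_split /= lerD2r lerD2l -mulr2n lerMn2r /=.
rewrite (le_trans (ler_norm _))// -(ler_pXn2r (n := 2)) ?nnegrE ?mulr_ge0 ?enorm_ge0//.
by rewrite real_normK ?num_real// exprMn !enorm_sqr cauchy_schwarz.
Qed.

Lemma enorm_parallelogram a b :
  enorm (a + b) ^+ 2 + enorm (a - b) ^+ 2 = 2 * (enorm a ^+ 2 + enorm b ^+ 2).
Proof.
rewrite !enorm_sqr -!big_split mulr_sumr; apply: eq_bigr => i _.
by rewrite /= !mxE; ring.
Qed.

Lemma measurable_enorm d (T : measurableType d) (D : set T) (G : T -> 'rV[R]_n) :
  (forall i, measurable_fun D (fun x => G x 0 i)) ->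
  measurable_fun D (fun x => enorm (G x)).
Proof.
move=> mG; apply: (@measurableT_comp _ _ _ _ _ _ (@Num.sqrt R)).
  by apply: continuous_measurable_fun; exact: sqrt_continuous.
by apply: measurable_sum => i; exact: measurable_funX.
Qed.

End enorm.

(** * The L^p norm on [Omega] *)

Section normL.
Context {R : realType} {n : nat} (Omega : set 'rV[R]_n).
Local Notation leb := (@lebesgue_rV R n).
Hypothesis mO : measurable Omega.
Variable p : R.
Hypothesis p1 : 1 <= p.
Implicit Types (u v : 'rV[R]_n -> R).

Let p0 : 0 < p. Proof. exact: lt_le_trans p1. Qed.

Lemma inLP u : inL Omega p%:E u <->
  measurable_fun Omega u /\ (normL Omega p%:E u < +oo)%E.
Proof.
rewrite /inL inE; split => [/andP[]|[mu uoo]].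
  by rewrite !inE /= => mu; split => //; apply/measurable_restrictT.
apply/andP; rewrite !inE /=; split; last exact: uoo.
exact/(measurable_restrictT _ mO).
Qed.

Lemma normL_powR u : measurable_fun Omega u ->
  (normL Omega p%:E u `^ p = \int[leb]_(x in Omega) (`|u x| `^ p)%:E)%E.
Proof.
move=> mu; rewrite /normL (poweR_Lnorm _ _ (lt0r_neq0 p0)) [RHS]integral_mkcond.
apply: eq_integral => x _; rewrite /= !patchE.
by case: ifP => // _; rewrite normr0 powR0 ?gt_eqF.
Qed.

Lemma normL_integral u : measurable_fun Omega u ->
  (normL Omega p%:E u = (\int[leb]_(x in Omega) (`|u x| `^ p)%:E) `^ p^-1)%E.
Proof.
move=> mu; rewrite -(normL_powR mu) -poweRrM divff ?(lt0r_neq0 p0)// poweRe1//.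
exact: Lnorm_ge0.
Qed.

Lemma normL_ge0 u : (0 <= normL Omega p%:E u)%E.
Proof. exact: Lnorm_ge0. Qed.

Lemma normL_fin u : inL Omega p%:E u -> normL Omega p%:E u \is a fin_num.
Proof. by move=> /inLP[_ uoo]; rewrite ge0_fin_numE// normL_ge0. Qed.

Let measurable_powR_norm u : measurable_fun Omega u ->
  measurable_fun Omega (fun x => (`|u x| `^ p)%:E).
Proof.
move=> mu; apply/measurable_EFinP; apply: (@measurableT_comp _ _ _ _ _ _ (@powR R ^~ p)).
  exact: measurable_powR.
exact: measurableT_comp.
Qed.

Lemma normL_ae_le u v : measurable_fun Omega u -> measurable_fun Omega v ->
  {ae leb, forall x, Omega x -> `|u x| <= `|v x|} ->
  (normL Omega p%:E u <= normL Omega p%:E v)%E.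
Proof.
move=> mu mv uv; rewrite (normL_integral mu) (normL_integral mv).
apply: gt0_ler_poweR; rewrite ?invr_ge0 ?(ltW p0)// ?in_itv/= ?leey ?andbT.
- by apply: integral_ge0 => x _; rewrite lee_fin powR_ge0.
- by apply: integral_ge0 => x _; rewrite lee_fin powR_ge0.
apply: ae_ge0_le_integral => //.
- exact: measurable_powR_norm.
- exact: measurable_powR_norm.
apply: filterS uv => x uvx Ox; rewrite lee_fin.
by apply: ge0_ler_powR; rewrite ?nnegrE ?(ltW p0)//; exact: uvx.
Qed.

Lemma normL_le u v : measurable_fun Omega u -> measurable_fun Omega v ->
  (forall x, Omega x -> `|u x| <= `|v x|) ->
  (normL Omega p%:E u <= normL Omega p%:E v)%E.
Proof. by move=> mu mv uv; apply: normL_ae_le => //; exact: aeW. Qed.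

Lemma normL_ae u v : measurable_fun Omega u -> measurable_fun Omega v ->
  {ae leb, forall x, Omega x -> u x = v x} ->
  normL Omega p%:E u = normL Omega p%:E v.
Proof.
move=> mu mv uv; apply/eqP; rewrite eq_le; apply/andP; split.
  by apply: normL_ae_le => //; apply: filterS uv => x + Ox => /(_ Ox) ->.
by apply: normL_ae_le => //; apply: filterS uv => x + Ox => /(_ Ox) ->.
Qed.

Lemma normLD u v : measurable_fun Omega u -> measurable_fun Omega v ->
  (normL Omega p%:E (fun x => u x + v x)%R <=
   normL Omega p%:E u + normL Omega p%:E v)%E.
Proof.
move=> mu mv; rewrite /normL.
rewrite (_ : (fun x => u x + v x)%R \_ Omega = (u \_ Omega) \+ (v \_ Omega)).
  apply: minkowski_EFin => //; exact/(measurable_restrictT _ mO).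
by apply/funext => x; rewrite /= !patchE; case: ifP; rewrite ?addr0.
Qed.

Lemma normLZ u c : measurable_fun Omega u ->
  normL Omega p%:E (fun x => c * u x) = (`|c|%:E * normL Omega p%:E u)%E.
Proof.
move=> mu; have mcu : measurable_fun Omega (fun x => c * u x) by exact: measurable_funM.
rewrite (normL_integral mu) (normL_integral mcu).
rewrite (_ : (\int[leb]_(x in Omega) (`|(c * u x)%R| `^ p)%:E =
  (`|c| `^ p)%:E * \int[leb]_(x in Omega) (`|u x| `^ p)%:E))%E.
  rewrite poweRM ?lee_fin ?powR_ge0//; last first.
    by apply: integral_ge0 => x _; rewrite lee_fin powR_ge0.
  by rewrite poweR_EFin -powRrM divff ?gt_eqF// powRr1.
rewrite -ge0_integralZl//.
  by apply: eq_integral => x _; rewrite normrM powRM// EFinM.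
exact: measurable_powR_norm.
Qed.

Lemma inLD u v c : inL Omega p%:E u -> inL Omega p%:E v ->
  inL Omega p%:E (fun x => u x + c * v x).
Proof.
move=> /inLP[mu uoo] /inLP[mv voo]; apply/inLP.
have mcv : measurable_fun Omega (fun x => c * v x) by exact: measurable_funM.
split; first exact: measurable_funD.
apply: le_lt_trans (normLD mu mcv) _; rewrite normLZ//.
by rewrite lte_add_pinfty// lte_mul_pinfty.
Qed.

Lemma inL_le u v : measurable_fun Omega u -> inL Omega p%:E v ->
  (forall x, Omega x -> `|u x| <= `|v x|) -> inL Omega p%:E u.
Proof.
move=> mu /inLP[mv voo] uv; apply/inLP; split => //.
exact: le_lt_trans (normL_le mu mv uv) voo.
Qed.

Lemma inL_bounded u (M : R) : (leb Omega < +oo)%E -> measurable_fun Omega u ->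
  (forall x, Omega x -> `|u x| <= M) -> inL Omega p%:E u.
Proof.
move=> Ooo mu uM; apply/inLP; split => //; rewrite (normL_integral mu).
apply: poweR_lty; apply: (@le_lt_trans _ _ (\int[leb]_(x in Omega) (M `^ p)%:E)%E).
  apply: ge0_le_integral => //; first exact: measurable_powR_norm.
  move=> x Ox; rewrite lee_fin ge0_ler_powR ?nnegrE ?(ltW p0)//.
    exact: le_trans (uM _ Ox).
  exact: uM.
by rewrite integral_cst// lte_mul_pinfty ?lee_fin ?powR_ge0.
Qed.

End normL.

(** * Weak gradients: linearity and uniqueness *)

Section weak_gradients.
Context {R : realType} {n : nat} (Omega : set 'rV[R]_n).
Local Notation leb := (@lebesgue_rV R n).
Hypothesis oO : open Omega.
Implicit Types (u v g : 'rV[R]_n -> R) (G H : 'rV[R]_n -> 'rV[R]_n).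

Let mO : measurable Omega. Proof. exact: open_measurable_rV. Qed.

Lemma compact_measurable_rV (K : set 'rV[R]_n) : compact K -> measurable K.
Proof.
move=> cK; rewrite -(setCK K); apply: measurableC; apply: open_measurable_rV.
by apply: closed_openC; apply: compact_closed => //; exact: norm_hausdorff.
Qed.

Lemma integrable_EFinZ (D : set 'rV[R]_n) g c : measurable D ->
  leb.-integrable D (EFin \o g) -> leb.-integrable D (EFin \o (fun x => c * g x)).
Proof. by move=> mD ig; have := integrableZl mD c ig; exact. Qed.

Lemma loc_integrableD g h c : loc_integrable Omega g -> loc_integrable Omega h ->
  loc_integrable Omega (fun x => g x + c * h x).
Proof.
move=> [mg ig] [mh ih]; split.
  by apply: measurable_funD => //; exact: measurable_funM.
move=> K cK KO; have mK := compact_measurable_rV cK.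
have := integrableD mK (ig K cK KO) (integrableZl mK c (ih K cK KO)).
exact.
Qed.

Lemma integrable_loc_mul g (psi : 'rV[R]_n -> R) (M : R) (K : set 'rV[R]_n) :
  loc_integrable Omega g -> continuous psi -> (forall x, `|psi x| <= M) ->
  compact K -> K `<=` Omega -> (forall x, ~ K x -> psi x = 0) ->
  leb.-integrable Omega (EFin \o (fun x => g x * psi x)).
Proof.
move=> [mg ig] cpsi psiM cK KO psi0; have mK := compact_measurable_rV cK.
have M0 : 0 <= M by exact: le_trans (psiM 0).
have iK : leb.-integrable K (EFin \o (fun x => g x * psi x)).
  apply: (le_integrable mK _ _ (integrableZl mK M (ig K cK KO))).
    apply/measurable_EFinP/measurable_funM; first exact: measurable_funS mg.
    by apply: measurable_funTS; exact: continuous_measurable_rV.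
  move=> x _; rewrite lee_fin /= !normrM mulrC (ger0_norm M0).
  by rewrite ler_wpM2r.
apply/(integrable_mkcond _ mO); move/(integrable_mkcond _ mK) : iK.
congr (leb.-integrable _ _).
apply/funext => x; rewrite !patchE; case: (boolP (x \in K)) => xK.
  by rewrite mem_set//; apply: KO; rewrite inE in xK.
case: ifPn => // _; rewrite /= psi0 ?mulr0//.
by rewrite notin_setE in xK.
Qed.

Lemma test_supp_compact (phi : 'rV[R]_n -> R) : test_function Omega phi ->
  exists2 K, compact K /\ K `<=` Omega &
    forall x, ~ K x -> phi x = 0 /\ forall i, partial i phi x = 0.
Proof.
move=> [_ cK KO]; exists (closure [set x | phi x != 0]) => // x nx.
split; last by move=> i; exact: partial_out.
by apply/eqP; apply: contrapT => /negP x0; apply: nx; exact: subset_closure.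
Qed.

Lemma integrable_loc_test g phi : loc_integrable Omega g -> test_function Omega phi ->
  leb.-integrable Omega (EFin \o (fun x => g x * phi x)) /\
  forall i, leb.-integrable Omega (EFin \o (fun x => g x * partial i phi x)).
Proof.
move=> lg tphi; have [M [M0 M1]] := test_bounded tphi; have sphi := test_smooth tphi.
have [K [cK KO] K0] := test_supp_compact tphi.
split=> [|i]; apply: (@integrable_loc_mul _ _ M K) => //.
- exact: smooth_continuous sphi.
- by move=> x /K0[].
- exact: smooth_continuous (smooth_partial i sphi).
- by move=> x /K0[].
Qed.

Lemma weak_gradientD u v c G H : weak_gradient Omega u G -> weak_gradient Omega v H ->
  weak_gradient Omega (fun x => u x + c * v x) (fun x => G x + c *: H x).
Proof.
move=> [lu lG uG] [lv lH vH]; split; first exact: loc_integrableD.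
  move=> i; rewrite (_ : (fun x => _) = (fun x => G x 0 i + c * H x 0 i)).
    exact: loc_integrableD.
  by apply/funext => x; rewrite !mxE.
move=> i phi tphi.
have [_ /(_ i) iu] := integrable_loc_test lu tphi.
have [_ /(_ i) iv] := integrable_loc_test lv tphi.
have [iG _] := integrable_loc_test (lG i) tphi.
have [iH _] := integrable_loc_test (lH i) tphi.
transitivity (\int[leb]_(x in Omega) (u x * partial i phi x) +
    c * \int[leb]_(x in Omega) (v x * partial i phi x)).
  rewrite -RintegralZl// -RintegralD//; last exact: integrable_EFinZ.
  by apply: eq_Rintegral => x _; rewrite mulrDl mulrA.
rewrite uG// vH// mulrN -opprD -RintegralZl// -RintegralD//; last exact: integrable_EFinZ.
by congr (- _); apply: eq_Rintegral => x _; rewrite !mxE mulrDl mulrA.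
Qed.

(** Each coordinate of the difference integrates to 0 against every test function, so [weak_zero]
    applies coordinate by coordinate. *)
Lemma weak_gradient_uniq u G H : weak_gradient Omega u G -> weak_gradient Omega u H ->
  {ae leb, forall x, Omega x -> G x = H x}.
Proof.
move=> [_ lG uG] [_ lH uH].
have : forall i, {ae leb, forall x, Omega x -> G x 0 i + -1 * H x 0 i = 0}.
  move=> i; apply: weak_zero => //; first exact: loc_integrableD.
  move=> phi tphi.
  have [iG _] := integrable_loc_test (lG i) tphi.
  have [iH _] := integrable_loc_test (lH i) tphi.
  transitivity (\int[leb]_(x in Omega) (G x 0 i * phi x) -
    \int[leb]_(x in Omega) (H x 0 i * phi x)).
    by rewrite -RintegralB//; apply: eq_Rintegral => x _; ring.
  apply/eqP; rewrite subr_eq0 -eqr_opp; apply/eqP.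
  by rewrite -uG// -uH.
pose P m x := if insub m is Some i then Omega x -> G x 0 (i : 'I_n) + -1 * H x 0 i = 0 else True.
move=> GH; have : forall m, {ae leb, forall x, P m x}.
  by move=> m; rewrite /P; case: insubP => [i _ _|_]; [exact: GH|exact: aeW].
move=> /ae_foralln; apply: filterS => x Px Ox; apply/rowP => i.
by apply/eqP; rewrite -subr_eq0 -mulN1r; have := Px i; rewrite /P valK => ->.
Qed.

Lemma weak_gradient_grad u G : weak_gradient Omega u G ->
  weak_gradient Omega u (grad Omega u).
Proof. by move=> uG; apply: (@xgetPex _ _ (weak_gradient Omega u)); exists G. Qed.

Lemma gradE u G : weak_gradient Omega u G ->
  {ae leb, forall x, Omega x -> grad Omega u x = G x}.
Proof. by move=> uG; exact: weak_gradient_uniq (weak_gradient_grad uG) uG. Qed.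

End weak_gradients.

(** * Sobolev functions carried with an explicit gradient field *)

Section sobolev_theory.
Context {R : realType} {n : nat} (Omega : set 'rV[R]_n) (p : R).
Local Notation leb := (@lebesgue_rV R n).
Hypothesis oO : open Omega.
Hypothesis p1 : 1 <= p.
Implicit Types (u v : 'rV[R]_n -> R) (G H : 'rV[R]_n -> 'rV[R]_n).

Let mO : measurable Omega. Proof. exact: open_measurable_rV. Qed.

Definition normG G : \bar R := normL Omega p%:E (fun x => enorm (G x)).

Definition inLG G := forall i, inL Omega p%:E (fun x => G x 0 i).

Lemma inLG_measurable G i : inLG G -> measurable_fun Omega (fun x => G x 0 i).
Proof. by move=> /(_ i) /(inLP mO) []. Qed.

Lemma inLG_measurable_enorm G : inLG G -> measurable_fun Omega (fun x => enorm (G x)).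
Proof. by move=> iG; apply: measurable_enorm => i; exact: inLG_measurable. Qed.

Lemma inLG_enorm G : inLG G -> inL Omega p%:E (fun x => enorm (G x)).
Proof.
move=> iG; have : inL Omega p%:E (fun x => \sum_(i < n) `|G x 0 i|).
  elim: (index_enum _) => [|i s IH].
    rewrite (_ : (fun x => _) = cst 0); last by apply/funext => x; rewrite big_nil.
    apply/(inLP mO); split => //.
    rewrite /normL (_ : _ \o _ = cst 0%E); last first.
      by apply/funext => x; rewrite /= patchE if_same.
    by rewrite Lnorm0// eqe gt_eqF// (lt_le_trans _ p1).
  under eq_fun do rewrite big_cons -[X in _ + X]mul1r.
  apply: inLD => //; apply: inL_le (iG i) _ => //.
    by apply: measurableT_comp => //; exact: inLG_measurable.
  by move=> x _; rewrite normr_id.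
move/(inL_le mO p1 (inLG_measurable_enorm iG)); apply => x _; rewrite ger0_norm ?enorm_ge0//.
by apply: le_trans (enorm_le_sum _) _; rewrite ger0_norm// sumr_ge0.
Qed.

Lemma normG_fin G : inLG G -> normG G \is a fin_num.
Proof. by move=> /inLG_enorm /normL_fin; exact. Qed.

Lemma normG_ge0 G : (0 <= normG G)%E. Proof. exact: normL_ge0. Qed.

Lemma inLGD G H c : inLG G -> inLG H -> inLG (fun x => G x + c *: H x).
Proof.
move=> iG iH i; rewrite (_ : (fun x => _) = (fun x => G x 0 i + c * H x 0 i)).
  exact: inLD.
by apply/funext => x; rewrite !mxE.
Qed.

Lemma inLGZ G c : inLG G -> inLG (fun x => c *: G x).
Proof.
move=> iG; rewrite (_ : (fun x => _) = (fun x => G x + (c - 1) *: G x)).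
  exact: inLGD.
by apply/funext => x; rewrite scalerBl scale1r addrC subrK.
Qed.

Lemma normGD G H c : inLG G -> inLG H ->
  (normG (fun x => G x + c *: H x)%R <= normG G + `|c|%:E * normG H)%E.
Proof.
move=> iG iH; rewrite /normG.
have mG := inLG_measurable_enorm iG; have mH := inLG_measurable_enorm iH.
rewrite -(normLZ mO p1 c mH).
have mcH : measurable_fun Omega (fun x => c * enorm (H x)) by exact: measurable_funM.
have macH : measurable_fun Omega (fun x => `|c| * enorm (H x)) by exact: measurable_funM.
have -> : normL Omega p%:E (fun x => c * enorm (H x)) =
    normL Omega p%:E (fun x => `|c| * enorm (H x)).
  by apply/eqP; rewrite eq_le; apply/andP; split; apply: normL_le => // x _;
    rewrite !normrM normr_id.
apply: le_trans (normLD mO p1 mG macH).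
apply: normL_le => //.
- exact: inLG_measurable_enorm (inLGD c iG iH).
- exact: measurable_funD.
move=> x _; rewrite (ger0_norm (enorm_ge0 _)).
rewrite [leRHS]ger0_norm ?addr_ge0 ?mulr_ge0 ?enorm_ge0//.
by rewrite -enormZ enormD.
Qed.

Lemma normG_ae G H : inLG G -> inLG H ->
  {ae leb, forall x, Omega x -> G x = H x} -> normG G = normG H.
Proof.
move=> iG iH GH; apply: normL_ae => //; [exact: inLG_measurable_enorm..|].
by apply: filterS GH => x + Ox => /(_ Ox) ->.
Qed.

(* The weak gradient is carried along explicitly because [grad] is only
   almost everywhere equal to it. *)
Definition W1p_grad u G := [/\ inL Omega p%:E u, weak_gradient Omega u G & inLG G].

Lemma W1p_gradP u : (exists G, W1p_grad u G) <-> W1p Omega p u.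
Proof.
split=> [[G [iu uG iG]]|[iu [G uG] ig]]; last first.
  by exists (grad Omega u); split => //; exact: weak_gradient_grad uG.
have uG' := weak_gradient_grad uG.
split => //; first by exists G.
move=> i; apply/(inLP mO).
have mg : measurable_fun Omega (fun x => grad Omega u x 0 i) by case: uG' => _ /(_ i)[].
have /(inLP mO)[mGi Goo] := iG i.
split => //; rewrite (normL_ae mO p1 mg mGi)//.
by apply: filterS (gradE oO uG) => x + Ox => /(_ Ox) ->.
Qed.

Lemma W1p_grad_grad u G : W1p_grad u G -> W1p_grad u (grad Omega u).
Proof.
move=> h; have /W1p_gradP[iu [G' uG'] ig] : exists G, W1p_grad u G by exists G.
by split => //; exact: weak_gradient_grad uG'.
Qed.

Lemma norm_gradE u G : W1p_grad u G -> norm_grad Omega p u = normG G.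
Proof.
move=> /[dup] /W1p_grad_grad [_ _ ig] [_ uG iG].
by apply: normG_ae => //; exact: gradE.
Qed.

Lemma W1p_gradD u v G H c : W1p_grad u G -> W1p_grad v H ->
  W1p_grad (fun x => u x + c * v x) (fun x => G x + c *: H x).
Proof.
move=> [iu uG iG] [iv vH iH]; split; [exact: inLD|exact: weak_gradientD|exact: inLGD].
Qed.

Lemma W1p_gradB u v G H : W1p_grad u G -> W1p_grad v H ->
  W1p_grad (fun x => u x - v x) (fun x => G x - H x).
Proof.
move=> h1 h2; have := W1p_gradD (-1) h1 h2; congr W1p_grad; apply/funext => x.
  by rewrite mulN1r.
by rewrite scaleN1r.
Qed.

Hypothesis Ooo : (leb Omega < +oo)%E.

Lemma W1p_grad_test phi : test_function Omega phi -> W1p_grad phi (cgrad phi).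
Proof.
move=> tphi; have [M [M0 M1]] := test_bounded tphi.
have sphi := test_smooth tphi; split.
- apply: (inL_bounded mO p1 (M := M)) => //; apply: measurable_funTS.
  exact: continuous_measurable_rV (smooth_continuous sphi).
- exact: test_weak_gradient.
- move=> i; rewrite (_ : (fun x => _) = partial i phi).
    apply: (inL_bounded mO p1 (M := M)) => //; apply: measurable_funTS.
    exact: continuous_measurable_rV (smooth_continuous (smooth_partial i sphi)).
  by apply/funext => x; rewrite mxE.
Qed.

Lemma normW1pE u G : W1p_grad u G ->
  normW1p Omega p u = (normL Omega p%:E u + normG G)%E.
Proof. by move=> h; rewrite /normW1p (norm_gradE h). Qed.

Let lte_approx (a b g h : \bar R) (c e : R) : 0 < e -> 0 <= c ->
  (0 <= b)%E -> (0 <= h)%E ->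
  a \is a fin_num -> b \is a fin_num -> g \is a fin_num -> h \is a fin_num ->
  (a + g < (e / 2)%:E)%E -> (b + h < (e / 2 / (c + 1))%:E)%E ->
  (a + c%:E * b + (g + c%:E * h) < e%:E)%E.
Proof.
move: a b g h => [a||] [b||] [g||] [h||]// e0 c0.
rewrite !lee_fin => b0 h0 _ _ _ _; rewrite -!EFinM -!EFinD !lte_fin => agh.
rewrite ltr_pdivlMr ?ltr_wpDl// => H2.
have -> : a + c * b + (g + c * h) = a + g + c * (b + h) by ring.
have : c * (b + h) <= (b + h) * (c + 1) by rewrite mulrC ler_wpM2l ?addr_ge0// lerDl.
lra.
Qed.

(** The approximation clause of [W01p] for a named field, so that later uses need no almost
    everywhere identification with [grad]. *)
Definition test_approx u G := forall e : R, 0 < e -> exists2 phi, test_function Omega phi &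
  (normL Omega p%:E (fun x => (u x - phi x)%R) + normG (fun x => (G x - cgrad phi x)%R) < e%:E)%E.

Lemma W01pP u : W01p Omega p u <-> exists2 G, W1p_grad u G & test_approx u G.
Proof.
split=> [[/W1p_gradP[G h] ap]|[G h ap]].
  exists G => // e /ap[phi tphi H]; exists phi => //.
  by rewrite -(normW1pE (W1p_gradB h (W1p_grad_test tphi))).
split; first by apply/W1p_gradP; exists G.
move=> e /ap[phi tphi H]; exists phi => //.
by rewrite (normW1pE (W1p_gradB h (W1p_grad_test tphi))).
Qed.

Lemma test_approxD u v G H c : W1p_grad u G -> W1p_grad v H -> test_approx u G -> test_approx v H ->
  test_approx (fun x => u x + c * v x) (fun x => G x + c *: H x).
Proof.
move=> hu hv au av e e0.
have c0 : 0 < `|c| + 1 by rewrite ltr_wpDl.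
have [phi tphi Hu] := au (e / 2) (divr_gt0 e0 (ltr0n _ 2)).
have [psi tpsi Hv] := av (e / 2 / (`|c| + 1)) (divr_gt0 (divr_gt0 e0 (ltr0n _ 2)) c0).
exists (phi \+ (c \*o psi)); first exact: test_functionD.
have [i1 g1 G1] := W1p_gradB hu (W1p_grad_test tphi).
have [i2 g2 G2] := W1p_gradB hv (W1p_grad_test tpsi).
have -> : (fun x => u x + c * v x - (phi \+ (c \*o psi)) x) =
  (fun x => (u x - phi x) + c * (v x - psi x)).
  by apply/funext => x /=; ring.
have -> : (fun x => G x + c *: H x - cgrad (phi \+ (c \*o psi)) x) =
  (fun x => (G x - cgrad phi x) + c *: (H x - cgrad psi x)).
  apply/funext => x; apply/rowP => i.
  have sphi := test_smooth tphi; have spsi := test_smooth tpsi.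
  rewrite !mxE (partialD i sphi (smoothZ c spsi)) (partialZ c i spsi) /=; ring.
have /(inLP mO)[m1 _] := i1; have /(inLP mO)[m2 _] := i2.
have m2c : measurable_fun Omega (fun x => c * (v x - psi x)) by exact: measurable_funM.
have h1 := normLD mO p1 m1 m2c; rewrite (normLZ mO p1 c m2) in h1.
have h2 := normGD c G1 G2.
have f1 := normL_fin mO i1; have f2 := normL_fin mO i2.
have f3 := normG_fin G1; have f4 := normG_fin G2.
apply: le_lt_trans (leeD h1 h2) _.
by apply: (lte_approx e0) Hu Hv; rewrite ?normL_ge0 ?normG_ge0.
Qed.

End sobolev_theory.

(** * Hoelder and sup bounds in W_0^{1,p}, by density *)

Section sobolev_embedding.
Context {R : realType} {n : nat} (Omega : set 'rV[R]_n) (p : R).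
Local Notation leb := (@lebesgue_rV R n).
Hypothesis oO : open Omega.
Hypothesis Ooo : (leb Omega < +oo)%E.
Hypothesis n0 : (0 < n)%N.
Hypotheses (p1 : 1 < p) (np : n%:R < p).
Implicit Types (u v phi : 'rV[R]_n -> R) (G H : 'rV[R]_n -> 'rV[R]_n) (x y : 'rV[R]_n).

Let mO : measurable Omega. Proof. exact: open_measurable_rV. Qed.
Let p1' : 1 <= p. Proof. exact: ltW. Qed.

Let alpha : R := 1 - n%:R / p.
Let cst0 : R := @morrey_cst R n p.

Let alpha_gt0 : 0 < alpha.
Proof. by rewrite subr_gt0 ltr_pdivrMr ?mul1r// (lt_trans _ p1). Qed.

Let cst0_ge0 : 0 <= cst0.
Proof.
rewrite divr_ge0// subr_ge0 powRN invf_le1 ?powR_gt0//.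
rewrite [leLHS](_ : _ = 1 `^ alpha); last by rewrite powR1.
by rewrite ge0_ler_powR ?nnegrE ?(ltW alpha_gt0)// ler1n.
Qed.

Lemma test_partial_Lnorm phi i : test_function Omega phi ->
  ('N[leb]_p%:E[EFin \o partial i phi] <= normG Omega p (cgrad phi))%E.
Proof.
move=> tphi; have [_ _ ig] := W1p_grad_test oO p1' Ooo tphi.
have -> : 'N[leb]_p%:E[EFin \o partial i phi]%E = normL Omega p%:E (partial i phi).
  rewrite /normL; congr (Lnorm _ _ _); apply/funext => x.
  rewrite /= patchE; case: ifPn => //; rewrite notin_setE => /(test_out tphi)[_ ->//].
apply: normL_le => //.
- by apply: measurable_funTS; exact: continuous_measurable_rV (smooth_continuous (smooth_partial i (test_smooth tphi))).
- exact: inLG_measurable_enorm ig.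
move=> x _; rewrite [leRHS]ger0_norm ?enorm_ge0//.
by have := coord_le_enorm (cgrad phi x) i; rewrite mxE.
Qed.

Lemma test_morrey phi (D : R) : test_function Omega phi ->
  (normG Omega p (cgrad phi) <= D%:E)%E ->
  (forall x y, `|phi x - phi y| <= 3 * (cst0 * D) * `|x - y| `^ alpha) /\
  (forall x r, 0 < r -> `|phi x - mean phi x (const_mx r)| <= cst0 * D * r `^ alpha).
Proof.
move=> tphi phiD; have [M [M0 M1]] := test_bounded tphi.
have sphi := test_smooth tphi.
have cd i : continuous (partial i phi) by exact: smooth_continuous (smooth_partial i sphi).
have dp i x : derivable phi x 'e_i by exact: smooth_derivable.
have N i : ('N[leb]_p%:E[EFin \o partial i phi] <= D%:E)%E.
  exact: le_trans (test_partial_Lnorm i tphi) phiD.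
split=> [x y|x r r0].
  exact: (morrey p1 np n0 (smooth_continuous sphi) dp cd M0 M1 N).
exact: (mean_cube_le p1 np n0 (smooth_continuous sphi) dp cd M0 M1 N).
Qed.

Lemma within_closure_continuous u x : {within closure Omega, continuous u} ->
  Omega x -> {for x, continuous u}.
Proof.
move=> /(continuous_subspaceW (@subset_closure _ Omega)).
by rewrite continuous_open_subspace// => cu Ox; apply: cu; rewrite inE.
Qed.

Lemma normG_near G phi (e : R) : inLG Omega p G -> test_function Omega phi ->
  (normG Omega p (fun x => (G x - cgrad phi x)%R) <= e%:E)%E ->
  (normG Omega p (cgrad phi) <= (fine (normG Omega p G) + e)%:E)%E.
Proof.
move=> iG tphi H; have [_ _ ig] := W1p_grad_test oO p1' Ooo tphi.
have iGg : inLG Omega p (fun x => G x - cgrad phi x).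
  have := inLGD oO p1' (-1) iG ig; congr inLG; apply/funext => x.
  by rewrite scaleN1r.
have := normGD oO p1' (-1) iG iGg.
rewrite (_ : (fun x => _) = cgrad phi); last first.
  by apply/funext => x; rewrite scaleN1r opprB addrC subrK.
move=> /le_trans; apply; rewrite normrN1 mul1e EFinD leeD// fineK//.
exact: normG_fin.
Qed.

(* The means of u and of a test function close to u in norm agree on a small cube,
   and Morrey's inequality controls their distance to the values at x. *)
Lemma approx_pointwise u G x (e : R) : W1p_grad Omega p u G ->
  {for x, continuous u} -> Omega x -> 0 < e ->
  exists2 d, 0 < d & forall phi, test_function Omega phi ->
    (normL Omega p%:E (fun x => (u x - phi x)%R) +
     normG Omega p (fun x => (G x - cgrad phi x)%R) < d%:E)%E ->
    `|u x - phi x| <= e.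
Proof.
move=> hu cu Ox e0; have [iu _ iG] := hu.
(* [D] bounds the gradient norm of every test function within distance 1, so the size of the cube
   can be fixed before the test function is known. *)
pose D := fine (normG Omega p G) + 1.
have D0 : 0 <= D by rewrite addr_ge0// fine_ge0// normG_ge0.
pose K := cst0 * D; have K0 : 0 <= K by rewrite mulr_ge0.
have e3 : 0 < e / 3 by rewrite divr_gt0.
have /nbhs_ballP[d1 /= d10 xd1] : nbhs x (Omega `&` [set z | `|u x - u z| < e / 3]).
  apply: filterI; first exact: open_nbhs_nbhs.
  by move/cvgrPdist_lt : cu => /(_ _ e3).
(* The first entry keeps the cube where [u] oscillates by less than e/3; the second makes the Morrey
   error K r^alpha at most e/3. Adding 1 to [K] avoids a zero denominator. *)
pose r := Num.min (d1 / 2) ((e / 3 / (K + 1)) `^ alpha^-1).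
have eK : 0 < e / 3 / (K + 1) by rewrite divr_gt0// ltr_wpDl.
have r0 : 0 < r by rewrite lt_min divr_gt0// powR_gt0.
have rd : r < d1 by rewrite gt_min; apply/orP; left; lra.
have Kr : K * r `^ alpha <= e / 3.
  have : r `^ alpha <= e / 3 / (K + 1).
    apply: (@le_trans _ _ (((e / 3 / (K + 1)) `^ alpha^-1) `^ alpha)).
      by rewrite ge0_ler_powR ?nnegrE ?powR_ge0 ?(ltW alpha_gt0) ?(ltW r0)// ge_min lexx orbT.
    by rewrite -powRrM mulVf ?gt_eqF// powRr1 ?(ltW eK).
  rewrite ler_pdivlMr ?ltr_wpDl// mulrDr mulr1 mulrC => h.
  by apply: le_trans h; rewrite lerDl powR_ge0.
pose Q := box x (const_mx r : 'rV[R]_n).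
have mQ : measurable Q by exact: measurable_box.
pose m := r ^+ n; have m0 : 0 < m by rewrite exprn_gt0.
have prodE : \prod_(i < n) (const_mx r : 'rV[R]_n) 0 i = m.
  by rewrite (eq_bigr (fun=> r)) ?prodr_const ?card_ord// => i _; rewrite mxE.
have Qm : leb Q = m%:E.
  by rewrite lebesgue_rV_box ?prodE// => i; rewrite mxE ltW.
have Qxd z : Q z -> Omega z /\ `|u x - u z| < e / 3.
  move=> zb; apply: xd1; split => // i j; rewrite ord1 /ball/=.
  have := zb j; rewrite mxE => /andP[h1 h2].
  by rewrite distrC ger0_norm ?subr_ge0//; lra.
(* [c] converts an L^p distance on [Omega] into a distance of means over [Q]. The entry 1 in [d]
   below keeps the gradients within the bound [D]. *)
pose c := m^-1 * m `^ (1 - p^-1).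
have c0 : 0 <= c by rewrite mulr_ge0 ?invr_ge0 ?powR_ge0 ?(ltW m0).
pose d := Num.min 1 (e / 3 / (c + 1)).
have d0 : 0 < d by rewrite lt_min ltr01 !divr_gt0// ltr_wpDl.
exists d => // phi tphi Hphi.
have [N1 N2] : (normL Omega p%:E (fun x => (u x - phi x)%R) <= d%:E)%E /\
    (normG Omega p (fun x => (G x - cgrad phi x)%R) <= 1%:E)%E.
  have g0 := normG_ge0 Omega p (fun x => G x - cgrad phi x).
  have l0 := normL_ge0 Omega p (fun x => u x - phi x).
  split; first by apply: le_trans (ltW Hphi); rewrite leeDl.
  have d1e : (d%:E <= 1%:E)%E by rewrite lee_fin ge_min lexx.
  by apply: le_trans (le_trans (ltW Hphi) d1e); rewrite leeDr.
have N3 := normG_near iG tphi N2; rewrite -/D in N3.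
have [_ /(_ x r r0) P1] := test_morrey tphi N3.
have mu : measurable_fun Omega u by have /(inLP mO)[] := iu.
have iuQ : leb.-integrable Q (EFin \o u).
  apply: (@integrable_bounded_rV _ _ _ _ (`|u x| + e / 3)) => //.
  - by rewrite Qm ltry.
  - by apply: measurable_funS mu => // z /Qxd[].
  - move=> z /Qxd[_ h]; rewrite (_ : u z = u x - (u x - u z)); last by ring.
    by apply: le_trans (ler_normB _ _) _; rewrite lerD2l ltW.
have [M [M0 _]] := test_bounded tphi.
have mphi : measurable_fun setT phi by exact: continuous_measurable_rV (smooth_continuous (test_smooth tphi)).
have ipQ : leb.-integrable Q (EFin \o phi).
  by apply: (@integrable_bounded_rV _ _ _ _ M) => //; [rewrite Qm ltry|exact: measurable_funTS].
have icQ (a : R) : leb.-integrable Q (EFin \o cst a).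
  by apply: (@integrable_bounded_rV _ _ _ _ `|a|) => //; rewrite Qm ltry.
have P2 : `|mean u x (const_mx r) - u x| <= e / 3.
  have uxE : u x = m^-1 * \int[leb]_(z in Q) cst (u x) z.
    by rewrite Rintegral_cst// (congr1 fine Qm) /= mulrCA mulVf ?mulr1// gt_eqF.
  rewrite [in X in _ - X]uxE /mean prodE -mulrBr -RintegralB// normrM gtr0_norm ?invr_gt0//.
  rewrite ler_pdivrMl//.
  have iub : leb.-integrable Q (EFin \o (fun z => u z - u x)).
    exact: (integrableB mQ iuQ (icQ (u x))).
  apply: le_trans (le_normr_Rintegral mQ iub) _.
  apply: (@le_trans _ _ (\int[leb]_(z in Q) cst (e / 3) z)).
    apply: le_Rintegral => //; first by move/integrable_norm : iub; exact.
    by move=> z /Qxd[_ /ltW]; rewrite distrC.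
  by rewrite Rintegral_cst// (congr1 fine Qm) /= mulrC.
have P3 : `|mean u x (const_mx r) - mean phi x (const_mx r)| <= e / 3.
  rewrite /mean prodE -mulrBr -RintegralB// normrM gtr0_norm ?invr_gt0//.
  have iup : leb.-integrable Q (EFin \o (fun z => u z - phi z)).
    exact: (integrableB mQ iuQ ipQ).
  pose f := (fun z => u z - phi z) \_ Omega.
  have mf : measurable_fun setT f.
    apply/(measurable_restrictT _ mO); apply: measurable_funB => //.
    exact: measurable_funTS.
  have := integral_le_Lnorm p1 mf mQ Qm (ltW m0) N1.
  rewrite (_ : (\int[leb]_(z in Q) `|f z|%:E = (\int[leb]_(z in Q) `|u z - phi z|)%:E)%E); last first.
    rewrite /Rintegral fineK; last first.
      by apply: integrable_fin_num => //; exact: integrable_norm.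
    apply: eq_integral => z; rewrite inE => /Qxd[Oz _].
    by rewrite /f patchE mem_set.
  rewrite lee_fin => h.
  apply: (@le_trans _ _ (c * d)).
    rewrite /c -mulrA ler_wpM2l ?invr_ge0 ?(ltW m0)//.
    exact: le_trans (le_normr_Rintegral mQ iup) h.
  apply: (@le_trans _ _ (c * (e / 3 / (c + 1)))).
    by rewrite ler_wpM2l// ge_min lexx orbT.
  rewrite mulrCA ler_piMr ?(ltW e3)// ler_pdivrMr ?ltr_wpDl// mul1r.
  by rewrite lerDl.
have P4 := le_trans P1 Kr.
move: P2 P3 P4; move: (mean u _ _) (mean phi _ _) => a b.
rewrite !ler_norml => /andP[h1 h2] /andP[h3 h4] /andP[h5 h6].
by apply/andP; split; lra.
Qed.

(** A single test function has to serve both points, so it is taken closer to [u] than either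
    threshold and than 1, the latter to bound its gradient. *)
Lemma approx_two u G x y (e : R) : W1p_grad Omega p u G -> test_approx Omega p u G ->
  {for x, continuous u} -> {for y, continuous u} ->
  Omega x -> Omega y -> 0 < e ->
  exists phi, [/\ test_function Omega phi,
    (normG Omega p (cgrad phi) <= (fine (normG Omega p G) + 1)%:E)%E,
    `|u x - phi x| <= e & `|u y - phi y| <= e].
Proof.
move=> hu au cx cy Ox Oy e0; have [_ _ iG] := hu.
have [d d0 dP] := approx_pointwise hu cx Ox e0.
have [d' d'0 d'P] := approx_pointwise hu cy Oy e0.
have m0 : 0 < Num.min 1 (Num.min d d') by rewrite !lt_min ltr01 d0.
have [phi tphi H] := au _ m0; exists phi.
have hd : (normL Omega p%:E (fun x => (u x - phi x)%R) +
     normG Omega p (fun x => (G x - cgrad phi x)%R) < 1%:E)%E.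
  by apply: lt_le_trans H _; rewrite lee_fin ge_min lexx.
split => //.
- apply: normG_near => //; apply: le_trans (ltW hd).
  by rewrite leeDr// normL_ge0.
- by apply: dP => //; apply: lt_le_trans H _; rewrite lee_fin !ge_min lexx !orbT.
- by apply: d'P => //; apply: lt_le_trans H _; rewrite lee_fin !ge_min lexx !orbT.
Qed.

(** Morrey's constant with the norm of [G] increased by 1: the inequality is applied to test
    functions within distance 1, not to the function itself. *)
Definition hoelder_cst G : R := 3 * (cst0 * (fine (normG Omega p G) + 1)).

Lemma hoelder_cst_ge0 G : 0 <= hoelder_cst G.
Proof.
rewrite mulr_ge0// mulr_ge0 ?cst0_ge0// addr_ge0//.
by apply: fine_ge0; exact: normG_ge0.
Qed.

Lemma W01p_hoelder u G x y : W1p_grad Omega p u G -> test_approx Omega p u G ->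
  {within closure Omega, continuous u} -> Omega x -> Omega y ->
  `|u x - u y| <= hoelder_cst G * `|x - y| `^ alpha.
Proof.
move=> hu au cu Ox Oy; apply/ler_addgt0Pr => e e0.
have e2 : 0 < e / 2 by rewrite divr_gt0.
have [phi [tphi Nphi h1 h2]] := approx_two hu au (within_closure_continuous cu Ox)
  (within_closure_continuous cu Oy) Ox Oy e2.
have [/(_ x y) h3 _] := test_morrey tphi Nphi.
move: h1 h2 h3; rewrite -/(hoelder_cst G); move: (hoelder_cst G * _) => c.
rewrite !ler_norml => /andP[h1 h2] /andP[h3 h4] /andP[h5 h6].
by apply/andP; split; lra.
Qed.

(** Test functions vanish outside [Omega]. Morrey's inequality between x and a point of norm
    [rho + 1] therefore bounds the value at x itself, the two points being at most 2 rho + 1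
    apart. *)
Lemma W01p_sup u G x (rho : R) : W1p_grad Omega p u G -> test_approx Omega p u G ->
  {within closure Omega, continuous u} -> (forall y, Omega y -> `|y| <= rho) ->
  Omega x -> `|u x| <= hoelder_cst G * (2 * rho + 1) `^ alpha.
Proof.
move=> hu au cu Orho Ox; apply/ler_addgt0Pr => e e0.
have cx := within_closure_continuous cu Ox.
have [phi [tphi Nphi h1 _]] := approx_two hu au cx cx Ox Ox e0.
have rho0 : 0 <= rho by exact: le_trans (Orho _ Ox).
pose y : 'rV[R]_n := const_mx (rho + 1).
have ny : `|y| = rho + 1.
  apply/eqP; rewrite eq_le; apply/andP; split.
    by apply/rV_norm_leP => [|i]; rewrite ?mxE ?ger0_norm ?addr_ge0.
  by have := rV_coord_le y (Ordinal n0); rewrite mxE ger0_norm ?addr_ge0.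
have Oy : ~ Omega y by move=> /Orho; rewrite ny; lra.
have [phiy _] := test_out tphi Oy.
have [/(_ x y) h3 _] := test_morrey tphi Nphi.
rewrite phiy subr0 -/(hoelder_cst G) in h3.
have h4 : `|x - y| `^ alpha <= (2 * rho + 1) `^ alpha.
  rewrite ge0_ler_powR ?nnegrE ?(ltW alpha_gt0) ?addr_ge0 ?mulr_ge0//.
  by have := ler_normB x y; have := Orho _ Ox; rewrite ny; lra.
have := ler_wpM2l (hoelder_cst_ge0 G) h4 => /(le_trans h3).
have := ler_normD (u x - phi x) (phi x); rewrite subrK.
by move: h1; lra.
Qed.

End sobolev_embedding.

(** * Clarkson's inequality *)

Section powR_inequalities.
Context {R : realType}.
Implicit Types (x y r p : R).

(** Write x^r = x x^(r-1) <= x (x + y)^(r-1), do the same for y, and add. *)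
Lemma powR_superadditive x y r : 1 <= r -> 0 <= x -> 0 <= y ->
  x `^ r + y `^ r <= (x + y) `^ r.
Proof.
move=> r1 x0 y0; have r0 : 0 < r by exact: lt_le_trans r1.
have r10 : 0 <= r - 1 by rewrite subr_ge0.
rewrite -(mulr_powRB1 x0 r0) -(mulr_powRB1 y0 r0).
rewrite -(mulr_powRB1 (addr_ge0 x0 y0) r0) mulrDl; apply: lerD; apply: ler_wpM2l => //.
  by apply: ge0_ler_powR; rewrite ?nnegrE ?(addr_ge0 x0 y0) ?lerDl.
by apply: ge0_ler_powR; rewrite ?nnegrE ?(addr_ge0 x0 y0) ?lerDr.
Qed.

Lemma powR_midpoint x y r : 1 <= r -> 0 <= x -> 0 <= y ->
  ((x + y) / 2) `^ r <= (x `^ r + y `^ r) / 2.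
Proof.
move=> r1 x0 y0; have r0 : 0 < r by exact: lt_le_trans r1.
have h0 : 0 <= 2^-1 :> R by lra.
have h1 : 2^-1 <= 1 :> R by lra.
have := @convex_powR R r r1 (Itv01 h0 h1) x y.
rewrite !inE /= !in_itv /= !andbT => /(_ x0 y0).
move=> h; rewrite [X in X `^ _ <= _]convRE convRE /= /unstable.onem in h.
move: h; rewrite (_ : 1 - 2^-1 = 2^-1 :> R); last by lra.
by rewrite -!mulrDr !(mulrC 2^-1).
Qed.

End powR_inequalities.

(** * The energy of a gradient field *)

Section energy.
Context {R : realType} {n : nat} (Omega : set 'rV[R]_n) (p : R).
Local Notation leb := (@lebesgue_rV R n).
Hypothesis oO : open Omega.
Hypothesis p2 : 2 <= p.
Implicit Types (u v : 'rV[R]_n -> R) (G H : 'rV[R]_n -> 'rV[R]_n).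

Let mO : measurable Omega. Proof. exact: open_measurable_rV. Qed.
Let p1 : 1 <= p. Proof. by rewrite (le_trans _ p2)// ler1n. Qed.
Definition energyG G : R := fine (normG Omega p G) `^ p.

Lemma energyG_ge0 G : 0 <= energyG G. Proof. exact: powR_ge0. Qed.

Lemma energyE u G : W1p_grad Omega p u G -> energy Omega p u = (energyG G)%:E.
Proof.
move=> hu; rewrite /energy (norm_gradE oO p1 hu) /energyG -poweR_EFin fineK//.
by have [_ _ /(normG_fin oO p1)] := hu.
Qed.

Lemma energyG_integral G : inLG Omega p G ->
  ((energyG G)%:E = \int[leb]_(x in Omega) (enorm (G x) `^ p)%:E)%E.
Proof.
move=> iG; rewrite /energyG -poweR_EFin fineK ?(normG_fin oO p1)//.
rewrite (normL_powR p1 (inLG_measurable_enorm oO iG)).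
by apply: eq_integral => x _; rewrite ger0_norm ?enorm_ge0.
Qed.

Lemma energyG_integrable G : inLG Omega p G ->
  leb.-integrable Omega (EFin \o (fun x => enorm (G x) `^ p)).
Proof.
move=> iG; apply/integrableP; split.
  apply/measurable_EFinP; apply: (@measurableT_comp _ _ _ _ _ _ (@powR R ^~ p)).
    exact: measurable_powR.
  exact: (inLG_measurable_enorm oO iG).
rewrite (_ : (\int[leb]_(x in Omega) _)%E = (energyG G)%:E) ?ltry//.
rewrite energyG_integral//; apply: eq_integral => x _.
by rewrite /= ger0_norm ?powR_ge0.
Qed.

Lemma energyG_Rintegral G : inLG Omega p G ->
  energyG G = \int[leb]_(x in Omega) (enorm (G x) `^ p).
Proof. by move=> iG; rewrite /Rintegral -energyG_integral. Qed.

(** With |a|^p = (|a|^2)^(p/2), superadditivity of t^(p/2) joins the two terms on the left, the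
    parallelogram law turns the sum of squares into the mean of |a|^2 and |b|^2, and convexity of
    t^(p/2) concludes. Both properties of t^(p/2) use p >= 2. *)
Let clarkson_pointwise (a b : 'rV[R]_n) :
  enorm (2^-1 *: (a + b)) `^ p + enorm (2^-1 *: (a - b)) `^ p <=
  (enorm a `^ p + enorm b `^ p) / 2.
Proof.
have pE x : 0 <= x -> x `^ p = (x ^+ 2) `^ (p / 2).
  by move=> x0; rewrite -powR_mulrn// -powRrM mulrC divfK.
have p21 : 1 <= p / 2 by rewrite ler_pdivlMr// mul1r.
rewrite !pE ?enorm_ge0//.
apply: le_trans (powR_superadditive p21 (sqr_ge0 _) (sqr_ge0 _)) _.
apply: le_trans (powR_midpoint p21 (sqr_ge0 _) (sqr_ge0 _)).
rewrite !enormZ !exprMn real_normK ?num_real// -mulrDr enorm_parallelogram.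
by rewrite le_eqVlt; apply/orP; left; apply/eqP; congr (_ `^ _); field.
Qed.

Lemma clarkson G H : inLG Omega p G -> inLG Omega p H ->
  energyG (fun x => 2^-1 *: (G x + H x)) + energyG (fun x => 2^-1 *: (G x - H x)) <=
  (energyG G + energyG H) / 2.
Proof.
move=> iG iH.
have i1 : inLG Omega p (fun x => 2^-1 *: (G x + H x)).
  have := inLGZ oO p1 2^-1 (inLGD oO p1 1 iG iH); congr inLG.
  by apply/funext => x; rewrite scale1r.
have i2 : inLG Omega p (fun x => 2^-1 *: (G x - H x)).
  have := inLGZ oO p1 2^-1 (inLGD oO p1 (-1) iG iH); congr inLG.
  by apply/funext => x; rewrite scaleN1r.
have e1 := energyG_integrable i1; have e2 := energyG_integrable i2.
have eG := energyG_integrable iG; have eH := energyG_integrable iH.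
pose s (x y : R) := x + y.
have E1 := etrans (RintegralD mO e1 e2)
  (esym (congr2 s (energyG_Rintegral i1) (energyG_Rintegral i2))).
have E2 := etrans (RintegralD mO eG eH)
  (esym (congr2 s (energyG_Rintegral iG) (energyG_Rintegral iH))).
rewrite {}/s in E1 E2.
have eGH : leb.-integrable Omega (EFin \o (fun x => enorm (G x) `^ p + enorm (H x) `^ p)).
  exact: (integrableD mO eG eH).
have E3 := RintegralZr 2^-1 mO eGH.
rewrite -E1 -E2 -E3.
apply: (le_Rintegral mO (integrableD mO e1 e2) (integrableZr mO 2^-1 eGH)) => x _.
exact: clarkson_pointwise.
Qed.

Lemma energyGZ G c : inLG Omega p G -> energyG (fun x => c *: G x) = `|c| `^ p * energyG G.
Proof.
move=> iG; have E := RintegralZl (`|c| `^ p) mO (energyG_integrable iG).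
rewrite (energyG_Rintegral (inLGZ oO p1 c iG)) (energyG_Rintegral iG) -E.
by apply: eq_Rintegral => x _; rewrite enormZ powRM ?enorm_ge0.
Qed.

End energy.

(** * Comparison of L^q norms on a set of finite measure *)

Section norm_comparison.
Context {R : realType} {n : nat} (Omega : set 'rV[R]_n).
Local Notation leb := (@lebesgue_rV R n).
Hypothesis mO : measurable Omega.
Variable m : R.
Hypothesis Om : leb Omega = m%:E.
Implicit Types (u : 'rV[R]_n -> R) (q s : R).

Let m0 : 0 <= m. Proof. by rewrite -lee_fin -Om. Qed.

Lemma normL_bounded_fin u q (M : R) : 1 <= q -> measurable_fun Omega u ->
  (forall x, Omega x -> `|u x| <= M) -> normL Omega q%:E u \is a fin_num.
Proof.
move=> q1 mu uM; apply: (normL_fin mO); apply: (inL_bounded mO q1 (M := M)) => //.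
by rewrite Om ltry.
Qed.

Lemma normL_le_bound u q (M : R) : 1 <= q -> 0 <= M -> measurable_fun Omega u ->
  (forall x, Omega x -> `|u x| <= M) ->
  (normL Omega q%:E u <= (M * m `^ q^-1)%:E)%E.
Proof.
move=> q1 M0 mu uM; have q0 : 0 < q by exact: lt_le_trans q1.
have mM : measurable_fun Omega (cst M) by exact: measurable_cst.
apply: le_trans (normL_le mO q1 mu mM _) _.
  by move=> x /uM uxM /=; rewrite (ger0_norm M0).
rewrite (normL_integral q1 mM) /= ger0_norm//.
have -> : (\int[leb]_(x in Omega) (M `^ q)%:E = (M `^ q * m)%:E)%E.
  by rewrite integral_cst// EFinM; congr (_ * _)%E; exact: Om.
by rewrite poweR_EFin powRM ?powR_ge0// -powRrM divff ?gt_eqF// powRr1.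
Qed.

Lemma normL_ge_bound u q s (U : set 'rV[R]_n) (d : R) : 1 <= q -> 0 <= s ->
  measurable_fun Omega u -> measurable U -> U `<=` Omega -> leb U = d%:E ->
  (forall x, U x -> s <= `|u x|) -> ((s * d `^ q^-1)%:E <= normL Omega q%:E u)%E.
Proof.
move=> q1 s0 mu mU UO Ud us; have q0 : 0 < q by exact: lt_le_trans q1.
have d0 : 0 <= d by rewrite -lee_fin -Ud.
have mI : measurable_fun Omega (fun x => s * \1_U x).
  by apply: measurable_funM => //; exact: measurable_indic.
apply: le_trans (normL_le mO q1 mI mu _); last first.
  move=> x _; rewrite indicE; case: (boolP (x \in U)) => [|_].
    by rewrite inE mulr1 ger0_norm// => /us.
  by rewrite mulr0 normr0.
rewrite (normL_integral q1 mI).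
rewrite (_ : (\int[leb]_(x in Omega) _)%E = (s `^ q * d)%:E).
  by rewrite poweR_EFin powRM ?powR_ge0// -powRrM divff ?gt_eqF// powRr1.
transitivity (\int[leb]_(x in U) (s `^ q)%:E)%E; last first.
  by rewrite integral_cst// EFinM; congr (_ * _)%E; exact: Ud.
rewrite [LHS]integral_mkcond [RHS]integral_mkcond; apply: eq_integral => x _; rewrite !patchE indicE.
case: (boolP (x \in U)) => xU; last first.
  by rewrite mulr0 normr0 powR0 ?gt_eqF// if_same.
by rewrite mem_set ?mulr1 ?ger0_norm//; apply: UO; rewrite inE in xU.
Qed.

(** Hoelder's inequality for |u|^q with exponent s/q, followed by a q-th root. *)
Lemma normL_le_normL u q s : 1 <= q -> q <= s -> measurable_fun Omega u ->
  normL Omega s%:E u \is a fin_num ->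
  (normL Omega q%:E u <= (fine (normL Omega s%:E u) * m `^ (q^-1 - s^-1))%:E)%E.
Proof.
move=> q1 qs mu us; have q0 : 0 < q by exact: lt_le_trans q1.
have s1 : 1 <= s by exact: le_trans qs.
have s0 : 0 < s by exact: lt_le_trans s1.
(* When q = s the exponent s/q is 1, which [integral_le_Lnorm] excludes. *)
move: qs; rewrite le_eqVlt => /predU1P[qs|qs].
  by subst s; rewrite subrr powRr0 mulr1 fineK.
pose a := fine (normL Omega s%:E u).
have a0 : 0 <= a by rewrite fine_ge0// normL_ge0.
pose f := fun x => `|u x| `^ q.
have mf : measurable_fun Omega f.
  apply: (@measurableT_comp _ _ _ _ _ _ (@powR R ^~ q)); first exact: measurable_powR.
  exact: measurableT_comp.
pose r := s / q; have r1 : 1 < r by rewrite ltr_pdivlMr// mul1r.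
have r0 : 0 < r by rewrite divr_gt0.
have Nf : normL Omega r%:E f = (a `^ q)%:E.
  rewrite (normL_integral (ltW r1) mf).
  rewrite (_ : (\int[leb]_(x in Omega) _)%E = (a `^ s)%:E).
    by rewrite poweR_EFin -powRrM /r invf_div mulrCA divff ?gt_eqF// mulr1.
  rewrite -poweR_EFin /a fineK// (normL_powR s1 mu); apply: eq_integral => x _.
  by rewrite ger0_norm ?powR_ge0// -powRrM /r mulrCA divff ?gt_eqF// mulr1.
have mfO : measurable_fun setT (f \_ Omega) by exact/(measurable_restrictT _ mO).
have Nf' : ('N[leb]_r%:E[EFin \o (f \_ Omega)] <= (a `^ q)%:E)%E by rewrite -Nf lexx.
have := integral_le_Lnorm r1 mfO mO Om m0 Nf'.
rewrite (_ : (\int[leb]_(x in Omega) _ = \int[leb]_(x in Omega) (`|u x| `^ q)%:E)%E).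
  move=> h; rewrite (normL_integral q1 mu).
  apply: le_trans (gt0_ler_poweR _ _ _ h) _.
  - by rewrite invr_ge0 ltW.
  - rewrite in_itv /= leey andbT; apply: integral_ge0 => x _.
    by rewrite lee_fin powR_ge0.
  - by rewrite in_itv /= leey andbT lee_fin mulr_ge0 ?powR_ge0.
  rewrite poweR_EFin lee_fin powRM ?powR_ge0// -!powRrM mulrC.
  rewrite divff ?gt_eqF// powRr1// le_eqVlt; apply/orP; left; apply/eqP.
  by congr (_ * _ `^ _); rewrite /r; field; rewrite !gt_eqF.
apply: eq_integral => x xO; rewrite patchE xO /f ger0_norm ?powR_ge0//.
Qed.

End norm_comparison.

(** * The limit of lambda_q *)

Section powR_limit.
Context {R : realType}.

Lemma powR_pinfty_cvg (a c : R) : 0 < a -> a `^ (c / q) @[q --> +oo] --> (1 : R).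
Proof.
move=> a0; apply/cvgrPdist_lt => e e0.
have /cvgrPdist_lt/(_ e e0)/nbhs_ballP[d /= d0 dP] := @continuous_expR R 0.
rewrite expR0 in dP.
have cv : 0 <= `|c * ln a| / d by rewrite divr_ge0// ltW.
near=> q.
have q0 : `|c * ln a| / d < q by near: q; apply: nbhs_pinfty_gt; exact: num_real.
have qp : 0 < q by exact: le_lt_trans q0.
rewrite /powR gt_eqF//; apply: dP; rewrite /ball /= sub0r normrN.
rewrite mulrAC normf_div (gtr0_norm qp) ltr_pdivrMr// [ltRHS]mulrC.
by rewrite -ltr_pdivrMr.
Unshelve. all: by end_near. Qed.

End powR_limit.

(** * Monotonicity and limit of lambda_q *)

Section extremals.
Context {R : realType} {n : nat} (Omega : set 'rV[R]_n) (p m rho : R).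
Local Notation leb := (@lebesgue_rV R n).
Hypothesis oO : open Omega.
Hypothesis Om : leb Omega = m%:E.
Hypothesis m0 : 0 < m.
Hypothesis Orho : forall x, Omega x -> `|x| <= rho.
Hypothesis n0 : (0 < n)%N.
Hypotheses (p2 : 2 <= p) (np : n%:R < p).
Variable w : R -> 'rV[R]_n -> R.
Hypothesis hw : forall q : R, 1 <= q -> positive_extremal Omega p q (w q).
Implicit Types (u v : 'rV[R]_n -> R) (G H : 'rV[R]_n -> 'rV[R]_n) (q s : R).

Let mO : measurable Omega. Proof. exact: open_measurable_rV. Qed.
Let p1 : 1 <= p. Proof. by rewrite (le_trans _ p2)// ler1n. Qed.
Let p1s : 1 < p. Proof. by rewrite (lt_le_trans _ p2)// ltr1n. Qed.
Let p0 : 0 < p. Proof. exact: lt_le_trans p1. Qed.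
Let Ooo : (leb Omega < +oo)%E. Proof. by rewrite Om ltry. Qed.

Definition CW01p_grad u G := [/\ W1p_grad Omega p u G, test_approx Omega p u G &
  {within closure Omega, continuous u}].

Lemma CW01pP u : CW01p Omega p u <-> exists G, CW01p_grad u G.
Proof.
split=> [[/(W01pP oO p1 Ooo)[G h a] c]|[G [h a c]]]; first by exists G.
by split => //; apply/(W01pP oO p1 Ooo); exists G.
Qed.

Lemma CW01p_grad_bounded u G : CW01p_grad u G -> exists2 M, 0 <= M & forall x, Omega x -> `|u x| <= M.
Proof.
move=> [h a c].
exists (hoelder_cst Omega p G * (2 * rho + 1) `^ (1 - n%:R / p)).
  by rewrite mulr_ge0 ?powR_ge0// hoelder_cst_ge0.
by move=> x Ox; exact: (W01p_sup oO Ooo n0 p1s np h a c Orho Ox).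
Qed.

Lemma CW01p_grad_measurable u G : CW01p_grad u G -> measurable_fun Omega u.
Proof. by move=> [[/(inLP mO)[]]]. Qed.

Lemma CW01p_grad_fin u G q : 1 <= q -> CW01p_grad u G -> normL Omega q%:E u \is a fin_num.
Proof.
move=> q1 /[dup] /CW01p_grad_bounded[M M0 uM] /CW01p_grad_measurable mu.
exact: (normL_bounded_fin mO Om q1 mu uM).
Qed.

Lemma CW01p_gradD u v G H c : CW01p_grad u G -> CW01p_grad v H ->
  CW01p_grad (fun x => u x + c * v x) (fun x => G x + c *: H x).
Proof.
move=> [hu au cu] [hv av cv]; split; [exact: W1p_gradD|exact: test_approxD|].
move=> x; apply: cvgD; first exact: cu.
by apply: cvgM; [exact: cvg_cst|exact: cv].
Qed.

Lemma CW01p_gradZ u G c : CW01p_grad u G -> CW01p_grad (fun x => c * u x) (fun x => c *: G x).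
Proof.
move=> h; have := CW01p_gradD (c - 1) h h; congr CW01p_grad; apply/funext => x; first by ring.
by rewrite scalerBl scale1r addrC subrK.
Qed.

Let hH q : 1 <= q -> exists G, CW01p_grad (w q) G.
Proof. by move=> /hw[/CW01pP]. Qed.

(** A fixed field that is at once a weak gradient and a limit of gradients of the approximating test
    functions; the default 0 is never met for q >= 1. *)
Definition wgrad q : 'rV[R]_n -> 'rV[R]_n := xget (fun=> 0) (CW01p_grad (w q)).

Lemma CW01p_wgrad q : 1 <= q -> CW01p_grad (w q) (wgrad q).
Proof. by move=> /hH; exact: xgetPex. Qed.

Definition rlambda q : R := energyG Omega p (wgrad q).

Lemma rlambda_ge0 q : 0 <= rlambda q. Proof. exact: energyG_ge0. Qed.

Lemma lambdaE q : 1 <= q -> lambda Omega p q = (rlambda q)%:E.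
Proof.
move=> q1; have [_ _ _ <-] := hw q1; have [h _ _] := CW01p_wgrad q1.
by rewrite (energyE oO p2 h).
Qed.

(** Divided by its q-norm, [v] competes in the infimum defining [lambda], and the energy is
    homogeneous of degree [p]. *)
Lemma rlambda_le v H q : 1 <= q -> CW01p_grad v H -> 0 < fine (normL Omega q%:E v) ->
  rlambda q * fine (normL Omega q%:E v) `^ p <= energyG Omega p H.
Proof.
move=> q1 hv; set a := fine _ => a0.
have mv := CW01p_grad_measurable hv; have af := CW01p_grad_fin q1 hv.
have [h1 h2 _] := CW01p_gradZ a^-1 hv; have [[_ _ iH] _ _] := hv.
have : (lambda Omega p q <= energy Omega p (fun x => a^-1 * v x)%R)%E.
  apply: ereal_inf_lbound; exists (fun x => a^-1 * v x) => //; split.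
    by apply/(W01pP oO p1 Ooo); exists (fun x => a^-1 *: H x).
  rewrite (normLZ mO q1 a^-1 mv) -(fineK af) -/a gtr0_norm ?invr_gt0//.
  by rewrite -EFinM mulVf// gt_eqF.
rewrite lambdaE// (energyE oO p2 h1) lee_fin => h.
have E := energyGZ oO p2 a^-1 iH; rewrite E in h.
have -> : energyG Omega p H = `|a^-1| `^ p * energyG Omega p H * a `^ p.
  rewrite mulrAC gtr0_norm ?invr_gt0// -powRM ?invr_ge0 ?(ltW a0)//.
  by rewrite mulVf ?gt_eqF// powR1 mul1r.
by rewrite ler_wpM2r ?powR_ge0.
Qed.

(** [w q] is used as a competitor for the exponent [s]: its q-norm is 1, so its s-norm is at least
    m^(1/s - 1/q), and raising this to the power [p] produces the two factors. *)
Lemma rlambda_mono q s : 1 <= q -> q <= s -> rlambda s * m `^ (p / s) <= rlambda q * m `^ (p / q).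
Proof.
move=> q1 qs; have s1 : 1 <= s by exact: le_trans qs.
have h := CW01p_wgrad q1; have sf := CW01p_grad_fin s1 h; have mv := CW01p_grad_measurable h.
have := normL_le_normL mO Om q1 qs mv sf; have [_ _ -> _] := hw q1.
set a := fine _; rewrite lee_fin => h1.
have am0 : 0 < a * m `^ (q^-1 - s^-1) by exact: lt_le_trans h1.
have a0 : 0 < a by rewrite pmulr_lgt0 ?powR_gt0// in am0.
have h2 := rlambda_le s1 h a0; rewrite -/a -/(rlambda q) in h2.
move: (rlambda s) (rlambda q) (rlambda_ge0 s) a a0 h1 am0 h2 => ls lq ls0 a a0 h1 am0 h2.
have -> : m `^ (p / q) = (m `^ (q^-1 - s^-1)) `^ p * m `^ (p / s).
  rewrite -powRrM -powRD; last by rewrite (gt_eqF m0) implybT.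
  by congr (_ `^ _); ring.
rewrite mulrA; apply: ler_wpM2r; first exact: powR_ge0.
apply: (@le_trans _ _ (ls * a `^ p * (m `^ (q^-1 - s^-1)) `^ p)); last first.
  by apply: ler_wpM2r => //; exact: powR_ge0.
rewrite -mulrA -powRM ?powR_ge0 ?(ltW a0)//; apply: ler_peMr => //.
rewrite [leLHS](_ : _ = 1 `^ p); last by rewrite powR1.
by apply: ge0_ler_powR; rewrite ?nnegrE ?(ltW p0) ?(ltW am0).
Qed.

(** The infimum of a nonincreasing quantity, hence its limit. As m^(p/q) tends to 1, it is the limit
    of [rlambda] as well. *)
Definition rLambda : R := inf [set rlambda q * m `^ (p / q) | q in [set q : R | 1 <= q]].

Lemma rlambda_cvg : rlambda q @[q --> +oo] --> rLambda.
Proof.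
pose S := [set rlambda q * m `^ (p / q) | q in [set q : R | 1 <= q]].
have S0 : S !=set0 by exists (rlambda 1 * m `^ (p / 1)), 1 => //=.
have lS : has_lbound S.
  by exists 0 => _ [q _ <-]; rewrite mulr_ge0 ?rlambda_ge0 ?powR_ge0.
have cg : rlambda q * m `^ (p / q) @[q --> +oo] --> rLambda.
  apply/cvgrPdist_lt => e e0.
  have [_ [q0 /= q01 <-] q0e] := inf_adherent e0 (conj S0 lS).
  near=> q.
  have qq : q0 <= q by near: q; apply: nbhs_pinfty_ge; exact: num_real.
  have q1 : 1 <= q by exact: le_trans qq.
  have h1 := rlambda_mono q01 qq.
  have h2 : rLambda <= rlambda q * m `^ (p / q) by apply: ge_inf => //; exists q.
  by rewrite distrC ger0_norm ?subr_ge0// ltrBlDl (le_lt_trans h1).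
have cm := powR_pinfty_cvg (- p) m0.
have := cvgM cg cm; rewrite mulr1.
have -> : (fun q => rlambda q * m `^ (p / q)) \* (fun q => m `^ (- p / q)) = rlambda.
  apply/funext => q /=; rewrite -mulrA -powRD; last by rewrite (gt_eqF m0) implybT.
  by rewrite mulNr subrr powRr0 mulr1.
exact.
Unshelve. all: by end_near. Qed.

Lemma LambdaE : Lambda Omega p = rLambda%:E.
Proof.
apply/cvg_lim => //; apply: cvg_trans (_ : _ `=>` ((rlambda q)%:E @[q --> +oo])) _.
  apply: near_eq_cvg; apply: filterS (nbhs_pinfty_ge (num_real (1 : R))) => q q1.
  by rewrite lambdaE.
by apply: cvg_EFin; [exact: nearW|exact: rlambda_cvg].
Qed.

Lemma open_superlevel u s : {within closure Omega, continuous u} ->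
  open [set x | Omega x /\ s < u x].
Proof.
move=> cu; rewrite openE => x [Ox sx] /=.
have cx := within_closure_continuous oO cu Ox.
apply: filterI; first exact: open_nbhs_nbhs.
by move/cvgr_gt : cx; apply.
Qed.

Lemma superlevel_lebesgue u s x : {within closure Omega, continuous u} ->
  Omega x -> s < u x -> exists2 d, 0 < d & leb [set x | Omega x /\ s < u x] = d%:E.
Proof.
move=> cu Ox sx.
pose U := [set x | Omega x /\ s < u x].
have oU : open U by exact: open_superlevel.
have Upos : (0 < leb U)%E by exact: lebesgue_rV_open_gt0 oU (conj Ox sx).
have Ufin : leb U \is a fin_num.
  rewrite ge0_fin_numE//; apply: le_lt_trans Ooo.
  apply: le_measure; rewrite ?inE//; first exact: open_measurable_rV.
  by move=> y [].
exists (fine (leb U)); last by rewrite fineK.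
by rewrite fine_gt0// Upos ltey_eq Ufin.
Qed.

Lemma normL_superlevel u G s x : CW01p_grad u G -> Omega x -> 0 <= s -> s < u x ->
  exists2 d, 0 < d & forall q, 1 <= q ->
    ((s * d `^ q^-1)%:E <= normL Omega q%:E u)%E.
Proof.
move=> h Ox s0 sx; have [_ _ cu] := h.
have [d d0 dE] := superlevel_lebesgue cu Ox sx; exists d => // q q1.
apply: (normL_ge_bound mO q1 s0 (CW01p_grad_measurable h) _ _ dE).
- by apply: open_measurable_rV; exact: open_superlevel.
- by move=> y [].
- by move=> y [_ /ltW sy]; rewrite (le_trans sy)// ler_norm.
Qed.

Lemma rLambda_le_energy v H x s : CW01p_grad v H -> Omega x -> 0 < s -> s < v x ->
  rLambda * s `^ p <= energyG Omega p H.
Proof.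
move=> h Ox s0 sx; have [d d0 dP] := normL_superlevel h Ox (ltW s0) sx.
have cm : rlambda q * s `^ p * d `^ (p / q) @[q --> +oo] --> rLambda * s `^ p.
  have := cvgM (cvgM rlambda_cvg (cvg_cst (s `^ p))) (powR_pinfty_cvg p d0).
  by rewrite mulr1; apply.
apply: (ler_cvg_to cm (cvg_cst (energyG Omega p H))).
near=> q; have q1 : 1 <= q by near: q; apply: nbhs_pinfty_ge; exact: num_real.
have := dP q q1; have af := CW01p_grad_fin q1 h; rewrite -(fineK af) lee_fin => h1.
have sd : 0 < s * d `^ q^-1 by rewrite mulr_gt0// powR_gt0.
have a0 := lt_le_trans sd h1.
apply: le_trans (rlambda_le q1 h a0) => /=; rewrite -mulrA ler_wpM2l ?rlambda_ge0//.
rewrite mulrC [p / q]mulrC powRrM -powRM ?powR_ge0 ?(ltW s0)//.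
by apply: ge0_ler_powR; rewrite ?nnegrE ?(ltW p0) ?(ltW a0)// mulrC ?(ltW sd).
Unshelve. all: by end_near. Qed.

End extremals.

(** * Convergence of the extremals *)

Section equicontinuous_cluster.
Context {R : realType} {n : nat} (K : set 'rV[R]_n).
Hypothesis cK : compact K.
Variables (f : R -> 'rV[R]_n -> R) (Q0 M : R).
Hypothesis fM : forall q x, Q0 <= q -> K x -> `|f q x| <= M.
Hypothesis f_equi : forall e : R, 0 < e -> exists2 d, 0 < d &
  forall q x y, Q0 <= q -> K x -> K y -> `|x - y| < d -> `|f q x - f q y| <= e.

(* The pointwise cluster point given by Tychonoff's theorem inherits the
   modulus of continuity, so closeness on a finite net is uniform closeness. *)
Lemma equicontinuous_cluster : exists g : 'rV[R]_n -> R,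
  forall e Q : R, 0 < e -> exists2 q, Q <= q & forall x, K x -> `|f q x - g x| <= e.
Proof.
(* Cut off outside [K], the functions with large [q] lie in a product of segments, compact for
   pointwise convergence. The segments use |M| since [M] may be negative when [K] is empty. *)
pose F : set_system (prod_topology (fun _ : 'rV[R]_n => R)) :=
  (fun q => f q \_ K) @ +oo.
have FF : ProperFilter F by exact: fmap_proper_filter.
pose S : set (prod_topology (fun _ : 'rV[R]_n => R)) :=
  [set g | forall x, `[- `|M|, `|M|]%classic (g x)].
have cS : compact S.
  by apply: (@tychonoff 'rV[R]_n (fun=> R) (fun=> `[- `|M|, `|M|]%classic)) => x;
     exact: segment_compact.
have FS : F S.
  rewrite /F /=; apply: filterS (nbhs_pinfty_ge (num_real Q0)) => q qQ x /=.
  rewrite in_itv /= -ler_norml patchE; case: (boolP (x \in K)) => [/set_mem Kx|_].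
    by rewrite (le_trans (fM qQ Kx))// ler_norm.
  by rewrite normr0.
have [g [_ gF]] := cS F FF FS; exists g.
(* Neighbourhoods for pointwise convergence see finitely many points only, but they are met by [f q]
   for arbitrarily large [q]. *)
have near_pts (s : {fset 'rV[R]_n}) (e Q : R) : 0 < e ->
    exists q, [/\ Q <= q, Q0 <= q & forall x, x \in s -> K x -> `|f q x - g x| < e].
  move=> e0.
  have Ns : nbhs g (\bigcap_(x in [set` s]) [set h : prod_topology (fun _ : 'rV[R]_n => R) | `|g x - h x| < e]).
    apply: filter_bigI => x _.
    have H : nbhs (g x : R) [set t : R | `|g x - t| < e].
      by apply/nbhs_ballP; exists e => // t; rewrite -ball_normE.
    exact: (@proj_continuous _ (fun _ : 'rV[R]_n => R) x g _ H).
  have FQ : F [set h | exists2 q, Num.max Q Q0 <= q & h = f q \_ K].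
    have H : \forall q \near +oo, Num.max Q Q0 <= q.
      by apply: nbhs_pinfty_ge; exact: num_real.
    by apply: filterS H => q qQ; exists q.
  have [h [[q qQ ->] hs]] := gF _ _ FQ Ns.
  move: qQ; rewrite ge_max => /andP[Qq Q0q]; exists q; split => // x xs Kx.
  by have := hs x xs; rewrite /= patchE mem_set// distrC.
move=> e Q e0; have e4 : 0 < e / 4 by rewrite divr_gt0.
have [d d0 dP] := f_equi e4.
have g_equi x y : K x -> K y -> `|x - y| < d -> `|g x - g y| <= e / 4 + e / 4.
  move=> Kx Ky xy; apply/ler_addgt0Pr => h h0.
  have m0 : 0 < Num.min (h / 2) (e / 4) by rewrite lt_min divr_gt0.
  have [q [_ Qq qP]] := near_pts [fset x; y]%fset _ Q m0.
  have := qP x; rewrite !inE eqxx /= => /(_ isT Kx).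
  have := qP y; rewrite !inE eqxx orbT /= => /(_ isT Ky).
  have := dP q x y Qq Kx Ky xy.
  rewrite !lt_min !ltr_norml !ler_norml => /andP[h1 h2] /andP[/andP[h3 h4] _] /andP[/andP[h5 h6] _].
  by apply/andP; split; lra.
have [s sK sP] : exists2 s : {fset 'rV[R]_n}, {subset s <= K} & K `<=` cover [set` s] (fun x => ball x d).
  have := cK; rewrite compact_cover => /(_ _ K (fun x => ball x d)).
  case.
  - by move=> x _; exact: ball_open.
  - by move=> x Kx; exists x => //; exact: ballxx.
  - by move=> s sK sP; exists s.
(* Error budget: e/4 at the nearest point of the net, e/4 for moving [f q] to it, and e/2 for moving
   [g], whose modulus came out as e/4 + e/4. *)
have [q [Qq Q0q qP]] := near_pts s _ Q e4.
exists q => // x Kx; have [y /= ys] := sP x Kx.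
have Ky : K y by have /set_mem := sK y ys.
rewrite -ball_normE /= => yx.
have h1 := qP y ys Ky; have h2 := dP q y x Q0q Ky Kx yx.
have h3 := g_equi y x Ky Kx yx.
move: h1 h2 h3; rewrite ltr_norml !ler_norml => /andP[h1 h2] /andP[h3 h4] /andP[h5 h6].
by apply/andP; split; lra.
Qed.

End equicontinuous_cluster.

Lemma dist_lt3 {R : realType} (a b c d e t : R) : `|a - b| < e / 3 -> t < e / 3 ->
  `|a - c| <= t -> `|b - d| <= t -> `|c - d| < e.
Proof.
rewrite !ltr_norml !ler_norml => /andP[h1 h2] h3 /andP[h4 h5] /andP[h6 h7].
by apply/andP; split; lra.
Qed.

Lemma dist_lt_ge0 {R : realType} (a b c e t : R) : `|a - b| < e / 2 -> t < e / 2 ->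
  `|c - b| <= t -> 0 < c -> 0 <= a + e.
Proof.
by rewrite ltr_norml ler_norml => /andP[h1 h2] h3 /andP[h4 h5] h6; lra.
Qed.

Lemma dist_le_lower {R : realType} (a b s t r : R) : `|a - b| <= r -> r < s - t ->
  s < b -> t <= `|a|.
Proof.
rewrite ler_norml => /andP[h1 h2] h3 h4; apply: (@le_trans _ _ a); first lra.
exact: ler_norm.
Qed.

Lemma dist_le_upper {R : realType} (a b s t r : R) : `|a - b| <= r -> r < t - s ->
  b <= s -> a <= t.
Proof. by rewrite ler_norml => /andP[h1 h2] h3 h4; lra. Qed.

Lemma dist_lt_mean {R : realType} (a b c s r t : R) : `|a - b| <= r -> `|c - b| <= t ->
  r < (1 - s) / 2 -> t < (1 - s) / 2 -> 1 - (1 - s) / 2 < b -> s < 2^-1 * (a + 1 * c).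
Proof.
by rewrite !ler_norml => /andP[h1 h2] /andP[h3 h4] h5 h6 h7; lra.
Qed.

(** * The uniform limit of the extremals and the Cauchy property of their gradients *)

Section limit_function.
Context {R : realType} {n : nat} (Omega : set 'rV[R]_n) (p m rho : R).
Local Notation leb := (@lebesgue_rV R n).
Hypothesis oO : open Omega.
Hypothesis Om : leb Omega = m%:E.
Hypothesis m0 : 0 < m.
Hypothesis Orho : forall x, Omega x -> `|x| <= rho.
Hypothesis n0 : (0 < n)%N.
Hypotheses (p2 : 2 <= p) (np : n%:R < p).
Variable w : R -> 'rV[R]_n -> R.
Hypothesis hw : forall q : R, 1 <= q -> positive_extremal Omega p q (w q).
Implicit Types (u v : 'rV[R]_n -> R) (G H : 'rV[R]_n -> 'rV[R]_n) (q s e : R).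

Let mO : measurable Omega. Proof. exact: open_measurable_rV. Qed.
Let p1 : 1 <= p. Proof. by rewrite (le_trans _ p2)// ler1n. Qed.
Let p1s : 1 < p. Proof. by rewrite (lt_le_trans _ p2)// ltr1n. Qed.
Let p0 : 0 < p. Proof. exact: lt_le_trans p1. Qed.
Let Ooo : (leb Omega < +oo)%E. Proof. by rewrite Om ltry. Qed.

Let alpha : R := 1 - n%:R / p.
Let alpha_gt0 : 0 < alpha.
Proof. by rewrite subr_gt0 ltr_pdivrMr ?mul1r. Qed.

(** The Hoelder and sup bounds hold at points of [Omega]; this transfers them to the closure, where
    uniform convergence is claimed. *)
Lemma closure_near u x e : {within closure Omega, continuous u} ->
  closure Omega x -> 0 < e ->
  exists y, [/\ Omega y, `|x - y| < e & `|u x - u y| < e].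
Proof.
move=> /subspace_continuousP cu cx e0.
have /cvgrPdist_lt/(_ e e0) H := cu x cx.
have /cx[y [Oy [/= h1 h2]]] : nbhs x [set y | (closure Omega y -> `|u x - u y| < e) /\ ball x e y].
  by apply: filterI; [exact: H|exact: nbhsx_ballx].
exists y; split => //; last by apply: h1; exact: subset_closure.
by move: h2; rewrite -ball_normE.
Qed.


Let wb := CW01p_wgrad oO Om p2 hw.

Lemma rlambda_bounded : exists Q0 : R, forall q, Q0 <= q ->
  1 <= q /\ rlambda Omega p w q <= rLambda Omega p m w + 1.
Proof.
have h := rlambda_cvg oO Om m0 Orho n0 p2 np hw.
have /cvgr_le/(_ (rLambda Omega p m w + 1)) := h.
rewrite ltrDl ltr01 => /(_ isT) [Q [_ HQ]].
(* Sets in the filter at [+oo] contain the points strictly above some [Q], hence [Q + 1]. *)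
exists (Num.max (Q + 1) 1) => q; rewrite ge_max => /andP[h1 h2]; split => //.
by apply: HQ; rewrite (lt_le_trans _ h1)// ltrDl.
Qed.

(** [hoelder_cst] with the norm of the gradient replaced by a bound valid for all large [q], where
    the energy is at most [rLambda] plus 1. *)
Definition bound_cst : R :=
  3 * (@morrey_cst R n p * ((rLambda Omega p m w + 1) `^ p^-1 + 1)).

Lemma morrey_cst_ge0 : 0 <= @morrey_cst R n p.
Proof.
rewrite divr_ge0// subr_ge0 powRN invf_le1 ?powR_gt0//.
rewrite [leLHS](_ : _ = 1 `^ alpha); last by rewrite powR1.
by rewrite ge0_ler_powR ?nnegrE ?(ltW alpha_gt0)// ler1n.
Qed.

Lemma hoelder_cst_le q : 1 <= q -> rlambda Omega p w q <= rLambda Omega p m w + 1 ->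
  hoelder_cst Omega p (wgrad Omega p w q) <= bound_cst.
Proof.
move=> q1 lq; rewrite /hoelder_cst /bound_cst ler_wpM2l// ler_wpM2l ?morrey_cst_ge0//.
rewrite lerD2r; set N := fine _.
have N0 : 0 <= N by apply: fine_ge0; exact: normG_ge0.
have -> : N = (rlambda Omega p w q) `^ p^-1.
  by rewrite /rlambda /energyG -/N -powRrM divff ?gt_eqF// powRr1.
apply: ge0_ler_powR; rewrite ?nnegrE ?invr_ge0 ?(ltW p0)//; first exact: rlambda_ge0.
exact: le_trans (rlambda_ge0 Omega p w q) lq.
Qed.

Lemma extremals_cluster : exists g : 'rV[R]_n -> R, forall e (Q : R), 0 < e ->
  exists2 q, Q <= q & forall x, closure Omega x -> `|w q x - g x| <= e.
Proof.
have [Q0 Q0P] := rlambda_bounded.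
have b0 : 0 <= bound_cst.
  rewrite mulr_ge0// mulr_ge0 ?morrey_cst_ge0// addr_ge0// powR_ge0//.
apply: (@equicontinuous_cluster _ _ (closure Omega) _ w Q0 (bound_cst * (2 * rho + 1) `^ alpha + 1)).
- apply: bounded_closed_compact; last exact: closed_closure.
  exists (rho + 1); split; first exact: num_real.
  move=> M M1 x cx; rewrite /=.
  (* Only the distance clause of [closure_near] is wanted here, so it is applied to a constant
     function. *)
  have cid : {within closure Omega, continuous (cst 0 : 'rV[R]_n -> R)}.
    exact: continuous_subspaceT (@cst_continuous _ _ _).
  have [y [Oy xy _]] := closure_near cid cx ltr01.
  have := ler_normD (x - y) y; rewrite subrK; have := Orho Oy; lra.
- move=> q x /Q0P[q1 lq] cx; have [h a c] := wb q1.
  have [y [Oy _ xy]] := closure_near c cx ltr01.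
  have h1 := W01p_sup oO Ooo n0 p1s np h a c Orho Oy.
  have h2 := ler_wpM2r (powR_ge0 (2 * rho + 1) alpha) (hoelder_cst_le q1 lq).
  have := ler_normD (w q x - w q y) (w q y); rewrite subrK.
  by move: h2; rewrite /alpha; lra.
(* [d] is chosen so that [bound_cst] times d^alpha is at most e/2; the other e/2 pays for replacing
   both points by points of [Omega]. *)
move=> e e0; pose d := (e / 2 / (bound_cst + 1)) `^ alpha^-1.
have eb : 0 < e / 2 / (bound_cst + 1) by rewrite !divr_gt0// ltr_wpDl.
exists d; first exact: powR_gt0.
move=> q x y /Q0P[q1 lq] cx cy xy; have [h a c] := wb q1.
(* Half of the gap between |x - y| and [d] keeps the replaced points within distance [d], and e/4
   bounds the change of each value. *)
pose t := Num.min ((d - `|x - y|) / 2) (e / 4).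
have t0 : 0 < t by rewrite lt_min !divr_gt0// subr_gt0.
have t1 : t <= (d - `|x - y|) / 2 by rewrite ge_min lexx.
have t2 : t <= e / 4 by rewrite ge_min lexx orbT.
have [x' [Ox' xx' ux']] := closure_near c cx t0.
have [y' [Oy' yy' uy']] := closure_near c cy t0.
have xy' : `|x' - y'| <= d.
  have -> : x' - y' = - (x - x') + (x - y) + (y - y').
    by apply/rowP => i; rewrite !mxE; ring.
  have := ler_normD (- (x - x') + (x - y)) (y - y').
  have := ler_normD (- (x - x')) (x - y); rewrite normrN; lra.
have h1 := W01p_hoelder oO Ooo n0 p1s np h a c Ox' Oy'.
have h2 : hoelder_cst Omega p (wgrad Omega p w q) * `|x' - y'| `^ alpha <= e / 2.
  apply: (@le_trans _ _ (bound_cst * (e / 2 / (bound_cst + 1)))).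
    apply: ler_pM; [exact: hoelder_cst_ge0|exact: powR_ge0|exact: hoelder_cst_le|].
    apply: (@le_trans _ _ (d `^ alpha)).
      by apply: ge0_ler_powR; rewrite ?nnegrE ?powR_ge0 ?(ltW alpha_gt0).
    by rewrite /d -powRrM mulVf ?gt_eqF// powRr1 ?(ltW eb).
  rewrite mulrCA ler_piMr ?divr_ge0 ?(ltW e0)//.
  by rewrite ler_pdivrMr ?ltr_wpDl// mul1r lerDl.
have {}h1 := le_trans h1 h2.
move: h1 ux' uy'; rewrite !ltr_norml !ler_norml.
by move=> /andP[h3 h4] /andP[h5 h6] /andP[h7 h8]; apply/andP; split; lra.
Qed.

Variable g : 'rV[R]_n -> R.
Variable q_ : nat -> R.
Hypothesis q_ge : forall k, k.+1%:R <= q_ k.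
Hypothesis q_g : forall k x, closure Omega x -> `|w (q_ k) x - g x| <= k.+1%:R^-1.

Let q_ge1 k : 1 <= q_ k.
Proof. by apply: le_trans (q_ge k); rewrite ler1n. Qed.

Lemma q_cvgy : q_ k @[k --> \oo] --> +oo.
Proof.
apply/cvgryPge => A; near=> k; apply: le_trans (q_ge k).
apply: (@le_trans _ _ k%:R); last by rewrite ler_nat.
by near: k; exact: nbhs_infty_ger.
Unshelve. all: by end_near. Qed.

Lemma inv_small e : 0 < e -> exists K, forall k, (K <= k)%N -> k.+1%:R^-1 < e :> R.
Proof.
move=> e0; exists (Num.bound e^-1) => k Kk.
rewrite invf_plt ?posrE//; apply: lt_le_trans (archi_boundP _) _.
  by rewrite invr_ge0 ltW.
by rewrite ler_nat; exact: leqW.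
Qed.

Lemma limit_continuous : {within closure Omega, continuous g}.
Proof.
apply/subspace_continuousP => x cx; apply/cvgrPdist_lt => e e0.
have e3 : 0 < e / 3 by rewrite divr_gt0.
have [K /(_ K (leqnn K)) Ke] := inv_small e3.
have [_ _ /subspace_continuousP c] := wb (q_ge1 K).
have /cvgrPdist_lt/(_ _ e3) := c x cx.
rewrite !near_withinE; apply: filterS => y h cy; have {}h := h cy.
have := q_g K cx; have := q_g K cy => h1 h2; exact: (dist_lt3 h Ke h2 h1).
Qed.

Lemma limit_ge0 x : closure Omega x -> 0 <= g x.
Proof.
move=> cx; apply/ler_addgt0Pr => e e0.
have [y [Oy _ gxy]] := closure_near limit_continuous cx (divr_gt0 e0 (ltr0n R 2)).
have [K /(_ K (leqnn K)) Ke] := inv_small (divr_gt0 e0 (ltr0n R 2)).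
have [_ /(_ y Oy) wy _ _] := hw (q_ge1 K).
exact: (dist_lt_ge0 gxy Ke (q_g K (subset_closure Oy)) wy).
Qed.

Let powR_inv_cvg (a : R) : 0 < a -> a `^ (q_ k)^-1 @[k --> \oo] --> (1 : R).
Proof.
move=> a0; have := cvg_comp _ _ q_cvgy (powR_pinfty_cvg 1 a0).
by apply: cvg_trans; apply: near_eq_cvg; apply: nearW => k /=; rewrite div1r.
Qed.

(** If g exceeded s > 1 on a set, necessarily of measure d > 0, then for some t in ]1, s[ uniform
    convergence would give w >= t there, and the norm 1 would be at least t d^(1/q), which tends to
    t. *)
Lemma limit_le1 x : Omega x -> g x <= 1.
Proof.
move=> Ox; rewrite leNgt; apply/negP => gx1.
pose s := (1 + g x) / 2; have s1 : 1 < s by rewrite /s; lra.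
have sg : s < g x by rewrite /s; lra.
have [d d0 dE] := superlevel_lebesgue oO Om limit_continuous Ox sg.
pose U := [set x | Omega x /\ s < g x].
have mU : measurable U by apply: open_measurable_rV; exact: (open_superlevel oO limit_continuous).
pose t := (1 + s) / 2; have t1 : 1 < t by rewrite /t; lra.
have ts : 0 < s - t by rewrite /t; lra.
have [K HK] := inv_small ts.
have : t <= 1.
  have cm : t * d `^ (q_ k)^-1 @[k --> \oo] --> t.
    by have := cvgM (cvg_cst t) (powR_inv_cvg d0); rewrite mulr1; apply.
  apply: (cvgr_to_le cm); exists K => // k /= Kk.
  have h := wb (q_ge1 k); have [_ _ N1 _] := hw (q_ge1 k).
  rewrite -lee_fin -N1.
  apply: (normL_ge_bound mO (q_ge1 k) _ (CW01p_grad_measurable oO h) mU _ dE).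
  - exact: ltW (lt_trans ltr01 t1).
  - by move=> y [].
  - move=> y [Oy sy]; exact: (dist_le_lower (q_g k (subset_closure Oy)) (HK k Kk) sy).
by rewrite leNgt t1.
Qed.

(** Otherwise the extremals would eventually stay below some t < 1, and their norm 1 would be at
    most t m^(1/q), which tends to t. *)
Lemma limit_sup s : s < 1 -> exists2 x, Omega x & s < g x.
Proof.
move=> s1; apply: contrapT => H.
have gs x : Omega x -> g x <= s.
  by move=> Ox; rewrite leNgt; apply/negP => gx; apply: H; exists x.
(* The maximum with 0 covers negative [s], since [normL_le_bound] requires a nonnegative bound. *)
pose t := Num.max 0 ((1 + s) / 2).
have t0 : 0 <= t by rewrite le_max lexx.
have t1 : t < 1 by rewrite gt_max ltr01; lra.
have st : 0 < t - s by rewrite subr_gt0 lt_max; apply/orP; right; lra.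
have [K HK] := inv_small st.
have : 1 <= t.
  have cm : t * m `^ (q_ k)^-1 @[k --> \oo] --> t.
    by have := cvgM (cvg_cst t) (powR_inv_cvg m0); rewrite mulr1; apply.
  apply: (cvgr_to_ge cm); exists K => // k /= Kk.
  have h := wb (q_ge1 k); have [_ wpos N1 _] := hw (q_ge1 k).
  rewrite -lee_fin -N1.
  apply: (normL_le_bound mO Om (q_ge1 k) t0 (CW01p_grad_measurable oO h)).
  move=> y Oy; rewrite gtr0_norm ?wpos//.
  exact: (dist_le_upper (q_g k (subset_closure Oy)) (HK k Kk) (gs y Oy)).
by rewrite leNgt t1.
Qed.

(* The midpoint of w_(q_k) and w_(q_l) exceeds s somewhere, with s ^ p = 1 - d, so its
   energy is at least Lambda (1 - d). *)
Lemma energy_cauchy e : 0 < e -> exists K, forall k l, (K <= k)%N -> (K <= l)%N ->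
  energyG Omega p (fun x => 2^-1 *: (wgrad Omega p w (q_ k) x - wgrad Omega p w (q_ l) x)) <= e.
Proof.
move=> e0; set L := rLambda Omega p m w.
have L0 : 0 <= L.
  have := cvgr_to_ge (rlambda_cvg oO Om m0 Orho n0 p2 np hw); apply.
  by apply: nearW => q; exact: rlambda_ge0.
pose d := Num.min 2^-1 (e / 2 / (L + 1)).
have ed : 0 < e / 2 / (L + 1) by rewrite !divr_gt0// ltr_wpDl.
have d0 : 0 < d by rewrite lt_min ed andbT; lra.
have d1 : d < 1 by rewrite gt_min; apply/orP; left; lra.
have Ld : L * d <= e / 2.
  apply: (@le_trans _ _ (L * (e / 2 / (L + 1)))).
    by rewrite ler_wpM2l// ge_min lexx orbT.
  rewrite mulrCA ler_piMr ?divr_ge0 ?(ltW e0)//.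
  by rewrite ler_pdivrMr ?ltr_wpDl// mul1r lerDl.
pose s := (1 - d) `^ p^-1.
have s0 : 0 < s by rewrite powR_gt0// subr_gt0.
have sp : s `^ p = 1 - d by rewrite /s -powRrM mulVf ?gt_eqF// powRr1// subr_ge0 ltW.
have s1 : s < 1.
  rewrite ltNge; apply/negP => s1.
  have : 1 `^ p <= s `^ p by apply: ge0_ler_powR; rewrite ?nnegrE ?(ltW p0) ?(ltW s0).
  by rewrite sp powR1; lra.
(* The distance from [s] to 1 is shared equally: half for how far g x falls below 1, half for the
   error of uniform approximation. *)
have s2 : 0 < (1 - s) / 2 by rewrite divr_gt0// subr_gt0.
have s3 : 1 - (1 - s) / 2 < 1 by rewrite ltrBlDr ltrDl.
have [x Ox gx] := limit_sup s3.
have [K1 HK1] := inv_small s2.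
have e2 : 0 < e / 2 by rewrite divr_gt0.
have [K2 _ HK2] : \forall k \near \oo, rlambda Omega p w (q_ k) <= L + e / 2.
  have := cvg_comp _ _ q_cvgy (rlambda_cvg oO Om m0 Orho n0 p2 np hw).
  by move/cvgr_le; apply; rewrite ltrDl.
exists (maxn K1 K2) => k l; rewrite !geq_max => /andP[k1 k2] /andP[l1 l2].
have hk := wb (q_ge1 k); have hl := wb (q_ge1 l).
have [[_ _ ik] _ _] := hk; have [[_ _ il] _ _] := hl.
have hv := CW01p_gradZ oO Om p2 2^-1 (CW01p_gradD oO Om p2 1 hk hl).
have vx : s < 2^-1 * (w (q_ k) x + 1 * w (q_ l) x).
  exact: (dist_lt_mean (q_g k (subset_closure Ox)) (q_g l (subset_closure Ox))
    (HK1 k k1) (HK1 l l1) gx).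
have h1 := rLambda_le_energy oO Om m0 Orho n0 p2 np hw hv Ox s0 vx.
have h2 := clarkson oO p2 ik il.
have h3 := HK2 k k2; have h4 := HK2 l l2.
move: h1 h2 h3 h4; rewrite -/L sp /= /rlambda.
have -> : (fun x => 2^-1 *: (wgrad Omega p w (q_ k) x + 1 *: wgrad Omega p w (q_ l) x)) =
  (fun x => 2^-1 *: (wgrad Omega p w (q_ k) x + wgrad Omega p w (q_ l) x)).
  by apply/funext => z; rewrite scale1r.
move: (energyG _ _ _) (energyG _ _ _) (energyG _ _ _) (energyG _ _ _) => a b c f.
by move=> h1 h2 h3 h4; lra.
Qed.

Lemma gradient_cauchy e : 0 < e -> exists K, forall k l, (K <= k)%N -> (K <= l)%N ->
  (normG Omega p (fun x => wgrad Omega p w (q_ k) x - wgrad Omega p w (q_ l) x)%R <= e%:E)%E.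
Proof.
move=> e0; have ep : 0 < (e / 2) `^ p by rewrite powR_gt0// divr_gt0.
have [K HK] := energy_cauchy ep; exists K => k l Kk Kl.
have [[_ _ ik] _ _] := wb (q_ge1 k); have [[_ _ il] _ _] := wb (q_ge1 l).
have id : inLG Omega p (fun x => wgrad Omega p w (q_ k) x - wgrad Omega p w (q_ l) x).
  have := inLGD oO p1 (-1) ik il; congr inLG; apply/funext => x.
  by rewrite scaleN1r.
have := HK k l Kk Kl; rewrite (energyGZ oO p2 2^-1 id).
have nf := normG_fin oO p1 id; rewrite -(fineK nf) lee_fin /energyG.
set N := fine _; have N0 : 0 <= N by apply: fine_ge0; exact: normG_ge0.
move=> h; rewrite leNgt; apply/negP => eN; move: h; apply/negP; rewrite -ltNge.
rewrite ger0_norm// -powRM// [2^-1 * N]mulrC.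
have h1 : e / 2 < N * 2^-1 by rewrite ltr_pM2r// invr_gt0.
have h2 : 0 <= e / 2 by rewrite divr_ge0// ltW.
by apply: gt0_ltr_powR => //; rewrite ?nnegrE ?(le_trans h2)// ltW.
Qed.

End limit_function.

(** Away from 0 this is continuity of exp(r ln t). The limit 0 needs its own argument, because the
    logarithm is not continuous there. *)
Lemma cvg_powR {R : realType} {T : Type} (F : set_system T) {FF : ProperFilter F}
  (f : T -> R) (a r : R) : 0 < r -> (forall x, 0 <= f x) -> f x @[x --> F] --> a ->
  f x `^ r @[x --> F] --> a `^ r.
Proof.
move=> r0 f0 fa.
have a0 : 0 <= a by apply: (cvgr_to_ge fa); exact: nearW.
move: fa; have [->|an0] := eqVneq a 0 => fa.
  apply/cvgrPdist_lt => e e0; rewrite powR0 ?gt_eqF//.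
  have e1 : 0 < e `^ r^-1 by exact: powR_gt0.
  have /cvgrPdist_lt/(_ _ e1) := fa; apply: filterS => x.
  rewrite !sub0r !normrN !ger0_norm ?powR_ge0// => h.
  have -> : e = (e `^ r^-1) `^ r by rewrite -powRrM mulVf ?gt_eqF// powRr1 ?ltW.
  by apply: gt0_ltr_powR => //; rewrite nnegrE ?powR_ge0.
have ap : 0 < a by rewrite lt_neqAle eq_sym an0.
have h : expR (r * ln (f x)) @[x --> F] --> expR (r * ln a).
  apply: (@cvg_comp _ _ _ (fun x => r * ln (f x)) expR).
    apply: cvgM; first exact: cvg_cst.
    by apply: (cvg_comp _ _ fa); exact: continuous_ln.
  exact: continuous_expR.
rewrite {2}/powR (gt_eqF ap); apply: cvg_trans h; apply: near_eq_cvg.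
have /cvgr_gt/(_ 0 ap) := fa; apply: filterS => x fx.
by rewrite /powR gt_eqF.
Qed.

(** * Completeness of L^p and closedness of the weak gradient *)

Section completeness.
Context {R : realType} {n : nat} (Omega : set 'rV[R]_n) (p m : R).
Local Notation leb := (@lebesgue_rV R n).
Hypothesis mO : measurable Omega.
Hypothesis Om : leb Omega = m%:E.
Hypothesis p1 : 1 <= p.
Implicit Types (u v : 'rV[R]_n -> R).

Let p0 : 0 < p. Proof. exact: lt_le_trans p1. Qed.

(** Lower semicontinuity of the norm under pointwise convergence, from Fatou's lemma for the p-th
    powers. *)
Lemma normL_cvg_le (v_ : nat -> 'rV[R]_n -> R) v (e : R) : 0 <= e ->
  (forall j, measurable_fun Omega (v_ j)) ->
  (forall x, Omega x -> v_ j x @[j --> \oo] --> v x) ->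
  (forall j, (normL Omega p%:E (v_ j) <= e%:E)%E) -> (normL Omega p%:E v <= e%:E)%E.
Proof.
move=> e0 mv_ vv ve.
have mv : measurable_fun Omega v by exact: (measurable_fun_cvg mv_ vv).
have mpow j : measurable_fun Omega (fun x => (`|v_ j x| `^ p)%:E).
  apply/measurable_EFinP; apply: (@measurableT_comp _ _ _ _ _ _ (@powR R ^~ p)).
    exact: measurable_powR.
  exact: measurableT_comp.
have H : (\int[leb]_(x in Omega) (`|v x| `^ p)%:E <= (e `^ p)%:E)%E.
  have pow0 j x : Omega x -> (0 <= (`|v_ j x| `^ p)%:E)%E by rewrite lee_fin powR_ge0.
  have := fatou leb mO mpow pow0.
  have -> : (\int[leb]_(x in Omega) limn_einf (fun j => (`|v_ j x| `^ p)%:E) =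
      \int[leb]_(x in Omega) (`|v x| `^ p)%:E)%E.
    apply: eq_integral => x /set_mem Ox.
    have c : (`|v_ j x| `^ p)%:E @[j --> \oo] --> (`|v x| `^ p)%:E.
      apply: cvg_EFin; first exact: nearW.
      by apply: cvg_powR => //; apply: cvg_norm; exact: vv.
    by have [-> _] := cvg_limn_einf_sup c.
  move/le_trans; apply; rewrite limn_einf_lim.
  apply: lime_le; first exact: is_cvg_einfs.
  apply: nearW => j; apply: ge_ereal_inf.
  exists (\int[leb]_(x in Omega) (`|v_ j x| `^ p)%:E)%E; first by exists j => /=.
  have := normL_powR p1 (mv_ j) => <-; rewrite -poweR_EFin.
  by apply: gt0_ler_poweR; rewrite ?(ltW p0)// in_itv/= leey ?normL_ge0 ?lee_fin ?e0.
have E := normL_powR p1 mv; rewrite -E in H.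
have {}H : ((normL Omega p%:E v `^ p) `^ p^-1 <= (e `^ p)%:E `^ p^-1)%E.
  by apply: gt0_ler_poweR H; rewrite ?invr_ge0 ?(ltW p0)// in_itv/= leey ?poweR_ge0 ?lee_fin ?powR_ge0.
move: H; rewrite -poweRrM divff ?gt_eqF// poweRe1 ?normL_ge0//.
by rewrite poweR_EFin -powRrM divff ?gt_eqF// powRr1.
Qed.


Lemma is_cvgn_summable_diff (a : nat -> R) :
  (\sum_(0 <= j <oo) (`|a j.+1 - a j|)%:E < +oo)%E -> cvgn a.
Proof.
set S := (X in (X < _)%E) => Soo.
have Sge k : ((\sum_(0 <= j < k) `|a j.+1 - a j|)%:E <= S)%E.
  by rewrite -sumEFin; apply: nneseries_lim_ge => j _ _; rewrite lee_fin.
have Sfin : S \is a fin_num.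
  by rewrite ge0_fin_numE// (le_trans _ (Sge 0%N))// big_geq.
have cS : cvgn [normed series (fun j => a j.+1 - a j)].
  apply: nondecreasing_is_cvgn.
    apply/nondecreasing_seqP => k; rewrite /= [leRHS]seriesSr lerDl.
    exact: normr_ge0.
  by exists (fine S) => _ [k _ <-]; rewrite -lee_fin fineK//; exact: Sge.
have := normed_cvg cS; have -> : series (fun j => a j.+1 - a j) = (fun j => a j - a 0%N).
  by apply/funext => k; rewrite /series /= telescope_sumr.
move=> /cvg_ex[l al]; apply/cvg_ex; exists (l + a 0%N).
have := cvgD al (cvg_cst (a 0%N)).
have -> : (fun j => a j - a 0%N) + cst (a 0%N) = a.
  by apply/funext => j; rewrite [LHS]/= subrK.
exact.
Qed.

Lemma normL1_integral u : measurable_fun Omega u ->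
  normL Omega 1 u = (\int[leb]_(x in Omega) (`|u x|)%:E)%E.
Proof.
move=> mu; have h := normL_powR (lexx (1 : R)) mu.
rewrite poweRe1 ?normL_ge0// in h; rewrite h.
by apply: eq_integral => x _; rewrite powRr1.
Qed.

(* Along a subsequence with summable increments the convergence holds almost
   everywhere; v_ is this subsequence cut off outside the convergence set. *)
Lemma normL_complete (u_ : nat -> 'rV[R]_n -> R) :
  (forall k, inL Omega p%:E (u_ k)) ->
  (forall e, 0 < e -> exists K, forall k l, (K <= k)%N -> (K <= l)%N ->
    (normL Omega p%:E (fun x => u_ k x - u_ l x)%R <= e%:E)%E) ->
  exists2 u, inL Omega p%:E u & forall e, 0 < e -> exists K, forall k, (K <= k)%N ->
    (normL Omega p%:E (fun x => u_ k x - u x)%R <= e%:E)%E.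
Proof.
move=> iu cauchy.
have mu k : measurable_fun Omega (u_ k) by have /(inLP mO)[] := iu k.
have mB k l : measurable_fun Omega (fun x => u_ k x - u_ l x) by exact: measurable_funB.
have e2 j : 0 < 1 / (2 ^ j.+1)%:R :> R by rewrite divr_gt0// ltr0n expn_gt0.
have [K HK] := choice (fun j => cauchy _ (e2 j)).
(* The maximum makes the indices nondecreasing and past every earlier threshold; adding [j] makes
   them unbounded. *)
pose k_ j := (\max_(i < j.+1) K i + j)%N.
have kK j : (K j <= k_ j)%N.
  by apply: leq_trans (leq_addr _ _); exact: (leq_bigmax (ord_max : 'I_j.+1)).
have kS j : (k_ j <= k_ j.+1)%N.
  by rewrite /k_ leq_add// [leqRHS]big_ord_recr leq_maxl.
pose d j x := u_ (k_ j.+1) x - u_ (k_ j) x.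
have dle j : (normL Omega p%:E (d j) <= (1 / (2 ^ j.+1)%:R)%:E)%E.
  by apply: HK; [exact: leq_trans (kS j)|exact: kK].
pose C := m `^ (1 - p^-1).
pose S x := (\sum_(0 <= j <oo) (`|d j x|)%:E)%E.
have md j : measurable_fun Omega (fun x => (`|d j x|)%:E).
  by apply/measurable_EFinP; apply: measurableT_comp => //; exact: mB.
have mS : measurable_fun Omega S.
  by apply: ge0_emeasurable_sum => [j x _ _|j _]; [rewrite lee_fin|exact: md].
(* As the measure is finite, the L^1 norm is at most [C] times the L^p norm, so the geometric bounds
   on the increments can be summed under the integral. *)
have intS : (\int[leb]_(x in Omega) S x < +oo)%E.
  rewrite integral_nneseries//.
  apply: (@le_lt_trans _ _ (\sum_(0 <= j <oo) (C / (2 ^ j.+1)%:R)%:E)%E); last first.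
    by apply: le_lt_trans (epsilon_trick0 _ _) (ltry _); exact: powR_ge0.
  apply: lee_nneseries => [j _ _|j _].
    by apply: integral_ge0 => x _; rewrite lee_fin.
  rewrite -(normL1_integral (mB _ _)).
  have idf : normL Omega p%:E (d j) \is a fin_num.
    by rewrite ge0_fin_numE ?normL_ge0//; apply: le_lt_trans (dle j) (ltry _).
  apply: le_trans (normL_le_normL mO Om (lexx 1) p1 (mB _ _) idf) _.
  rewrite invr1 lee_fin mulrC /C -[X in _ <= _ * X]mul1r ler_wpM2l ?powR_ge0//.
  by have := dle j; rewrite -(fineK idf) lee_fin.
pose A := Omega `&` [set x | (S x < +oo)%E].
have mA : measurable A by exact: emeasurable_fun_infty_o.
have S0 x : (0 <= S x)%E by apply: nneseries_ge0 => j _ _; rewrite lee_fin.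
have aeA : {ae leb, forall x, Omega x -> A x}.
  have : leb.-integrable Omega S.
    apply/integrableP; split => //; apply: le_lt_trans intS.
    by under eq_integral do rewrite gee0_abs//.
  move/(integrable_ae mO); apply: filterS => x + Ox => /(_ Ox) Sx.
  by split => //=; rewrite ltey_eq Sx.
pose v_ j x := \1_A x * u_ (k_ j) x.
have vcvg x : cvgn (fun j => v_ j x).
  rewrite /v_ indicE; case: (boolP (x \in A)) => [/set_mem[_ Sx]|_].
    have -> : (fun j => true%:R * u_ (k_ j) x) = (fun j => u_ (k_ j) x).
      by apply/funext => j; rewrite mul1r.
    exact: is_cvgn_summable_diff.
  have -> : (fun j => false%:R * u_ (k_ j) x) = cst 0.
    by apply/funext => j; rewrite mul0r.
  exact: is_cvg_cst.
pose u x := limn (fun j => v_ j x).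
have mv j : measurable_fun Omega (v_ j).
  by apply: measurable_funM => //; exact: measurable_indic.
have mlim : measurable_fun Omega u by exact: (measurable_fun_cvg mv (fun x _ => vcvg x)).
have main e : 0 < e -> exists K, forall k, (K <= k)%N ->
    (normL Omega p%:E (fun x => u_ k x - u x)%R <= e%:E)%E.
  (* For fixed [k] the limit in [j] is taken inside the norm by [normL_cvg_le]; shifting [j] by [K1]
     puts the second index past the Cauchy threshold from the start. *)
  move=> e0; have [K1 HK1] := cauchy e e0.
  exists K1 => k Kk.
  apply: (@normL_cvg_le (fun j x => u_ k x - v_ (j + K1)%N x)) => [||x Ox|j].
  - exact: ltW.
  - by move=> j; exact: measurable_funB.
  - apply: cvgB; first exact: cvg_cst.
    by have := vcvg x; rewrite -(cvg_shiftn K1).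
  have mvB : measurable_fun Omega (fun x => u_ k x - v_ (j + K1)%N x) by exact: measurable_funB.
  rewrite (normL_ae mO p1 mvB (mB k (k_ (j + K1)%N))); last first.
    apply: filterS aeA => x + Ox => /(_ Ox) Ax.
    by rewrite /v_ indicE mem_set// mul1r.
  by apply: HK1 => //; rewrite /k_ addnA leq_addl.
exists u => //.
have [K1 /(_ K1 (leqnn _)) H] := main 1 ltr01.
have iB : inL Omega p%:E (fun x => u_ K1 x - u x).
  apply/(inLP mO); split; first exact: measurable_funB.
  exact: le_lt_trans H (ltry _).
have := inLD mO p1 (-1) (iu K1) iB; congr inL; apply/funext => x.
by rewrite mulN1r opprB addrC subrK.
Qed.

End completeness.

(** * Completeness for gradient fields and closedness of the weak gradient *)

Section closedness.
Context {R : realType} {n : nat} (Omega : set 'rV[R]_n) (p m : R).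
Local Notation leb := (@lebesgue_rV R n).
Hypothesis oO : open Omega.
Hypothesis Om : leb Omega = m%:E.
Hypothesis p1 : 1 <= p.
Implicit Types (u v psi : 'rV[R]_n -> R) (G H : 'rV[R]_n -> 'rV[R]_n).

Let mO : measurable Omega. Proof. exact: open_measurable_rV. Qed.
Let p0 : 0 < p. Proof. exact: lt_le_trans p1. Qed.
Let Ooo : (leb Omega < +oo)%E. Proof. by rewrite Om ltry. Qed.

Lemma normG_le_sum G : inLG Omega p G ->
  (normG Omega p G <= \sum_(i < n) normL Omega p%:E (fun x => G x 0%R i))%E.
Proof.
move=> iG; have mG i : measurable_fun Omega (fun x => G x 0 i) by exact: (inLG_measurable oO).
have mN i : measurable_fun Omega (fun x => `|G x 0 i|) by exact: measurableT_comp.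
have mS (s : seq 'I_n) : measurable_fun Omega (fun x => \sum_(i <- s) `|G x 0 i|).
  by apply: measurable_sum.
apply: (@le_trans _ _ (normL Omega p%:E (fun x => \sum_(i < n) `|G x 0 i|))).
  apply: (normL_le mO p1 (inLG_measurable_enorm oO iG) (mS _)) => x _.
  rewrite ger0_norm ?enorm_ge0//; apply: le_trans (enorm_le_sum _) _.
  exact: ler_norm.
elim: (index_enum _) => [|i s IH].
  rewrite big_nil; under eq_fun do rewrite big_nil.
  rewrite /normL (_ : _ \o _ = cst 0%E); last first.
    by apply/funext => x; rewrite /= patchE if_same.
  by rewrite Lnorm0// eqe gt_eqF.
rewrite big_cons; under eq_fun do rewrite big_cons.
apply: le_trans (normLD mO p1 (mN i) (mS s)) _; apply: leeD IH.
by apply: (normL_le mO p1 (mN i) (mG i)) => x _; rewrite normr_id.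
Qed.

Lemma normL_coord_le G i : inLG Omega p G ->
  (normL Omega p%:E (fun x => G x 0%R i) <= normG Omega p G)%E.
Proof.
move=> iG; apply: (normL_le mO p1 (inLG_measurable oO i iG) (inLG_measurable_enorm oO iG)) => x _.
by rewrite [leRHS]ger0_norm ?enorm_ge0// coord_le_enorm.
Qed.

Lemma inLGB G H : inLG Omega p G -> inLG Omega p H -> inLG Omega p (fun x => G x - H x).
Proof.
move=> iG iH; have := inLGD oO p1 (-1) iG iH; congr inLG; apply/funext => x.
by rewrite scaleN1r.
Qed.

Lemma inLB u v : inL Omega p%:E u -> inL Omega p%:E v -> inL Omega p%:E (fun x => u x - v x).
Proof.
move=> iu iv; have := inLD mO p1 (-1) iu iv; congr inL; apply/funext => x.
by rewrite mulN1r.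
Qed.

Lemma normG_complete (G_ : nat -> 'rV[R]_n -> 'rV[R]_n) : (0 < n)%N ->
  (forall k, inLG Omega p (G_ k)) ->
  (forall e, 0 < e -> exists K, forall k l, (K <= k)%N -> (K <= l)%N ->
    (normG Omega p (fun x => G_ k x - G_ l x)%R <= e%:E)%E) ->
  exists2 G, inLG Omega p G & forall e, 0 < e -> exists K, forall k, (K <= k)%N ->
    (normG Omega p (fun x => G_ k x - G x)%R <= e%:E)%E.
Proof.
move=> n0 iG cauchy.
have H i : exists u, inL Omega p%:E u /\ forall e, 0 < e -> exists K, forall k, (K <= k)%N ->
    (normL Omega p%:E (fun x => G_ k x 0 i - u x)%R <= e%:E)%E.
  have [|e /cauchy[K HK]|u iu Hu] := @normL_complete _ _ Omega p m mO Om p1 (fun k x => G_ k x 0 i).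
  - by move=> k; exact: iG.
  - exists K => k l Kk Kl; apply: le_trans (HK k l Kk Kl).
    have := normL_coord_le i (inLGB (iG k) (iG l)).
    by under eq_fun do rewrite !mxE.
  - by exists u.
have [u_ Hu] := choice H; pose G x := \row_i u_ i x.
have iGG : inLG Omega p G.
  move=> i; rewrite (_ : (fun x => _) = u_ i); first by have [] := Hu i.
  by apply/funext => x; rewrite mxE.
exists G => // e e0.
have en : 0 < e / n%:R by rewrite divr_gt0// ltr0n.
have [K HK] := choice (fun i => (Hu i).2 _ en).
exists (\max_i K i)%N => k Kk; apply: le_trans (normG_le_sum (inLGB (iG k) iGG)) _.
have -> : e = \sum_(i < n) e / n%:R.
  by rewrite sumr_const card_ord -[RHS]mulr_natr divfK// pnatr_eq0 -lt0n.
rewrite -sumEFin; apply: lee_sum => i _.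
rewrite (_ : (fun x => _) = (fun x => G_ k x 0 i - u_ i x)); last first.
  by apply/funext => x; rewrite !mxE.
by apply: HK; apply: leq_trans Kk; exact: leq_bigmax.
Qed.

Lemma inL_integrable u : inL Omega p%:E u -> leb.-integrable Omega (EFin \o u).
Proof.
move=> iu; have /(inLP mO)[mu _] := iu; apply/integrableP; split.
  exact/measurable_EFinP.
have := normL_le_normL mO Om (lexx 1) p1 mu (normL_fin mO iu).
by rewrite (normL1_integral mu) => /le_lt_trans; apply; exact: ltry.
Qed.

Lemma inL_loc_integrable u : inL Omega p%:E u -> loc_integrable Omega u.
Proof.
move=> iu; split; first by have /(inLP mO)[] := iu.
move=> K cK KO; apply: integrableS (inL_integrable iu) => //.
exact: compact_measurable_rV.
Qed.

Lemma Rintegral_normL_le u psi (M : R) : inL Omega p%:E u -> measurable_fun Omega psi ->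
  0 <= M -> (forall x, `|psi x| <= M) ->
  `|\int[leb]_(x in Omega) (u x * psi x)| <=
    M * (fine (normL Omega p%:E u) * m `^ (1 - p^-1)).
Proof.
move=> iu mpsi M0 psiM; have /(inLP mO)[mu _] := iu.
have iiu := inL_integrable iu.
have h1 := normL_le_normL mO Om (lexx 1) p1 mu (normL_fin mO iu).
rewrite (normL1_integral mu) invr1 in h1.
have iup : leb.-integrable Omega (EFin \o (fun x => u x * psi x)).
  apply: (le_integrable mO _ _ (integrableZl mO M iiu)).
    by apply/measurable_EFinP/measurable_funM.
  move=> x _; rewrite lee_fin /= !normrM mulrC (ger0_norm M0).
  by rewrite ler_wpM2r.
apply: le_trans (le_normr_Rintegral mO iup) _.
rewrite -lee_fin EFinM; apply: (@le_trans _ _ (M%:E * \int[leb]_(x in Omega) (`|u x|)%:E)%E); last first.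
  by apply: lee_wpmul2l h1; rewrite lee_fin.
rewrite /Rintegral fineK; last first.
  by apply: integrable_fin_num => //; have := integrable_norm iup; exact.
rewrite -ge0_integralZl//; last by apply/measurable_EFinP; exact: measurableT_comp.
apply: ge0_le_integral => //.
- by apply/measurable_EFinP/measurableT_comp => //; exact: measurable_funM.
- by apply/measurable_EFinP/measurable_funM => //; exact: measurableT_comp.
by move=> x _; rewrite -EFinM lee_fin normrM mulrC ler_wpM2r.
Qed.

(** For a fixed test function both sides of the defining identity are continuous in the L^p norm by
    [Rintegral_normL_le], so the identity passes from the approximating pairs to the limit. *)
Lemma W1p_grad_closed u G : inL Omega p%:E u -> inLG Omega p G ->
  (forall e, 0 < e -> exists v H, [/\ W1p_grad Omega p v H,
    (normL Omega p%:E (fun x => v x - u x)%R <= e%:E)%E &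
    (normG Omega p (fun x => H x - G x)%R <= e%:E)%E]) ->
  W1p_grad Omega p u G.
Proof.
move=> iu iG near; split => //; split; first exact: inL_loc_integrable.
  by move=> i; apply: inL_loc_integrable; exact: iG.
move=> i phi tphi; have [M [M0 M1]] := test_bounded tphi.
have sphi := test_smooth tphi.
have M00 : 0 <= M by exact: le_trans (M0 0).
have mphi : measurable_fun Omega phi.
  by apply: measurable_funTS; exact: continuous_measurable_rV (smooth_continuous sphi).
have mdphi : measurable_fun Omega (partial i phi).
  apply: measurable_funTS.
  exact: continuous_measurable_rV (smooth_continuous (smooth_partial i sphi)).
apply/eqP; rewrite -subr_eq0 opprK -normr_le0; apply/ler_addgt0Pr => e e0; rewrite add0r.
pose C := M * m `^ (1 - p^-1).
have C0 : 0 <= C by rewrite mulr_ge0 ?powR_ge0.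
have d0 : 0 < e / (2 * (C + 1)) by rewrite divr_gt0// mulr_gt0// ltr_wpDl.
have [v [H [hv vu HG]]] := near _ d0; have [iv [lv lH vH] iH] := hv.
have [_ /(_ i) i1] := integrable_loc_test oO (inL_loc_integrable iu) tphi.
have [_ /(_ i) i2] := integrable_loc_test oO lv tphi.
have [i3 _] := integrable_loc_test oO (inL_loc_integrable (iG i)) tphi.
have [i4 _] := integrable_loc_test oO (lH i) tphi.
have ivu := inLB iv iu; have iHG := inLGB iH iG.
have e1 := Rintegral_normL_le ivu mdphi M00 (M1 i).
have e2 := Rintegral_normL_le (iHG i) mphi M00 M0.
have E1 : \int[leb]_(x in Omega) ((v x - u x) * partial i phi x) =
    \int[leb]_(x in Omega) (v x * partial i phi x) - \int[leb]_(x in Omega) (u x * partial i phi x).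
  by rewrite -RintegralB//; apply: eq_Rintegral => x _; rewrite mulrBl.
have E2 : \int[leb]_(x in Omega) ((H x - G x) 0 i * phi x) =
    \int[leb]_(x in Omega) (H x 0 i * phi x) - \int[leb]_(x in Omega) (G x 0 i * phi x).
  by rewrite -RintegralB//; apply: eq_Rintegral => x _; rewrite !mxE mulrBl.
have vHi := vH i phi tphi; rewrite E1 vHi in e1; rewrite E2 in e2.
have f1 : fine (normL Omega p%:E (fun x => v x - u x)) <= e / (2 * (C + 1)).
  by rewrite -lee_fin (fineK (normL_fin mO ivu)).
have f2 : fine (normL Omega p%:E (fun x => (H x - G x) 0 i)) <= e / (2 * (C + 1)).
  rewrite -lee_fin (fineK (normL_fin mO (iHG i))).
  exact: le_trans (normL_coord_le i iHG) HG.
have CC (t : R) : t <= e / (2 * (C + 1)) -> M * (t * m `^ (1 - p^-1)) <= e / 2.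
  move=> te; rewrite mulrCA -/C.
  apply: (@le_trans _ _ (e / (2 * (C + 1)) * C)); first by rewrite ler_wpM2r.
  have -> : e / (2 * (C + 1)) * C = (e / 2) * ((C + 1)^-1 * C) by rewrite invfM !mulrA.
  rewrite ler_piMr ?divr_ge0 ?(ltW e0)//.
  by rewrite mulrC ler_pdivrMr ?ltr_wpDl// mul1r lerDl.
have {}e1 := le_trans e1 (CC _ f1); have {}e2 := le_trans e2 (CC _ f2).
move: e1 e2; move: (\int[leb]_(x in Omega) _) (\int[leb]_(x in Omega) _)
  (\int[leb]_(x in Omega) _) => a b c.
by rewrite !ler_norml => /andP[h1 h2] /andP[h3 h4]; apply/andP; split; lra.
Qed.

Lemma test_approx_closed u G : inL Omega p%:E u -> inLG Omega p G ->
  (forall e, 0 < e -> exists v H, [/\ W1p_grad Omega p v H, test_approx Omega p v H,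
    (normL Omega p%:E (fun x => v x - u x)%R <= e%:E)%E &
    (normG Omega p (fun x => H x - G x)%R <= e%:E)%E]) ->
  test_approx Omega p u G.
Proof.
move=> iu iG near e e0; have e4 : 0 < e / 4 by rewrite divr_gt0.
have [v [H [hv av vu HG]]] := near _ e4; have [iv _ iH] := hv.
have [phi tphi Hphi] := av _ e4; exists phi => //.
have [iphi _ iphiG] := W1p_grad_test oO p1 Ooo tphi.
have ivu := inLB iv iu; have iHG := inLGB iH iG.
have ivp := inLB iv iphi; have iHp := inLGB iH iphiG.
have /(inLP mO)[m1 _] := ivp; have /(inLP mO)[m2 _] := ivu.
have m3 : measurable_fun Omega (fun x => -1 * (v x - u x)) by exact: measurable_funM.
have h1 := normLD mO p1 m1 m3; rewrite (normLZ mO p1 (-1) m2) normrN1 mul1e in h1.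
have h2 := normGD oO p1 (-1) iHp iHG; rewrite normrN1 mul1e in h2.
have E1 : (fun x => v x - phi x + -1 * (v x - u x)) = (fun x => u x - phi x).
  by apply/funext => x; ring.
have E2 : (fun x => H x - cgrad phi x + -1 *: (H x - G x)) = (fun x => G x - cgrad phi x).
  by apply/funext => x; apply/rowP => i; rewrite !mxE; ring.
rewrite E1 in h1; rewrite E2 in h2; apply: le_lt_trans (leeD h1 h2) _.
have f1 := normL_fin mO ivp; have f2 := normL_fin mO ivu.
have f3 := normG_fin oO p1 iHp; have f4 := normG_fin oO p1 iHG.
move: Hphi vu HG f1 f2 f3 f4.
move: (normL _ _ _) (normL _ _ _) (normG _ _ _) (normG _ _ _) => [a||] [b||] [c||] [d||]//.
by rewrite -!EFinD !lte_fin !lee_fin => *; lra.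
Qed.

End closedness.

(** * The limit is extremal *)

Section limit_extremal.
Context {R : realType} {n : nat} (Omega : set 'rV[R]_n) (p m rho : R).
Local Notation leb := (@lebesgue_rV R n).
Hypothesis oO : open Omega.
Hypothesis Om : leb Omega = m%:E.
Hypothesis m0 : 0 < m.
Hypothesis Orho : forall x, Omega x -> `|x| <= rho.
Hypothesis n0 : (0 < n)%N.
Hypotheses (p2 : 2 <= p) (np : n%:R < p).
Variable w : R -> 'rV[R]_n -> R.
Hypothesis hw : forall q : R, 1 <= q -> positive_extremal Omega p q (w q).
Variable g : 'rV[R]_n -> R.
Variable q_ : nat -> R.
Hypothesis q_ge : forall k, k.+1%:R <= q_ k.
Hypothesis q_g : forall k x, closure Omega x -> `|w (q_ k) x - g x| <= k.+1%:R^-1.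

Let mO : measurable Omega. Proof. exact: open_measurable_rV. Qed.
Let p1 : 1 <= p. Proof. by rewrite (le_trans _ p2)// ler1n. Qed.
Let p0 : 0 < p. Proof. exact: lt_le_trans p1. Qed.
Let Ooo : (leb Omega < +oo)%E. Proof. by rewrite Om ltry. Qed.

Let q_ge1 k : 1 <= q_ k.
Proof. by apply: le_trans (q_ge k); rewrite ler1n. Qed.

Let wb k := CW01p_wgrad oO Om p2 hw (q_ge1 k).

Let g1 x : Omega x -> `|g x| <= 1.
Proof.
move=> Ox; rewrite ger0_norm; first exact: (limit_le1 oO Om p2 hw q_ge q_g).
exact: (limit_ge0 oO Om p2 hw q_ge q_g (subset_closure Ox)).
Qed.

Let cg : {within closure Omega, continuous g}.
Proof. exact: (limit_continuous oO Om p2 hw q_ge q_g). Qed.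

Let mg : measurable_fun Omega g.
Proof.
apply: (measurable_fun_cvg (fun k => CW01p_grad_measurable oO (wb k))) => x Ox.
apply/cvgrPdist_le => e e0; have [K HK] := inv_small e0.
exists K => // k /= Kk; rewrite distrC.
exact: le_trans (q_g k (subset_closure Ox)) (ltW (HK k Kk)).
Qed.

Let ig : inL Omega p%:E g.
Proof. exact: (inL_bounded mO p1 Ooo mg g1). Qed.

Lemma normL_limit e : 0 < e -> exists K, forall k, (K <= k)%N ->
  (normL Omega p%:E (fun x => w (q_ k) x - g x)%R <= e%:E)%E.
Proof.
move=> e0; have c0 : 0 < m `^ p^-1 by exact: powR_gt0.
have [K HK] := inv_small (divr_gt0 e0 c0); exists K => k Kk.
have mB : measurable_fun Omega (fun x => w (q_ k) x - g x).
  by apply: measurable_funB => //; exact: (CW01p_grad_measurable oO (wb k)).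
have k0 : 0 <= k.+1%:R^-1 :> R by [].
apply: le_trans (normL_le_bound mO Om p1 k0 mB _) _.
  by move=> x /subset_closure; exact: q_g.
by rewrite lee_fin -ler_pdivlMr// ltW// HK.
Qed.

Lemma gradient_limit : exists2 G, inLG Omega p G & forall e, 0 < e ->
  exists K, forall k, (K <= k)%N ->
  (normG Omega p (fun x => wgrad Omega p w (q_ k) x - G x)%R <= e%:E)%E.
Proof.
apply: (normG_complete oO Om p1 n0).
  by move=> k; have [[]] := wb k.
move=> e e0; exact: (gradient_cauchy oO Om m0 Orho n0 p2 np hw q_ge q_g e0).
Qed.

Variable G : 'rV[R]_n -> 'rV[R]_n.
Hypothesis iG : inLG Omega p G.
Hypothesis wG : forall e, 0 < e -> exists K, forall k, (K <= k)%N ->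
  (normG Omega p (fun x => wgrad Omega p w (q_ k) x - G x)%R <= e%:E)%E.

Lemma limit_CW01p_grad : CW01p_grad Omega p g G.
Proof.
have near e : 0 < e -> exists v H, [/\ W1p_grad Omega p v H, test_approx Omega p v H,
    (normL Omega p%:E (fun x => v x - g x)%R <= e%:E)%E &
    (normG Omega p (fun x => H x - G x)%R <= e%:E)%E].
  move=> e0; have [K1 HK1] := normL_limit e0; have [K2 HK2] := wG e0.
  exists (w (q_ (maxn K1 K2))), (wgrad Omega p w (q_ (maxn K1 K2))).
  have [h a _] := wb (maxn K1 K2); split => //.
    by apply: HK1; exact: leq_maxl.
  by apply: HK2; exact: leq_maxr.
split; last exact: cg; last exact: (test_approx_closed oO Om p1 ig iG near).
apply: (W1p_grad_closed oO Om p1 ig iG) => e /near[v [H [h _ h1 h2]]].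
by exists v, H.
Qed.

Let iwG k : inLG Omega p (fun x => wgrad Omega p w (q_ k) x - G x).
Proof. by apply: (inLGB oO p1) => //; have [[]] := wb k. Qed.

Let iw k : inL Omega p%:E (fun x => w (q_ k) x - g x).
Proof. by apply: (inLB oO p1) => //; have [[]] := wb k. Qed.

Lemma normW1p_limit : normW1p Omega p (fun x => w (q_ k) x - g x) @[k --> \oo] --> 0%E.
Proof.
pose r k := fine (normL Omega p%:E (fun x => w (q_ k) x - g x)) +
  fine (normG Omega p (fun x => wgrad Omega p w (q_ k) x - G x)).
have -> : (fun k => normW1p Omega p (fun x => w (q_ k) x - g x)) = (fun k => (r k)%:E).
  apply/funext => k; have [h _ _] := wb k; have [h' _ _] := limit_CW01p_grad.
  have hB := W1p_gradB oO p1 h h'.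
  rewrite (normW1pE oO p1 hB) /r EFinD.
  by rewrite (fineK (normL_fin mO (iw k))) (fineK (normG_fin oO p1 (iwG k))).
apply: cvg_EFin; first exact: nearW.
apply/cvgrPdist_le => e e0; have e2 : 0 < e / 2 by rewrite divr_gt0.
have [K1 HK1] := normL_limit e2; have [K2 HK2] := wG e2.
exists (maxn K1 K2) => // k /=; rewrite geq_max => /andP[k1 k2].
have h1 := HK1 k k1; rewrite -(fineK (normL_fin mO (iw k))) lee_fin in h1.
have h2 := HK2 k k2; rewrite -(fineK (normG_fin oO p1 (iwG k))) lee_fin in h2.
rewrite sub0r normrN ger0_norm; first by rewrite /r (splitr e) lerD.
by rewrite addr_ge0// fine_ge0// ?normL_ge0// normG_ge0.
Qed.

Lemma normG_limit :
  fine (normG Omega p (wgrad Omega p w (q_ k))) @[k --> \oo] --> fine (normG Omega p G).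
Proof.
apply/cvgrPdist_le => e e0; have [K HK] := wG e0.
exists K => // k /= Kk; have [[_ _ ik] _ _] := wb k.
have h := HK k Kk.
have f1 := normG_fin oO p1 ik; have f2 := normG_fin oO p1 iG.
have f3 := normG_fin oO p1 (iwG k).
have h1 := normGD oO p1 1 iG (iwG k); have h2 := normGD oO p1 (-1) ik (iwG k).
have E1 : (fun x => G x + 1 *: (wgrad Omega p w (q_ k) x - G x)) = wgrad Omega p w (q_ k).
  by apply/funext => x; rewrite scale1r addrC subrK.
have E2 : (fun x => wgrad Omega p w (q_ k) x + -1 *: (wgrad Omega p w (q_ k) x - G x)) = G.
  by apply/funext => x; rewrite scaleN1r opprB addrC subrK.
rewrite E1 in h1; rewrite E2 in h2.
rewrite normr1 mul1e in h1; rewrite normrN1 mul1e in h2.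
move: h h1 h2 f1 f2 f3.
move: (normG _ _ _) (normG _ _ _) (normG _ _ _) => [a||] [b||] [c||]//.
rewrite -!EFinD !lee_fin /= => h h1 h2 _ _ _.
by rewrite ler_norml; apply/andP; split; lra.
Qed.

(** The energies along the sequence have two limits that must agree: one by strong convergence of
    the gradients, the other by convergence of [rlambda]. *)
Lemma energy_limit : energyG Omega p G = rLambda Omega p m w.
Proof.
have c1 : rlambda Omega p w (q_ k) @[k --> \oo] --> energyG Omega p G.
  exact: (cvg_powR p0 (fun k => fine_ge0 (normG_ge0 _ _ _)) normG_limit).
have c2 := cvg_comp _ _ (q_cvgy q_ge) (rlambda_cvg oO Om m0 Orho n0 p2 np hw).
exact: (cvg_unique _ c1 c2).
Qed.

(** The essential supremum could only drop below the supremum if some superlevel set were null, but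
    superlevel sets of a continuous function are open and have positive measure when nonempty. *)
Lemma limit_normL_pinfty : normL Omega +oo%E g = 1%E.
Proof.
have [x0 Ox0 _] := limit_sup oO Om m0 p2 hw q_ge q_g ltr01.
(* The norm of index [+oo] is the essential supremum only when the whole space has positive
   measure. *)
have l0 : (0 < leb setT)%E.
  have Opos : (0 < leb Omega)%E by rewrite Om lte_fin.
  by apply: lt_le_trans Opos _; apply: le_measure; [exact: mem_set|exact: mem_set|exact: subsetT].
rewrite /normL unlock l0; apply/eqP; rewrite eq_le; apply/andP; split.
  apply/ess_supP; apply: aeW => x /=; rewrite patchE; case: ifPn => [/set_mem Ox|_].
    by rewrite lee_fin; exact: g1.
  by rewrite normr0 lee_fin.
rewrite leNgt; apply/negP => H.
have S0 : (0 <= ess_sup leb (abse \o (EFin \o (g \_ Omega))))%E by apply: ess_sup_gee => //; apply: aeW => x /=; rewrite lee_fin.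
move: H S0; set S := ess_sup _ _ => H S0.
have Sf : S \is a fin_num by rewrite ge0_fin_numE// (lt_trans H)// ltry.
have Sle : (S <= (fine S)%:E)%E by rewrite fineK.
rewrite -(fineK Sf) lte_fin in H.
have [x Ox gx] := limit_sup oO Om m0 p2 hw q_ge q_g H.
have [d d0 dE] := superlevel_lebesgue oO Om cg Ox gx.
have mU : measurable [set y | Omega y /\ fine S < g y].
  by apply: open_measurable_rV; exact: (open_superlevel oO cg).
have /ess_supP[N [mN N0 SN]] := Sle.
suff : (leb [set y | Omega y /\ (fine S < g y)%R] <= leb N)%E.
  by rewrite N0 dE lee_fin leNgt d0.
apply: le_measure; [exact: mem_set|exact: mem_set|move=> y [Oy gy]; apply: SN => /=].
rewrite patchE mem_set// lee_fin => h; move: gy; apply/negP; rewrite -leNgt.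
exact: le_trans (ler_norm _) h.
Qed.

End limit_extremal.

Unset Implicit Arguments.

Theorem theorem2p3 (R : realType) (N : nat) (hN : (2 <= N)%N)
    (Omega : set 'rV[R]_N) (Omega_domain : domain Omega)
    (Omega_bounded : bounded_set Omega) (Omega_smooth : smooth_boundary Omega)
    (p : R) (hp : N%:R < p)
    (w_ : R -> 'rV[R]_N -> R)
    (w_extremal : forall q : R, 1 <= q -> positive_extremal Omega p q (w_ q)) :
  exists (q_ : nat -> R) (w : 'rV[R]_N -> R),
    [/\ (forall n, 1 <= q_ n) /\ q_ n @[n --> \oo] --> +oo,
        (forall x, closure Omega x -> 0 <= w x) /\ CW01p Omega p w,
        {uniform closure Omega, (fun n => w_ (q_ n)) @ \oo --> w},
        normW1p Omega p (fun x => w_ (q_ n) x - w x) @[n --> \oo] --> 0%E &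
        extremal_Lambda Omega p w].
Proof.
have [[x0 Ox0] _ oO] := Omega_domain.
have mO : measurable Omega by exact: open_measurable_rV.
have n0 : (0 < N)%N by exact: ltnW.
have p2 : 2 <= p by apply: ltW; apply: le_lt_trans hp; rewrite ler_nat.
have [rho Orho] : exists rho, forall x, Omega x -> `|x| <= rho.
  have [M [_ HM]] := Omega_bounded; exists (M + 1) => x Ox.
  by apply: HM => //; rewrite ltrDl.
have Om : lebesgue_rV N Omega = (fine (lebesgue_rV N Omega))%:E.
  by rewrite fineK// ge0_fin_numE//; exact: lebesgue_rV_bounded Orho.
have m0 : 0 < fine (lebesgue_rV N Omega).
  by rewrite -lte_fin -Om; exact: (lebesgue_rV_open_gt0 oO Ox0).
have [g gP] := extremals_cluster oO Om m0 Orho n0 p2 hp w_extremal.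
(* The same [k] bounds the exponent from below and the uniform error from above, so the chosen
   exponents diverge while the extremals converge. *)
have H k : exists q, k.+1%:R <= q /\ forall x, closure Omega x -> `|w_ q x - g x| <= k.+1%:R^-1.
  by have [|q] := gP k.+1%:R^-1 k.+1%:R; [rewrite invr_gt0|exists q].
have [q_ qP] := choice H.
have q_ge k : k.+1%:R <= q_ k by have [] := qP k.
have q_g k x : closure Omega x -> `|w_ (q_ k) x - g x| <= k.+1%:R^-1 by have [_] := qP k; apply.
have q_ge1 k : 1 <= q_ k by apply: le_trans (q_ge k); rewrite ler1n.
have [G iG wG] := gradient_limit oO Om m0 Orho n0 p2 hp w_extremal q_ge q_g.
have gG := limit_CW01p_grad oO Om m0 p2 w_extremal q_ge q_g iG wG.
have cw : CW01p Omega p g by apply/(CW01pP oO Om p2); exists G.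
exists q_, g; split.
- by split => //; exact: q_cvgy.
- by split => // x; exact: (limit_ge0 oO Om p2 w_extremal q_ge q_g).
- move=> P /uniform_nbhs[E [entE EP]].
  have [e /= e0 eE] : exists2 e : R, 0 < e & forall a b : R, `|a - b| < e -> E (a, b).
    move: entE; rewrite -entourage_ballE => -[e /= e0 eE]; exists e => // a b ab.
    by apply: eE; rewrite /= -ball_normE.
  have [K HK] := inv_small e0; exists K => // k /= Kk; apply: EP => x cx.
  by apply: eE; rewrite distrC; exact: le_lt_trans (q_g k x cx) (HK k Kk).
- exact: (normW1p_limit oO Om m0 p2 w_extremal q_ge q_g iG wG).
have [h _ _] := gG; have p1 : 1 <= p by rewrite (le_trans _ p2)// ler1n.
split => //; last exact: (limit_normL_pinfty oO Om m0 p2 w_extremal q_ge q_g).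
rewrite (energyE oO p2 h) (LambdaE oO Om m0 Orho n0 p2 hp w_extremal).
by congr _%:E; exact: (energy_limit oO Om m0 Orho n0 p2 hp w_extremal q_ge iG wG).
Qed.
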